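(* Let $\eta>0$, let $1\le p\le+\infty$, let $u_0\in L^p(\mathbb{R})$ be an initial datum, and let $T>0$. Then there exists $\delta=\delta(T)>0$ such that if $\|u_0\|_{L^p}<\delta$, then the integral equation $$u(t,x)=K_\eta(t,\cdot)*u_0(x)-\frac12\int_0^tK_\eta(t-\tau,\cdot)*\partial_x(u^2)(\tau,\cdot)(x)\,d\tau$$ possesses a unique local in time solution $u\in L^\infty(]0,T[,L^p(\mathbb{R}))$ which verifies $\sup_{0<t<T}t^{\frac13}\|u(t,\cdot)\|_{L^p}<+\infty$.
   Context: Here $\mathcal{F}^{-1}g(x)=\frac1{2\pi}\int_{\mathbb{R}}e^{ix\xi}g(\xi)\,d\xi$, and for $\eta>0$, $t>0$ the kernel is $K_\eta(t,x)=\mathcal{F}^{-1}\big(e^{i\xi^3t-\eta t(|\xi|^3-|\xi|)}\big)(x)$; $*$ denotes convolution in $x$. The nonlinear term is understood as $K_\eta(t-\tau,\cdot)*\partial_x(u^2)(\tau,\cdot)=\partial_xK_\eta(t-\tau,\cdot)*u^2(\tau,\cdot)$. The parameter $\eta>0$ is fixed, so $\delta$ may also depend on $\eta$. *)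

(* Defs.v *)
From HB Require Import structures.
From mathcomp Require Import all_boot all_order all_algebra.
From mathcomp Require Import all_classical all_reals all_analysis.
From mathcomp Require Import measurable_realfun complex ring.

Set Implicit Arguments.
Unset Strict Implicit.
Unset Printing Implicit Defensive.
Import Order.TTheory GRing.Theory Num.Theory.
Import numFieldNormedType.Exports.

Local Open Scope classical_set_scope.
Local Open Scope complex_scope.
Local Open Scope ring_scope.

Definition cexp (R : realType) (z : R[i]) : R[i] :=
  (expR (complex.Re z))%:C * (cos (complex.Im z) +i* sin (complex.Im z)).

Definition cintegral (R : realType) (g : R -> R[i]) : R[i] :=
  (\int[@lebesgue_measure R]_x complex.Re (g x)) +i*
  (\int[@lebesgue_measure R]_x complex.Im (g x)).

Definition invFourier (R : realType) (g : R -> R[i]) (x : R) : R[i] :=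
  ((2 * pi)^-1)%:C * cintegral (fun xi => cexp (0 +i* (x * xi)) * g xi).

Definition Ksymbol (R : realType) (eta t xi : R) : R[i] :=
  cexp ((- (eta * t * (`|xi| ^+ 3 - `|xi|))) +i* (xi ^+ 3 * t)).

(* Taking the real part loses nothing: see [Im_invFourier_Ksymbol] and
   [KernelE] below. *)
Definition Kernel (R : realType) (eta t x : R) : R :=
  complex.Re (invFourier (Ksymbol eta t) x).

Definition dxKernel (R : realType) (eta t : R) : R -> R := derive1 (Kernel eta t).

Definition conv (R : realType) (f g : R -> R) (x : R) : R :=
  \int[@lebesgue_measure R]_y (f (x - y) * g y).

(* u is a representative of a class in L^oo(]0, T[, L^p(R)); its values at
   times outside ]0, T[ are irrelevant. *)
Definition Linfty_Lp (R : realType) (T : R) (p : \bar R) (u : R -> R -> R)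
    : Prop :=
  measurable_fun (`]0, T[ `*` [set: R]) (fun z : R * R => u z.1 z.2) /\
  exists M : R, {ae @lebesgue_measure R, forall t, t \in `]0, T[ ->
    ('N[lebesgue_measure]_p[EFin \o u t] <= M%:E)%E}.

Definition sup_weighted_norm (R : realType) (T : R) (p : \bar R)
    (u : R -> R -> R) : \bar R :=
  ereal_sup [set ((t `^ (3%:R^-1))%:E *
                  'N[lebesgue_measure]_p[EFin \o u t])%E | t in `]0%R, T[].

(* Absolute convergence of the Duhamel integral at (t, x).  It must be part of
   the notion of solution since Lebesgue integrals are total functions here,
   and for p < 2 a function u in L^oo(]0, T[, L^p) need not have a locally
   integrable square. *)
Definition duhamel_cvg (R : realType) (eta : R) (u : R -> R -> R) (t x : R)
    : Prop :=
  (@lebesgue_measure R \x @lebesgue_measure R)%E.-integrable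
    (`]0, t[ `*` [set: R])
    (fun z : R * R => (dxKernel eta (t - z.1) (x - z.2) * u z.1 z.2 ^+ 2)%:E).

(* K * d_x(u^2) is understood as (d_x K) * u^2, so no derivative of u occurs. *)
Definition duhamel (R : realType) (eta : R) (u : R -> R -> R) (t x : R) : R :=
  \int[@lebesgue_measure R]_(tau in `]0, t[)
    conv (dxKernel eta (t - tau)) (fun y => u tau y ^+ 2) x.

Definition mild_solution (R : realType) (eta T : R) (u0 : R -> R)
    (u : R -> R -> R) : Prop :=
  {ae @lebesgue_measure R, forall t, t \in `]0, T[ ->
    {ae @lebesgue_measure R, forall x,
      duhamel_cvg eta u t x /\
      u t x = conv (Kernel eta t) u0 x - 2%:R^-1 * duhamel eta u t x}}.

Section Kernel_is_real.
Context (R : realType).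
Local Notation mu := (@lebesgue_measure R).

Local Open Scope ereal_scope.

Let ge0_integral_opp (f : R -> \bar R) :
  measurable_fun [set: R] f -> (forall r, 0 <= f r) ->
  \int[mu]_r f r = \int[mu]_r f (- r)%R.
Proof.
move=> mf f0.
rewrite -[in RHS](_ : (-%R : _ -> measurableTypeR R) @^-1` setT = setT)//.
rewrite -ge0_integral_pushforward//=.
by apply: eq_measure_integral => //= A mA _; exact/esym/lebesgue_measureN.
Qed.

Local Close Scope ereal_scope.

Let Rintegral_odd (f : R -> R) : measurable_fun [set: R] f ->
  (forall x, f (- x) = - f x) -> \int[mu]_x f x = 0.
Proof.
move=> mf fodd; rewrite /Rintegral integralE.
have -> : (\int[mu]_x (fun x => (f x)%:E)^\- x)%E =
          (\int[mu]_x (fun x => (f x)%:E)^\+ x)%E.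
  rewrite [RHS]ge0_integral_opp//.
  - by apply: eq_integral => x _; rewrite funeposE funenegE /= fodd.
  - by apply: measurable_funepos; exact: measurableT_comp.
by case: (\int[mu]_x _)%E => [r| |] //=; rewrite subrr.
Qed.

Lemma Im_invFourier_Ksymbol (eta t x : R) :
  complex.Im (invFourier (Ksymbol eta t) x) = 0.
Proof.
rewrite /invFourier /cintegral /Ksymbol /cexp /= !(mul0r, addr0, subr0).
rewrite Rintegral_odd ?mulr0 ?addr0//=; last first.
  move=> xi; rewrite mulrN normrN exprNn -signr_odd /= expr1 mulN1r mulNr.
  by rewrite !(sinN, cosN); ring.
have mX : measurable_fun [set: R] (fun xi : R => xi ^+ 3 * t).
  by apply: measurable_funM => //; exact: exprn_measurable.
have mx : measurable_fun [set: R] (fun xi : R => x * xi).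
  exact: measurable_funM.
have me : measurable_fun [set: R]
    (fun xi : R => expR (- (eta * t * (`|xi| ^+ 3 - `|xi|)))).
  apply: measurableT_comp => //; apply: measurableT_comp => //.
  apply: measurable_funM => //; apply: measurable_funB => //.
  exact: measurable_funX.
have msin (f : R -> R) : measurable_fun [set: R] f ->
    measurable_fun [set: R] (fun xi => sin (f xi)).
  move=> mf; apply: measurableT_comp => //; apply: continuous_measurable_fun.
  exact: continuous_sin.
have mcos (f : R -> R) : measurable_fun [set: R] f ->
    measurable_fun [set: R] (fun xi => cos (f xi)).
  move=> mf; apply: measurableT_comp => //; apply: continuous_measurable_fun.
  exact: continuous_cos.
rewrite expR0.
apply: measurable_funD; apply: measurable_funM;
  (apply: measurable_funB || apply: measurable_funD);
  by apply: measurable_funM => //; (apply: msin || apply: mcos).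
Qed.

Lemma KernelE (eta t x : R) :
  (Kernel eta t x)%:C = invFourier (Ksymbol eta t) x.
Proof.
rewrite /Kernel; have := Im_invFourier_Ksymbol eta t x.
by case: (invFourier _ _) => a b /= ->.
Qed.

End Kernel_is_real.

(* Main.v *)
From HB Require Import structures.
Require Import Defs.
From mathcomp Require Import all_boot all_order all_algebra.
From mathcomp Require Import all_classical all_reals all_analysis.
From mathcomp Require Import measurable_realfun complex ring lra.

(** The symbol of the kernel [K] decays like [exp (- eta t |xi|^3)] and has a cusp [|xi|]
    at the origin.  Integrating by parts on each half line in frequency therefore
    gives, with [r = cbrt t] and for bounded times,

      [|K t x| <= C r / (r^2 + x^2)]   and   [|d_x K t x| <= C r / (r + |x|)^3]

    ([kernel_bounds]).  The cusp also makes the second bound sharp: [x^3 d_x K t x] has a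
    nonzero limit at infinity ([kernel_tail_lower]).  By Fourier inversion, [K] is a
    convolution semigroup, and the convolution of [K s] with [d_x K t] is [d_x K (s + t)]
    ([Kernel_semigroup], [dxKernel_semigroup]).

    Existence.  Let [U t x] be the integral of [|u0|] against the Poisson kernel of
    scale [cbrt t] centred at [x].  The linear part of the equation is at most [C U].
    Poisson kernels convolve additively in the scale, and [U <= C d / r] when [u0] has
    norm at most [d] in [L^p], whatever [p].  Hence the integral in space of
    [|d_x K (t - s)| U(s)^2] is at most [C d U(t) / (cbrt (t - s) cbrt s)], which is
    integrable in [s] ([duhamel_majorant]).  If [d] is small, the iteration map preserves
    the functions bounded pointwise by [W = 2 C U] and contracts their differences
    measured in units of [W].  The iterates converge pointwise, and Jensen's inequality bounds the
    [L^p] norm of [U t] by that of [u0] ([pois_average_Lnorm]).  A single smallness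
    condition thus serves all exponents.

    Uniqueness.  For small [p] the square of a solution [v] need not be integrable, so
    the difference of two solutions cannot be estimated in [L^p] directly.  The
    argument has four steps.

    - Absolute convergence of the Duhamel integral at two distant points of one time
      [t], together with the lower bound for the tail of [d_x K], shows that [v^2] is
      integrable over [ ]0, t1[ x R] with the weight [(1 + |x|)^(-3)], for every
      [t1 < t] ([strip_sq_weight_finite]).

    - By the semigroup law the equation can be restarted at almost every time [t0].
      Taking the difference of two points in space makes the kernels decay like the
      weight, which legitimates Fubini's theorem; averaging over the second point
      brings in the [L^p] norm only.  With [s = t - t0] the outcome is
      [|v| <= C / cbrt s + C cbrt s V(v^2)], where [V] is a linear Volterra operator with
      a weakly singular kernel ([averaged_inequality]).

    - Choosing [s] of the order of [|v|^(-3)] turns this into a linear inequality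
      [v^2 <= C t^(-2/3) + C V(v^2)] ([linear_inequality]).

    - A large exponential weight in time makes [V] a contraction of the weighted [L^1]
      space, so a nonnegative function dominated by its image under [C V] vanishes
      ([vkers_vanish]).  Applied to the part of [v^2] above a barrier of order
      [t^(-2/3)], this gives [|v| <= C t^(-1/3)] ([solution_decay]); applied next to
      [t^(-1/3)] times the difference of two solutions, it gives uniqueness
      ([decaying_solutions_eq]). *)

Set Implicit Arguments.
Unset Strict Implicit.
Unset Printing Implicit Defensive.
Import Order.TTheory GRing.Theory Num.Theory.
Import numFieldNormedType.Exports.

Local Open Scope classical_set_scope.
Local Open Scope ring_scope.

(** Functions on the plane are annotated with this type to receive the product of the
    Borel sigma-algebras. *)
Local Notation plane R := (measurableTypeR R * measurableTypeR R)%type (only parsing).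

(** * Integration on the line *)

Section affine_change_of_variables.
Context (R : realType).
Local Notation mu := (@lebesgue_measure R).
Local Open Scope ereal_scope.

Lemma lebesgue_measure_shift (c : R) (A : set R) : measurable A ->
  pushforward mu ((fun x => (x + c)%R) : measurableTypeR R -> measurableTypeR R) A = mu A.
Proof.
move=> mA; apply/esym/lebesgue_measure_unique => //=.
  by apply: measurable_funD.
move=> mf _ [[a b]] _ <-.
rewrite /pushforward.
have -> : (fun x : R => (x + c)%R) @^-1` `]a, b] = `](a - c)%R, (b - c)%R]%classic.
  by apply/seteqP; split => x /=; rewrite !in_itv/= ltrBlDr lerBrDr.
rewrite !lebesgue_measure_itv/= !lte_fin ltrD2r.
by case: ifPn => // _; rewrite -!EFinB opprB addrA subrK.
Qed.

Lemma ge0_integral_shift (c : R) (f : R -> \bar R) :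
  measurable_fun [set: R] f -> (forall x, 0 <= f x) ->
  \int[mu]_x f (x + c)%R = \int[mu]_x f x.
Proof.
move=> mf f0.
have mc : measurable_fun [set: measurableTypeR R]
    ((fun x => (x + c)%R) : _ -> measurableTypeR R) by exact: measurable_funD.
transitivity (\int[mu]_(x in ((fun x => (x + c)%R) : _ -> measurableTypeR R) @^-1` setT)
    (f \o (fun x => (x + c)%R)) x); first by rewrite preimage_setT.
rewrite -(ge0_integral_pushforward mc)//=.
by apply: eq_measure_integral => //= A mA _; exact: lebesgue_measure_shift.
Qed.

Lemma ge0_integral_opp (f : R -> \bar R) :
  measurable_fun [set: R] f -> (forall x, 0 <= f x) ->
  \int[mu]_x f (- x)%R = \int[mu]_x f x.
Proof.
move=> mf f0.
rewrite -[in LHS](_ : (-%R : _ -> measurableTypeR R) @^-1` setT = setT)//.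
rewrite -ge0_integral_pushforward//=.
by apply: eq_measure_integral => //= A mA _; exact/lebesgue_measureN.
Qed.

Lemma ge0_integral_subl (c : R) (f : R -> \bar R) :
  measurable_fun [set: R] f -> (forall x, 0 <= f x) ->
  \int[mu]_x f (c - x)%R = \int[mu]_x f x.
Proof.
move=> mf f0.
rewrite -[RHS](@ge0_integral_shift c)//.
rewrite -[RHS]ge0_integral_opp//.
- by apply: eq_integral => x _; rewrite addrC.
- by apply: measurableT_comp => //; exact: measurable_funD.
Qed.

Lemma ge0_integral_scale (a : R) (f : R -> \bar R) : (0 < a)%R ->
  measurable_fun [set: R] f -> (forall x, 0 <= f x) ->
  a%:E * \int[mu]_x f (a * x)%R = \int[mu]_x f x.
Proof.
move=> a0 mf f0.
have ma : measurable_fun [set: measurableTypeR R]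
    (( *%R a) : _ -> measurableTypeR R) by exact: measurable_funM.
rewrite (_ : \int[mu]_x f (a * x)%R = \int[mu]_(x in (( *%R a) : _ -> measurableTypeR R) @^-1` setT)
    (f \o ( *%R a)) x); last by rewrite preimage_setT.
rewrite -(ge0_integral_pushforward ma)//=.
pose na := NngNum (ltW a0).
rewrite (_ : a%:E = (na%:num)%:E)// -ge0_integral_mscale//.
apply: eq_measure_integral => //= A mA _; apply/esym.
apply: (lebesgue_measure_unique (mu := mscale na (pushforward mu (( *%R a) : _ -> measurableTypeR R)))) => // _ [[u v]] _ <-.
rewrite /mscale/= /pushforward.
transitivity (a%:E * mu `](u / a)%R, (v / a)%R]); last first.
  congr (_ * mu _); apply/seteqP; split => x /=;
  by rewrite !in_itv/= ltr_pdivrMr// ler_pdivlMr// mulrC.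
rewrite !lebesgue_measure_itv/= !lte_fin ltr_pM2r ?invr_gt0//.
case: ifPn => _; last by rewrite mule0.
by rewrite -EFinB -EFinM -mulrBl mulrC divfK ?gt_eqF.
Qed.

End affine_change_of_variables.

Section signed_change_of_variables.
Context (R : realType).
Local Notation mu := (@lebesgue_measure R).
Local Open Scope ereal_scope.

Lemma integral_shift (c : R) (f : R -> \bar R) : measurable_fun [set: R] f ->
  \int[mu]_x f (x + c)%R = \int[mu]_x f x.
Proof.
move=> mf; rewrite integralE [RHS]integralE.
have mp : measurable_fun [set: R] f^\+ by exact: measurable_funepos.
have mn : measurable_fun [set: R] f^\- by exact: measurable_funeneg.
by rewrite -(ge0_integral_shift c mp (funepos_ge0 f)) -(ge0_integral_shift c mn (funeneg_ge0 f)); congr (_ - _);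
  apply: eq_integral => x _; rewrite ?funeposE ?funenegE.
Qed.

Lemma integral_opp (f : R -> \bar R) : measurable_fun [set: R] f ->
  \int[mu]_x f (- x)%R = \int[mu]_x f x.
Proof.
move=> mf; rewrite integralE [RHS]integralE.
have mp : measurable_fun [set: R] f^\+ by exact: measurable_funepos.
have mn : measurable_fun [set: R] f^\- by exact: measurable_funeneg.
by rewrite -(ge0_integral_opp mp (funepos_ge0 f)) -(ge0_integral_opp mn (funeneg_ge0 f)); congr (_ - _);
  apply: eq_integral => x _; rewrite ?funeposE ?funenegE.
Qed.

Lemma integral_subl (c : R) (f : R -> \bar R) : measurable_fun [set: R] f ->
  \int[mu]_x f (c - x)%R = \int[mu]_x f x.
Proof.
move=> mf; rewrite integralE [RHS]integralE.
have mp : measurable_fun [set: R] f^\+ by exact: measurable_funepos.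
have mn : measurable_fun [set: R] f^\- by exact: measurable_funeneg.
by rewrite -(ge0_integral_subl c mp (funepos_ge0 f)) -(ge0_integral_subl c mn (funeneg_ge0 f)); congr (_ - _);
  apply: eq_integral => x _; rewrite ?funeposE ?funenegE.
Qed.

Lemma integrable_subl (c : R) (f : R -> \bar R) : mu.-integrable setT f ->
  mu.-integrable setT (fun x => f (c - x)%R).
Proof.
move=> /integrableP[mf fi]; have mf' : measurable_fun [set: R] f by [].
apply/integrableP; split.
  by apply: measurableT_comp => //; exact: measurable_funB.
have /= -> // := @ge0_integral_subl R c (abse \o f).
exact: measurableT_comp mf'.
Qed.

Lemma ge0_integral_even (f : R -> \bar R) : measurable_fun [set: R] f ->
  (forall x, 0 <= f x) -> (forall x, f (- x)%R = f x) ->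
  \int[mu]_x f x = \int[mu]_(x in `[0%R, +oo[) f x + \int[mu]_(x in `[0%R, +oo[) f x.
Proof.
move=> mf f0 fN.
have mfD (D : set R) : measurable_fun D f by exact: measurable_funTS.
rewrite [X in X + _](ge0_integration_by_substitution0 mf)//.
under [X in X + _]eq_integral do rewrite fN.
rewrite -[X in _ + X]integral_itv_obnd_cbnd// -ge0_integral_setU//=.
- congr (integral _ _ _); apply/seteqP; split => x //= _; rewrite !in_itv/= andbT.
  by have [?|?] := leP x 0%R; [left|right].
- exact: mfD.
- rewrite disj_set2E; apply/eqP; rewrite -subset0 => x /= []; rewrite !in_itv/= andbT => x0.
  by rewrite ltNge x0.
Qed.

Lemma integral_even (f : R -> \bar R) : mu.-integrable setT f ->
  (forall x, f (- x)%R = f x) ->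
  \int[mu]_x f x = 2%:E * \int[mu]_(x in `[0%R, +oo[) f x.
Proof.
move=> fi fN; have mf : measurable_fun setT f := measurable_int mu fi.
have fi0 : mu.-integrable `[0%R, +oo[ f by apply: integrableS fi.
have fp : \int[mu]_(x in `[0%R, +oo[) f^\+ x \is a fin_num.
  by apply: integrable_pos_fin_num.
have fn : \int[mu]_(x in `[0%R, +oo[) f^\- x \is a fin_num.
  by apply: integrable_neg_fin_num.
rewrite integralE [in RHS]integralE.
rewrite ge0_integral_even//; last 2 first.
  exact: measurable_funepos.
  by move=> x; rewrite !funeposE fN.
rewrite (@ge0_integral_even f^\-)//; last 2 first.
  exact: measurable_funeneg.
  by move=> x; rewrite !funenegE fN.
move: fp fn; case: (integral _ _ _) => [a| |]//; case: (integral _ _ _) => [b| |]// _ _.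
by rewrite -!EFinD -EFinM; congr (_%:E); ring.
Qed.

End signed_change_of_variables.

Section half_line_FTC.
Context (R : realType).
Local Notation mu := (@lebesgue_measure R).

(** The hypothesis at infinity is along the integers only, which is enough once the
    integral converges absolutely. *)
Lemma Rintegral_halfline (f F : R -> R) :
  mu.-integrable `[0, +oo[ (EFin \o f) -> continuous f ->
  (forall x, is_derive x (1 : R) F (f x)) ->
  F n%:R @[n --> \oo] --> 0 ->
  \int[mu]_(x in `[0, +oo[) f x = - F 0.
Proof.
move=> fi cf dF F0.
pose f_ n x : \bar R := ((f \_ `[0, n.+1%:R]) x)%:E.
have mf (D : set R) : measurable_fun D f.
  by apply: measurable_funTS; exact: continuous_measurable_fun.
have [] := @dominated_convergence _ _ R mu `[0, +oo[ (measurable_itv _) f_ (EFin \o f)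
    (fun x => `|f x|%:E).
- move=> n; apply/measurable_EFinP; apply: measurable_funTS.
  by apply/(measurable_restrictT f) => //.
- exact: measurableT_comp (mf _).
- apply/aeW => x x0; apply: cvg_EFin; first exact: nearW.
  apply: cvg_near_cst.
  near=> n; rewrite /f_/= patchE mem_set//=.
  move: x0; rewrite /= !in_itv/= andbT => -> /=.
  rewrite (le_trans (ler_norm _))//.
  rewrite (@le_trans _ _ n%:R)// ?ler_nat//.
  by near: n; exact: nbhs_infty_ger.
- exact: integrable_norm fi.
- apply/aeW => x n x0; rewrite /f_ lee_fin patchE; case: ifPn => //.
  by rewrite normr0.
move=> _ _ lim1.
have lim2 : (fun n => \int[mu]_(x in `[0%R, +oo[) f_ n x)%E @ \oo --> (- F 0)%:E.
  rewrite [X in X @ _](_ : _ = (fun n => (F n.+1%:R - F 0)%:E)); last first.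
    apply/funext => n.
    transitivity (\int[mu]_(x in `[0%R, n.+1%:R]) (f x)%:E)%E.
      rewrite /f_ [RHS]integral_mkcond [LHS]integral_mkcond.
      apply: eq_integral => x _; rewrite !patchE.
      by rewrite !mem_setE !in_itv/= andbT; case: leP => x0 //=; case: ifPn.
    rewrite (@continuous_FTC2 _ f F)//.
    - exact: continuous_subspaceT.
    - split.
      + by move=> x _; case: (dF x).
      + apply: cvg_at_right_filter; apply: differentiable_continuous.
        by apply/derivable1_diffP; case: (dF 0).
      + apply: cvg_at_left_filter; apply: differentiable_continuous.
        by apply/derivable1_diffP; case: (dF n.+1%:R).
    - by move=> x _; rewrite derive1E; case: (dF x).
  apply: cvg_EFin; first exact: nearW.
  rewrite -[X in _ --> X]add0r; apply: cvgB; last exact: cvg_cst.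
  by rewrite (cvg_shiftS (fun n => F n%:R)).
rewrite /Rintegral.
have -> // : (\int[mu]_(x in `[0%R, +oo[) (f x)%:E = (- F 0)%:E)%E.
by apply: cvg_unique lim1 lim2.
Unshelve. all: by end_near. Qed.

End half_line_FTC.

Section nonnegative_integrals.
Context d (T : measurableType d) (R : realType).
Variable m : {measure set T -> \bar R}.
Implicit Types f g : T -> R.

Lemma le_ge0_integral f g : (forall x, 0 <= f x) ->
  measurable_fun setT f -> measurable_fun setT g -> (forall x, f x <= g x) ->
  (\int[m]_x (f x)%:E <= \int[m]_x (g x)%:E)%E.
Proof.
move=> f0 mf mg fg; apply: ge0_le_integral => //.
- by move=> x _; rewrite lee_fin.
- exact/measurable_EFinP.
- exact/measurable_EFinP.
- by move=> x _; rewrite lee_fin.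
Qed.

Lemma ge0_integralMl (c : R) f : 0 <= c -> (forall x, 0 <= f x) ->
  measurable_fun setT f ->
  (\int[m]_x (c * f x)%:E = c%:E * \int[m]_x (f x)%:E)%E.
Proof.
move=> c0 f0 mf; under eq_integral do rewrite EFinM.
rewrite ge0_integralZl//; first exact/measurable_EFinP.
by move=> x _; rewrite lee_fin.
Qed.

Lemma ge0_integralDr f g : (forall x, 0 <= f x) -> (forall x, 0 <= g x) ->
  measurable_fun setT f -> measurable_fun setT g ->
  (\int[m]_x (f x + g x)%:E = \int[m]_x (f x)%:E + \int[m]_x (g x)%:E)%E.
Proof.
move=> f0 g0 mf mg; under eq_integral do rewrite EFinD.
rewrite ge0_integralD//.
- by move=> x _; rewrite lee_fin.
- exact/measurable_EFinP.
- by move=> x _; rewrite lee_fin.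
- exact/measurable_EFinP.
Qed.

End nonnegative_integrals.

(** Inversion is not continuous at [0]; writing it as [x * (x^2) `^ (-1)] reduces the claim
    to the measurability of real powers. *)
Lemma measurable_fun_invr d (T : measurableType d) (R : realType) (D : set T)
    (f : T -> R) :
  measurable_fun D f -> measurable_fun D (fun u => (f u)^-1).
Proof.
move=> mf; have -> : (fun u => (f u)^-1) = (fun u => f u * (f u ^+ 2) `^ (- 1)).
  apply/funext => u; rewrite powR_inv1 ?sqr_ge0//.
  have [->|fu0] := eqVneq (f u) 0; first by rewrite invr0 mul0r.
  by field.
apply: measurable_funM => //.
apply: (measurableT_comp (@measurable_powR R (- 1))) => //.
exact: measurable_funX.
Qed.

(** * Poisson-type kernels and the spatial weight *)

Section poisson_type_kernels.
Context (R : realType).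
Local Notation mu := (@lebesgue_measure R).
Implicit Types (a b r x y z : R).

(** [pois r / pi] is the Poisson kernel of scale [r]; it bounds the kernel at time [r^3].
    [gam r] bounds its derivative in space, and [wgt] is the decay of [gam] at unit scale. *)
Definition pois r z := r / (r ^+ 2 + z ^+ 2).
Definition gam r z := r / (r + `|z|) ^+ 3.
Definition wgt x := (1 + `|x|) ^- 3.

Lemma pois_ge0 r z : 0 <= r -> 0 <= pois r z.
Proof. by move=> r0; rewrite divr_ge0// addr_ge0// sqr_ge0. Qed.

Lemma gam_ge0 r z : 0 <= r -> 0 <= gam r z.
Proof. by move=> r0; rewrite divr_ge0// exprn_ge0// addr_ge0. Qed.

Lemma wgt_gt0 x : 0 < wgt x.
Proof. by rewrite invr_gt0 exprn_gt0// ltr_pwDl. Qed.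

Lemma wgt_ge0 x : 0 <= wgt x. Proof. exact/ltW/wgt_gt0. Qed.

Lemma gamN r z : gam r (- z) = gam r z. Proof. by rewrite /gam normrN. Qed.
Lemma poisN r z : pois r (- z) = pois r z. Proof. by rewrite /pois sqrrN. Qed.

Lemma continuous_pois r : 0 < r -> continuous (pois r).
Proof.
move=> r0 z; apply: cvgM; first exact: cvg_cst.
apply: cvgV; first by rewrite gt_eqF// ltr_pwDl ?exprn_gt0// sqr_ge0.
by apply: cvgD; [exact: cvg_cst|exact: exprn_continuous].
Qed.

Lemma measurable_pois d (T : measurableType d) (D : set T) (f g : T -> R) :
  measurable_fun D f -> measurable_fun D g ->
  measurable_fun D (fun u => pois (f u) (g u)).
Proof.
move=> mf mg; apply: measurable_funM => //.
apply: measurable_fun_invr.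
by apply: measurable_funD; exact: measurable_funX.
Qed.

Lemma measurable_gam d (T : measurableType d) (D : set T) (f g : T -> R) :
  measurable_fun D f -> measurable_fun D g ->
  measurable_fun D (fun u => gam (f u) (g u)).
Proof.
move=> mf mg; apply: measurable_funM => //.
apply: measurable_fun_invr.
apply: measurable_funX; apply: measurable_funD => //.
exact: measurableT_comp.
Qed.

Lemma measurable_wgt d (T : measurableType d) (D : set T) (f : T -> R) :
  measurable_fun D f -> measurable_fun D (fun u => wgt (f u)).
Proof.
move=> mf; apply: measurable_fun_invr.
apply: measurable_funX; apply: measurable_funD => //.
exact: measurableT_comp.
Qed.

Lemma integral_pois1 : (\int[mu]_x (pois 1 x)%:E = pi%:E)%E.
Proof.
have c1 := continuous_pois ltr01.
rewrite ge0_symfun_integralT//; last 2 first.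
  by move=> x; exact: pois_ge0.
  by move=> x /=; rewrite poisN.
rewrite -set_itvcy (@ge0_continuous_FTC2y _ _ atan 0 (pi / 2)).
- by rewrite atan0 sube0 -EFinM mulrC divfK.
- by move=> x _; exact: pois_ge0.
- exact: continuous_subspaceT.
- exact: cvgy_atan.
- by move=> x _; exact: derivable_atan.
- by apply: cvg_at_right_filter; exact: continuous_atan.
- by move=> x _; rewrite derive1_atan /pois expr1n div1r.
Qed.

Lemma integral_pois r : 0 < r -> (\int[mu]_x (pois r x)%:E = pi%:E)%E.
Proof.
move=> r0; rewrite -(ge0_integral_scale r0); last 2 first.
  by apply/measurable_EFinP; exact: measurable_pois.
  by move=> x; rewrite lee_fin pois_ge0// ltW.
rewrite -ge0_integralMl ?ltW//; last 2 first.
  by move=> x; rewrite pois_ge0// ltW.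
  by apply: measurable_pois => //; exact: measurable_funM.
rewrite -integral_pois1; apply: eq_integral => x _; congr EFin.
have h : 1 + x ^+ 2 != 0 by rewrite gt_eqF// ltr_pwDl// sqr_ge0.
rewrite /pois exprMn expr1n; field; rewrite h gt_eqF//=.
by rewrite ltr_pwDl ?exprn_gt0 ?sqr_ge0.
Qed.

Lemma integral_pois_shift r c : 0 < r -> (\int[mu]_x (pois r (c - x))%:E = pi%:E)%E.
Proof.
move=> r0; rewrite (ge0_integral_subl c (f := fun x => (pois r x)%:E)) ?integral_pois//.
  by apply/measurable_EFinP; exact: measurable_pois.
by move=> x; rewrite lee_fin pois_ge0// ltW.
Qed.

Lemma integral_pois_shiftr r c : 0 < r -> (\int[mu]_x (pois r (x - c))%:E = pi%:E)%E.
Proof.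
move=> r0; rewrite -(integral_pois_shift c r0).
by apply: eq_integral => x _; rewrite -poisN opprB.
Qed.

Lemma integrable_pois r : 0 < r -> mu.-integrable setT (EFin \o pois r).
Proof.
move=> r0; apply/integrableP; split.
  by apply/measurable_EFinP; exact: measurable_pois.
under eq_integral do rewrite /= ger0_norm ?pois_ge0 ?ltW//.
by rewrite integral_pois// ltry.
Qed.

Lemma gam_le_pois r z : 0 < r -> gam r z <= pois r z / r.
Proof.
move=> r0; rewrite /gam /pois.
have z0 := normr_ge0 z.
have -> : z ^+ 2 = `|z| ^+ 2 by rewrite real_normK// num_real.
move: (`|z|) z0 => u u0.
rewrite mulrAC divff ?gt_eqF// mul1r.
rewrite ler_pdivrMr; last by rewrite exprn_gt0// ltr_pwDl.
rewrite mulrC ler_pdivlMr; last by rewrite ltr_pwDl ?exprn_gt0// sqr_ge0.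
have : 0 <= r * r * u by rewrite !mulr_ge0// ltW.
have : 0 <= r * u * u by rewrite !mulr_ge0// ltW.
have : 0 <= u * u * u by rewrite !mulr_ge0// ltW.
nra.
Qed.

Lemma integral_gam_shift r c : 0 < r ->
  (\int[mu]_x (gam r (c - x))%:E <= (pi / r)%:E)%E.
Proof.
move=> r0.
have mp : measurable_fun [set: R] (fun u => pois r (c - u)).
  by apply: measurable_pois => //; exact: measurable_funB.
have p0 u : 0 <= pois r (c - u) by rewrite pois_ge0// ltW.
have -> : ((pi / r)%:E = \int[mu]_x (r^-1 * pois r (c - x))%:E)%E.
  rewrite ge0_integralMl ?integral_pois_shift ?invr_ge0 ?ltW//.
  by rewrite -EFinM mulrC.
apply: le_ge0_integral => //.
- by move=> x; rewrite gam_ge0// ltW.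
- by apply: measurable_gam => //; exact: measurable_funB.
- by apply: measurable_funM.
- by move=> x; rewrite mulrC gam_le_pois.
Qed.

Lemma integral_gam_shiftr r c : 0 < r ->
  (\int[mu]_x (gam r (x - c))%:E <= (pi / r)%:E)%E.
Proof.
move=> r0; apply: le_trans (integral_gam_shift c r0); rewrite le_eqVlt; apply/orP; left.
by apply/eqP; apply: eq_integral => x _; rewrite -gamN opprB.
Qed.

(** Pointwise form of the convolution inequality: [(a + b)^2 + (z + w)^2] is at most twice the
    sum of the two denominators, so clearing denominators leaves one of the two kernels
    in each term. *)
Lemma pois_mul_le a b z w : 0 < a -> 0 < b ->
  pois a z * pois b w <=
  (2 * (b * pois a z + a * pois b w)) / ((a + b) ^+ 2 + (z + w) ^+ 2).
Proof.
move=> a0 b0; rewrite /pois.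
set A := a ^+ 2 + z ^+ 2; set B := b ^+ 2 + w ^+ 2.
have A0 : 0 < A by rewrite ltr_pwDl ?exprn_gt0// sqr_ge0.
have B0 : 0 < B by rewrite ltr_pwDl ?exprn_gt0// sqr_ge0.
have C0 : 0 < (a + b) ^+ 2 + (z + w) ^+ 2.
  by rewrite ltr_pwDl ?exprn_gt0// ?sqr_ge0// addr_gt0.
rewrite ler_pdivlMr//.
have -> : 2 * (b * (a / A) + a * (b / B)) = a / A * (b / B) * (2 * (A + B)).
  by field; rewrite !gt_eqF.
apply: ler_wpM2l; first by rewrite !mulr_ge0// ?invr_ge0 ltW.
rewrite /A /B; have := sqr_ge0 (a - b); have := sqr_ge0 (z - w); nra.
Qed.

(** The semigroup property of Poisson kernels, up to the factor [2], by integrating the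
    pointwise bound [pois_mul_le]. *)
Lemma pois_conv a b x y : 0 < a -> 0 < b ->
  (\int[mu]_w (pois a (x - w) * pois b (w - y))%:E <=
   (2 * pi * pois (a + b) (x - y))%:E)%E.
Proof.
move=> a0 b0.
pose D := (a + b) ^+ 2 + (x - y) ^+ 2.
have D0 : 0 < D by rewrite ltr_pwDl ?exprn_gt0// ?sqr_ge0// addr_gt0.
have mpa : measurable_fun [set: R] (fun w => pois a (x - w)).
  by apply: measurable_pois => //; exact: measurable_funB.
have mpb : measurable_fun [set: R] (fun w => pois b (w - y)).
  by apply: measurable_pois => //; exact: measurable_funB.
have pa w : 0 <= pois a (x - w) by rewrite pois_ge0// ltW.
have pb w : 0 <= pois b (w - y) by rewrite pois_ge0// ltW.
pose c1 := 2 * b / D; pose c2 := 2 * a / D.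
have c10 : 0 <= c1 by rewrite !mulr_ge0 ?invr_ge0 // ltW.
have c20 : 0 <= c2 by rewrite !mulr_ge0 ?invr_ge0 // ltW.
apply: (@le_trans _ _ (\int[mu]_w (c1 * pois a (x - w) + c2 * pois b (w - y))%:E)%E).
  apply: le_ge0_integral => //.
  - by move=> w; rewrite mulr_ge0.
  - exact: measurable_funM.
  - by apply: measurable_funD; exact: measurable_funM.
  - move=> w; have := pois_mul_le (x - w) (w - y) a0 b0.
    rewrite (_ : x - w + (w - y) = x - y); last by ring.
    rewrite -/D /c1 /c2 => /le_trans; apply; rewrite le_eqVlt; apply/orP; left; apply/eqP.
    by field; rewrite gt_eqF.
rewrite ge0_integralDr//; last 4 first.
  - by move=> w; rewrite mulr_ge0.
  - by move=> w; rewrite mulr_ge0.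
  - exact: measurable_funM.
  - exact: measurable_funM.
move: (ge0_integralMl mu c10 pa mpa) (ge0_integralMl mu c20 pb mpb) => /= -> ->.
rewrite integral_pois_shift// integral_pois_shiftr// -!EFinM -EFinD lee_fin.
rewrite le_eqVlt; apply/orP; left; apply/eqP.
by rewrite /c1 /c2 /pois -/D; field; rewrite gt_eqF.
Qed.

Lemma pois_le_pois r s z : 0 < r -> r <= s -> s <= 2 * r -> pois s z <= 2 * pois r z.
Proof.
move=> r0 rs s2r; rewrite /pois mulrA; apply: ler_pM => //.
- by rewrite (le_trans (ltW r0)).
- by rewrite invr_ge0 addr_ge0 ?sqr_ge0.
- rewrite lef_pV2 ?posrE ?ltr_pwDl ?exprn_gt0 ?sqr_ge0// ?(lt_le_trans r0)//.
  by rewrite lerD2r ler_pXn2r// nnegrE ltW// (lt_le_trans r0).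
Qed.

Lemma wgt_le_pois x : wgt x <= pois 1 x.
Proof.
rewrite /wgt /pois expr1n div1r lef_pV2 ?posrE ?exprn_gt0 ?ltr_pwDl ?sqr_ge0//.
have -> : x ^+ 2 = `|x| ^+ 2 by rewrite real_normK// num_real.
move: (`|x|) (normr_ge0 x) => u u0.
have : 0 <= u * u * u by rewrite !mulr_ge0.
nra.
Qed.

Lemma wgt_shift_le x c : wgt x <= (1 + `|c|) ^+ 3 * wgt (x + c).
Proof.
rewrite /wgt ler_pdivlMr ?exprn_gt0 ?ltr_pwDl//.
rewrite mulrC ler_pdivrMr ?exprn_gt0 ?ltr_pwDl// -exprMn.
rewrite ler_pXn2r ?nnegrE ?addr_ge0 ?mulr_ge0 ?addr_ge0//.
have := ler_normD x c; have := normr_ge0 x; have := normr_ge0 c.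
have : 0 <= `|x| * `|c| by rewrite mulr_ge0.
nra.
Qed.

(** Since [1 + |y| <= (1 + |x|) + |x - y|], either [wgt x] or [gam r (x - y)] can be exchanged
    for a multiple of [wgt y]. *)
Lemma wgt_gam_le r x y : 0 < r ->
  wgt x * gam r (x - y) <= 4 * wgt y * (gam r (x - y) + r * wgt x).
Proof.
move=> r0.
have zr : 0 < r + `|x - y| by rewrite ltr_pwDl.
have g0 : 0 <= gam r (x - y) by rewrite gam_ge0// ltW.
have h : (1 + `|y|) ^+ 3 <= 4 * ((1 + `|x|) ^+ 3 + `|x - y| ^+ 3).
  have : 1 + `|y| <= (1 + `|x|) + `|x - y|.
    rewrite -addrA lerD2l.
    by rewrite -[X in `|X| <= _](_ : x - (x - y) = y) ?ler_normB//; ring.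
  move: (1 + `|x|) (`|x - y|) (1 + `|y|) (ltr_pwDl ltr01 (normr_ge0 x)) (normr_ge0 (x - y))
     (ltr_pwDl ltr01 (normr_ge0 y)) => A B C A0 B0 C0 CAB.
  apply: (@le_trans _ _ ((A + B) ^+ 3)); first by rewrite ler_pXn2r// nnegrE ?addr_ge0// ltW.
  have : 0 <= (A + B) * (A - B) ^+ 2 by rewrite mulr_ge0 ?sqr_ge0// addr_ge0// ltW.
  nra.
have gz : `|x - y| ^+ 3 * gam r (x - y) <= r.
  rewrite /gam mulrA ler_pdivrMr ?exprn_gt0// mulrC ler_wpM2l ?(ltW r0)//.
  by rewrite ler_pXn2r ?nnegrE ?addr_ge0 ?(ltW r0)// ler_wpDl// ltW.
have wx := wgt_gt0 x; have wy := wgt_gt0 y.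
have wxE : wgt x * (1 + `|x|) ^+ 3 = 1 by rewrite mulVf// gt_eqF// exprn_gt0// ltr_pwDl.
have wyE : wgt y * (1 + `|y|) ^+ 3 = 1 by rewrite mulVf// gt_eqF// exprn_gt0// ltr_pwDl.
have -> : wgt x * gam r (x - y) = wgt y * (wgt x * gam r (x - y)) * (1 + `|y|) ^+ 3.
  by rewrite mulrAC wyE mul1r.
apply: (le_trans (ler_wpM2l _ h)); first by apply: mulr_ge0 (ltW wy) (mulr_ge0 (ltW wx) g0).
have -> : wgt y * (wgt x * gam r (x - y)) * (4 * ((1 + `|x|) ^+ 3 + `|x - y| ^+ 3)) =
  4 * wgt y * ((wgt x * (1 + `|x|) ^+ 3) * gam r (x - y) + wgt x * (`|x - y| ^+ 3 * gam r (x - y))).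
  by ring.
by rewrite wxE mul1r ler_wpM2l ?mulr_ge0 ?wgt_ge0// lerD2l mulrC ler_wpM2r ?wgt_ge0.
Qed.

Lemma integral_wgt_le : (\int[mu]_x (wgt x)%:E <= pi%:E)%E.
Proof.
rewrite -integral_pois1; apply: le_ge0_integral => //.
- exact: wgt_ge0.
- exact: measurable_wgt.
- exact: measurable_pois.
- exact: wgt_le_pois.
Qed.

(** Convolution with [gam r] preserves the weight; this is what makes the weighted [L^1] space
    the natural one for the Duhamel operator. *)
Lemma integral_wgt_gam r rho y : 0 < r -> r <= rho ->
  (\int[mu]_x (wgt x * gam r (x - y))%:E <=
   (4 * pi * (1 + rho ^+ 2) / r * wgt y)%:E)%E.
Proof.
move=> r0 rrho.
have mg : measurable_fun [set: R] (fun x => gam r (x - y)).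
  by apply: measurable_gam => //; exact: measurable_funB.
have mw : measurable_fun [set: R] (@wgt) by exact: measurable_wgt.
have g0 x : 0 <= gam r (x - y) by rewrite gam_ge0// ltW.
pose c := 4 * wgt y.
have c0 : 0 <= c by rewrite mulr_ge0// wgt_ge0.
have w0 := wgt_ge0.
have cr0 : 0 <= c * r by rewrite mulr_ge0// ltW.
apply: (@le_trans _ _ (\int[mu]_x (c * gam r (x - y) + c * r * wgt x)%:E)%E).
  apply: le_ge0_integral => //.
  - by move=> x; rewrite mulr_ge0.
  - exact: measurable_funM.
  - by apply: measurable_funD; exact: measurable_funM.
  - by move=> x; rewrite (le_trans (wgt_gam_le x y r0))// /c; rewrite mulrDr !mulrA.
rewrite ge0_integralDr//; last 4 first.
  - by move=> w; rewrite mulr_ge0.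
  - by move=> w; rewrite mulr_ge0.
  - exact: measurable_funM.
  - exact: measurable_funM.
move: (ge0_integralMl mu c0 g0 mg) (ge0_integralMl mu cr0 w0 mw) => /= -> ->.
apply: (@le_trans _ _ (c%:E * (pi / r)%:E + (c * r)%:E * pi%:E)%E).
  apply: leeD; apply: lee_wpmul2l; rewrite ?lee_fin ?mulr_ge0 ?(ltW r0)//.
    exact: integral_gam_shiftr.
  exact: integral_wgt_le.
rewrite -!EFinM -EFinD lee_fin.
have -> : 4 * pi * (1 + rho ^+ 2) / r * wgt y = c * (pi / r) + c * (pi * rho ^+ 2 / r).
  by rewrite /c; field; rewrite gt_eqF.
rewrite lerD2l -[leLHS]mulrA ler_wpM2l// (mulrC r) -mulrA ler_wpM2l ?pi_ge0// ler_pdivlMr// -expr2.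
by rewrite ler_pXn2r// nnegrE ltW// (lt_le_trans r0).
Qed.

End poisson_type_kernels.

(** * Oscillatory integrals on the half line *)

Section cube_root.
Context (R : realType).
Implicit Types t : R.

Definition cbrt t : R := t `^ (3%:R^-1).

Lemma cbrt_ge0 t : 0 <= cbrt t. Proof. exact: powR_ge0. Qed.

Lemma cbrt_gt0 t : 0 < t -> 0 < cbrt t. Proof. exact: powR_gt0. Qed.

Lemma cbrtK t : 0 <= t -> cbrt t ^+ 3 = t.
Proof.
by move=> t0; rewrite -powR_mulrn ?cbrt_ge0// /cbrt -powRrM mulVf// powRr1.
Qed.

Lemma cbrt_le s t : 0 <= s -> s <= t -> cbrt s <= cbrt t.
Proof.
by move=> s0 st; apply: ge0_ler_powR; rewrite ?invr_ge0// nnegrE// (le_trans s0).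
Qed.

Lemma measurable_cbrt d (T : measurableType d) (D : set T) (f : T -> R) :
  measurable_fun D f -> measurable_fun D (fun u => cbrt (f u)).
Proof. by move=> mf; apply: measurableT_comp (@measurable_powR R _) mf. Qed.

End cube_root.

Section half_line_oscillatory_integrals.
Context (R : realType) (eta : R) (heta : 0 < eta).
Local Notation mu := (@lebesgue_measure R).
Local Notation hl := (`[0, +oo[%classic : set R).
Implicit Types (t x xi : R) (n : nat).

(** [damp] is the modulus of the symbol on the half line [xi >= 0].  By parity the kernel
    is [Ac 0 / pi] and its derivative in space is [- As 1 / pi]. *)
Definition damp t xi := expR (- (eta * t * (xi ^+ 3 - xi))).
Definition osc n t x xi := xi ^+ n * damp t xi * cos (x * xi + xi ^+ 3 * t).
Definition osn n t x xi := xi ^+ n * damp t xi * sin (x * xi + xi ^+ 3 * t).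
Definition Ac n t x := \int[mu]_(xi in `[0, +oo[) osc n t x xi.
Definition As n t x := \int[mu]_(xi in `[0, +oo[) osn n t x xi.

Lemma exp_cube_decay n : exists2 c : R, 0 <= c &
  forall y : R, 0 <= y -> y ^+ n * expR (- (eta / 2 * y ^+ 3)) <= c.
Proof.
exists (1 + (2 / eta) ^+ n * n`!%:R).
  by rewrite addr_ge0// mulr_ge0// exprn_ge0// divr_ge0// ltW.
move=> y y0; rewrite expRN ler_pdivrMr ?expR_gt0//.
set a := eta / 2 * y ^+ 3.
have a0 : 0 <= a by rewrite mulr_ge0 ?exprn_ge0// divr_ge0// ltW.
have e1 : 1 <= expR a by rewrite -expR0 ler_expR.
have c0 : 0 <= (2 / eta) ^+ n * n`!%:R.
  by rewrite mulr_ge0// exprn_ge0// divr_ge0// ltW.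
have [y1|y1] := leP y 1.
  apply: (@le_trans _ _ 1); first by rewrite exprn_ile1.
  by rewrite -[leLHS]mul1r ler_pM// lerDl.
have an : a ^+ n <= n`!%:R * expR a.
  case: n c0 => [|n] _; first by rewrite expr0 fact0 mul1r.
  rewrite -ler_pdivrMl ?ltr0n ?fact_gt0// mulrC.
  by rewrite (le_trans _ (expR_ge1Dxn n a0))// lerDr.
apply: (@le_trans _ _ ((2 / eta) ^+ n * a ^+ n)).
  rewrite -exprMn /a mulrA (_ : 2 / eta * (eta / 2) = 1) ?mul1r; last by field; rewrite gt_eqF.
  by rewrite lerXn2r ?nnegrE ?exprn_ge0// ler_eXnr// ltW.
have P0 : 0 <= (2 / eta) ^+ n by rewrite exprn_ge0// divr_ge0// (ltW heta).
have := ler_wpM2l P0 an.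
by move: ((2 / eta) ^+ n) (n`!%:R) (expR a) (a ^+ n) e1 => P N E Q; lra.
Qed.

(** The growing factor [exp (eta t xi)] is absorbed by half of the cubic decay, as
    [xi <= 1 + xi^3 / 2]. *)
Lemma damp_le T t xi : 0 < t -> t <= T -> 0 <= xi ->
  damp t xi <= expR (eta * T) * expR (- (eta / 2 * (cbrt t * xi) ^+ 3)).
Proof.
move=> t0 tT x0; rewrite /damp -expRD ler_expR exprMn cbrtK ?(ltW t0)//.
have h : xi <= 1 + xi ^+ 3 / 2.
  have : 0 <= (xi - 1) ^+ 2 * (xi + 2) by rewrite mulr_ge0 ?sqr_ge0// addr_ge0.
  by nra.
have h1 := ler_wpM2l (mulr_ge0 (ltW heta) (ltW t0)) h.
have h2 : eta * t <= eta * T by rewrite ler_pM2l.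
lra.
Qed.

(** Any integrable majorant would do for the moments; a Poisson kernel of scale [1 / cbrt t]
    has an explicit mass, and gives the right power of [t]. *)
Lemma moment_le_pois T n : 0 < T -> exists2 c : R, 0 <= c &
  forall t xi, 0 < t -> t <= T -> 0 <= xi ->
  xi ^+ n * damp t xi <= c / cbrt t ^+ n.+1 * pois (cbrt t)^-1 xi.
Proof.
move=> T0; have [c1 c10 h1] := exp_cube_decay n.
have [c2 c20 h2] := exp_cube_decay n.+2.
exists (expR (eta * T) * (c1 + c2)); first by rewrite mulr_ge0 ?expR_ge0// addr_ge0.
move=> t xi t0 tT x0; have r0 := cbrt_gt0 t0; set r := cbrt t in r0 *.
have y0 : 0 <= r * xi by rewrite mulr_ge0// ltW.
have hp : 0 < 1 + (r * xi) ^+ 2 by rewrite ltr_pwDl ?sqr_ge0.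
have -> : expR (eta * T) * (c1 + c2) / r ^+ n.+1 * pois r^-1 xi =
   expR (eta * T) * (c1 + c2) / r ^+ n / (1 + (r * xi) ^+ 2).
  rewrite /pois exprS exprMn exprVn; field.
  have rn : r != 0 by rewrite gt_eqF.
  rewrite expf_neq0// rn /=; have := hp; rewrite exprMn => hp'; rewrite !gt_eqF//=.
rewrite ler_pdivlMr// ler_pdivlMr ?exprn_gt0//.
have -> : xi ^+ n * damp t xi * (1 + (r * xi) ^+ 2) * r ^+ n =
   ((r * xi) ^+ n + (r * xi) ^+ n.+2) * damp t xi.
  by rewrite !exprS !exprMn; ring.
apply: (@le_trans _ _ (((r * xi) ^+ n + (r * xi) ^+ n.+2) *
    (expR (eta * T) * expR (- (eta / 2 * (r * xi) ^+ 3))))).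
  by apply: ler_wpM2l; [rewrite addr_ge0// exprn_ge0|exact: damp_le].
rewrite mulrCA ler_wpM2l ?expR_ge0// mulrDl.
by apply: lerD; [exact: h1|exact: h2].
Qed.

Lemma continuous_phase t x : continuous (fun xi : R => x * xi + xi ^+ 3 * t).
Proof.
move=> z; apply: cvgD; apply: cvgM; try exact: cvg_cst; try exact: cvg_id.
exact: exprn_continuous.
Qed.

Lemma continuous_damp t : continuous (damp t).
Proof.
move=> z; apply: (@continuous_comp _ _ _ (fun xi => - (eta * t * (xi ^+ 3 - xi))) expR).
  apply: cvgN; apply: cvgM; first exact: cvg_cst.
  by apply: cvgB; [exact: exprn_continuous|exact: cvg_id].
exact: continuous_expR.
Qed.

Lemma continuous_osc n t x : continuous (osc n t x).
Proof.
move=> z; apply: cvgM; first by apply: cvgM; [exact: exprn_continuous|exact: continuous_damp].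
apply: (@continuous_comp _ _ _ (fun xi => x * xi + xi ^+ 3 * t) cos).
  exact: continuous_phase.
exact: continuous_cos.
Qed.

Lemma continuous_osn n t x : continuous (osn n t x).
Proof.
move=> z; apply: cvgM; first by apply: cvgM; [exact: exprn_continuous|exact: continuous_damp].
apply: (@continuous_comp _ _ _ (fun xi => x * xi + xi ^+ 3 * t) sin).
  exact: continuous_phase.
exact: continuous_sin.
Qed.

Lemma damp_ge0 t xi : 0 <= damp t xi. Proof. exact: expR_ge0. Qed.

Lemma sin_max (z : R) : `|sin z| <= 1.
Proof. by rewrite ler_norml sin_geN1 sin_le1. Qed.

Lemma osc_le n t x xi : 0 <= xi -> `|osc n t x xi| <= xi ^+ n * damp t xi.
Proof.
move=> x0; rewrite normrM ger0_norm; last by rewrite mulr_ge0 ?exprn_ge0 ?damp_ge0.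
by rewrite ler_piMr ?cos_max// mulr_ge0 ?exprn_ge0 ?damp_ge0.
Qed.

Lemma osn_le n t x xi : 0 <= xi -> `|osn n t x xi| <= xi ^+ n * damp t xi.
Proof.
move=> x0; rewrite normrM ger0_norm; last by rewrite mulr_ge0 ?exprn_ge0 ?damp_ge0.
by rewrite ler_piMr ?sin_max// mulr_ge0 ?exprn_ge0 ?damp_ge0.
Qed.

Lemma halfline_pois_bound (f : R -> R) (c a : R) : continuous f -> 0 < a -> 0 <= c ->
  (forall xi, 0 <= xi -> `|f xi| <= c * pois a xi) ->
  mu.-integrable hl (EFin \o f) /\ `|\int[mu]_(xi in `[0, +oo[) f xi| <= c * pi.
Proof.
move=> cf a0 c0 fle.
have mf (D : set R) : measurable_fun D f.
  by apply: measurable_funTS; exact: continuous_measurable_fun.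
have ip : mu.-integrable setT (fun xi => (c * pois a xi)%:E).
  under eq_fun do rewrite EFinM.
  by apply: integrableZl => //; exact: integrable_pois.
have fi : mu.-integrable hl (EFin \o f).
  apply: (@le_integrable _ _ _ mu hl _ _ (fun xi => (c * pois a xi)%:E)) => //.
  - exact: measurableT_comp (mf _).
  - move=> xi /=; rewrite in_itv/= andbT => xi0.
    by rewrite lee_fin (le_trans (fle _ xi0))// ler_norm.
  - exact: integrableS ip.
split => //.
apply: (le_trans (le_normr_Rintegral _ fi)) => //.
have fin1 : (\int[mu]_(xi in hl) `|f xi|%:E)%E \is a fin_num.
  by apply: integrable_fin_num => //; exact: integrable_norm fi.
rewrite -lee_fin /Rintegral fineK//.
apply: (@le_trans _ _ (\int[mu]_(xi in hl) (c * pois a xi)%:E)%E).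
  apply: ge0_le_integral => //.
  - by apply/measurable_EFinP; exact: measurableT_comp (mf _).
  - apply/measurable_EFinP; apply: measurable_funTS; apply: measurable_funM => //.
    exact: measurable_pois.
  - by move=> xi /=; rewrite in_itv/= andbT => xi0; rewrite lee_fin fle.
apply: (@le_trans _ _ (\int[mu]_xi (c * pois a xi)%:E)%E).
  apply: ge0_subset_integral => //.
  - apply/measurable_EFinP; apply: measurable_funM => //.
    exact: measurable_pois.
  - by move=> xi _; rewrite lee_fin mulr_ge0// pois_ge0// ltW.
rewrite ge0_integralMl//; last 2 first.
  by move=> xi; rewrite pois_ge0// ltW.
  exact: measurable_pois.
by rewrite integral_pois.
Qed.

Lemma osc_integrable n t x : 0 < t -> mu.-integrable hl (EFin \o osc n t x).
Proof.
move=> t0; have [c c0 h] := @moment_le_pois t n t0.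
apply: (halfline_pois_bound (c := c / cbrt t ^+ n.+1) (a := (cbrt t)^-1) _ _ _ _).1.
- exact: continuous_osc.
- by rewrite invr_gt0 cbrt_gt0.
- by rewrite divr_ge0// exprn_ge0// cbrt_ge0.
- by move=> xi xi0; rewrite (le_trans (osc_le _ _ _ xi0))// h.
Qed.

Lemma osn_integrable n t x : 0 < t -> mu.-integrable hl (EFin \o osn n t x).
Proof.
move=> t0; have [c c0 h] := @moment_le_pois t n t0.
apply: (halfline_pois_bound (c := c / cbrt t ^+ n.+1) (a := (cbrt t)^-1) _ _ _ _).1.
- exact: continuous_osn.
- by rewrite invr_gt0 cbrt_gt0.
- by rewrite divr_ge0// exprn_ge0// cbrt_ge0.
- by move=> xi xi0; rewrite (le_trans (osn_le _ _ _ xi0))// h.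
Qed.

Lemma osc_bound T n : 0 < T -> exists2 c : R, 0 <= c &
  forall t x, 0 < t -> t <= T ->
  `|Ac n t x| * cbrt t ^+ n.+1 <= c /\ `|As n t x| * cbrt t ^+ n.+1 <= c.
Proof.
move=> T0; have [c c0 h] := @moment_le_pois T n T0.
exists (c * pi); first by rewrite mulr_ge0// pi_ge0.
move=> t x t0 tT; have r0 := cbrt_gt0 t0.
rewrite -!ler_pdivlMr ?exprn_gt0// (mulrAC c).
split; apply: (halfline_pois_bound (a := (cbrt t)^-1) _ _ _ _).2.
- exact: continuous_osc.
- by rewrite invr_gt0.
- by rewrite divr_ge0// exprn_ge0// ltW.
- by move=> xi xi0; rewrite (le_trans (osc_le _ _ _ xi0))// h.
- exact: continuous_osn.
- by rewrite invr_gt0.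
- by rewrite divr_ge0// exprn_ge0// ltW.
- by move=> xi xi0; rewrite (le_trans (osn_le _ _ _ xi0))// h.
Qed.

Lemma is_derive_moment n t xi : is_derive xi (1 : R) (fun z => z ^+ n * damp t z)
  (n%:R * xi ^+ n.-1 * damp t xi - 3 * eta * t * (xi ^+ n.+2 * damp t xi)
   + eta * t * (xi ^+ n * damp t xi)).
Proof.
have h1 : is_derive xi (1 : R) (fun z : R => z ^+ n) (n%:R * xi ^+ n.-1).
  apply: DeriveDef; first exact: exprn_derivable.
  by rewrite exp_derive /GRing.scale/= mulr1.
have h2 : is_derive xi (1 : R) (fun z : R => - (eta * t * (z ^+ 3 - z)))
   (- (eta * t * (3 * xi ^+ 2 - 1))).
  by apply: is_derive_eq; rewrite /GRing.scale/=; ring.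
have h3 : is_derive xi (1 : R) (damp t) (- (eta * t * (3 * xi ^+ 2 - 1)) * damp t xi).
  by apply: is_derive_eq; rewrite /GRing.scale/= mulrC.
by apply: is_derive_eq; rewrite /GRing.scale/= !exprS; ring.
Qed.

Lemma is_derive_phase t x xi : is_derive xi (1 : R) (fun z : R => x * z + z ^+ 3 * t)
   (x + 3 * t * xi ^+ 2).
Proof. by apply: is_derive_eq; rewrite /GRing.scale/=; ring. Qed.

Lemma is_derive_osc n t x xi : is_derive xi (1 : R) (osc n t x)
  (n%:R * osc n.-1 t x xi + (- (3 * eta * t)) * osc n.+2 t x xi + eta * t * osc n t x xi
   + (- x) * osn n t x xi + (- (3 * t)) * osn n.+2 t x xi).
Proof.
have h1 := is_derive_moment n t xi.
have h2 := is_derive_phase t x xi.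
have h3 : is_derive xi (1 : R) (fun z => cos (x * z + z ^+ 3 * t))
   (- sin (x * xi + xi ^+ 3 * t) * (x + 3 * t * xi ^+ 2)).
  by apply: is_derive_eq; rewrite /GRing.scale/= mulrC.
by apply: is_derive_eq; rewrite /GRing.scale/= /osc /osn !exprS; ring.
Qed.

Lemma is_derive_osn n t x xi : is_derive xi (1 : R) (osn n t x)
  (n%:R * osn n.-1 t x xi + (- (3 * eta * t)) * osn n.+2 t x xi + eta * t * osn n t x xi
   + x * osc n t x xi + 3 * t * osc n.+2 t x xi).
Proof.
have h1 := is_derive_moment n t xi.
have h2 := is_derive_phase t x xi.
have h3 : is_derive xi (1 : R) (fun z => sin (x * z + z ^+ 3 * t))
   (cos (x * xi + xi ^+ 3 * t) * (x + 3 * t * xi ^+ 2)).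
  by apply: is_derive_eq; rewrite /GRing.scale/= mulrC.
by apply: is_derive_eq; rewrite /GRing.scale/= /osc /osn !exprS; ring.
Qed.

End half_line_oscillatory_integrals.

(** * Decay of the kernel *)

Section kernel_decay.
Context (R : realType) (eta : R) (heta : 0 < eta).
Local Notation mu := (@lebesgue_measure R).
Local Notation hl := (`[0, +oo[%classic : set R).
Local Notation Ac := (Ac eta).
Local Notation As := (As eta).
Implicit Types (t x xi : R) (n : nat).

Lemma Rintegral_lin5 (f1 f2 f3 f4 f5 : R -> R) (a1 a2 a3 a4 a5 : R) :
  mu.-integrable hl (EFin \o f1) -> mu.-integrable hl (EFin \o f2) ->
  mu.-integrable hl (EFin \o f3) -> mu.-integrable hl (EFin \o f4) ->
  mu.-integrable hl (EFin \o f5) ->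
  mu.-integrable hl (EFin \o (fun z => a1 * f1 z + a2 * f2 z + a3 * f3 z + a4 * f4 z + a5 * f5 z))
  /\ \int[mu]_(z in `[0, +oo[) (a1 * f1 z + a2 * f2 z + a3 * f3 z + a4 * f4 z + a5 * f5 z) =
  a1 * \int[mu]_(z in `[0, +oo[) f1 z + a2 * \int[mu]_(z in `[0, +oo[) f2 z +
  a3 * \int[mu]_(z in `[0, +oo[) f3 z + a4 * \int[mu]_(z in `[0, +oo[) f4 z +
  a5 * \int[mu]_(z in `[0, +oo[) f5 z.
Proof.
move=> i1 i2 i3 i4 i5.
have Z (f : R -> R) a : mu.-integrable hl (EFin \o f) ->
    mu.-integrable hl (EFin \o (fun z => a * f z)).
  move=> fi; change (mu.-integrable hl (fun z => a%:E * (f z)%:E)%E).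
  exact: integrableZl.
have D (f g : R -> R) : mu.-integrable hl (EFin \o f) -> mu.-integrable hl (EFin \o g) ->
    mu.-integrable hl (EFin \o (fun z => f z + g z)).
  move=> fi gi; change (mu.-integrable hl (fun z => (f z)%:E + (g z)%:E)%E).
  exact: integrableD.
have j1 := Z _ a1 i1; have j2 := Z _ a2 i2; have j3 := Z _ a3 i3.
have j4 := Z _ a4 i4; have j5 := Z _ a5 i5.
have k2 := D _ _ j1 j2; have k3 := D _ _ k2 j3; have k4 := D _ _ k3 j4.
split; first exact: D.
by rewrite !RintegralD// !RintegralZl.
Qed.

Lemma cvg_osc_seq (f : R -> R) (c a : R) : 0 < a -> 0 <= c ->
  (forall xi, 0 <= xi -> `|f xi| <= c * pois a xi) ->
  f n%:R @[n --> \oo] --> 0.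
Proof.
move=> a0 c0 fle; apply/norm_cvg0P.
have lim0 : (fun n => c * a * harmonic n.-1) @ \oo --> (0 : R).
  rewrite -[X in _ --> X](mulr0 (c * a)); apply: cvgMl_tmp.
  by rewrite -(cvg_shiftS (fun n => (harmonic n.-1 : R))) /=; exact: cvg_harmonic.
apply: (squeeze_cvgr _ (cvg_cst 0) lim0).
near=> n; rewrite normr_ge0/= (le_trans (fle _ _))//.
have n0 : (0 < n)%N by near: n; exact: nbhs_infty_gt.
rewrite -mulrA ler_wpM2l// /pois ler_wpM2l ?(ltW a0)//= prednK//.
have n1 : (1 : R) <= n%:R by rewrite ler1n.
rewrite lef_pV2 ?posrE ?ltr0n ?ltr_pwDl ?exprn_gt0 ?sqr_ge0//.
have := sqr_ge0 a; nra.
Unshelve. all: by end_near. Qed.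

Lemma osc_tail n t x : 0 < t -> osc eta n t x m%:R @[m --> \oo] --> 0.
Proof.
move=> t0; have [c c0 h] := @moment_le_pois R eta heta t n t0.
apply: (@cvg_osc_seq _ (c / cbrt t ^+ n.+1) (cbrt t)^-1).
- by rewrite invr_gt0 cbrt_gt0.
- by rewrite divr_ge0// exprn_ge0// cbrt_ge0.
- by move=> xi xi0; rewrite (le_trans (osc_le _ _ _ _ xi0))// h.
Qed.

Lemma osn_tail n t x : 0 < t -> osn eta n t x m%:R @[m --> \oo] --> 0.
Proof.
move=> t0; have [c c0 h] := @moment_le_pois R eta heta t n t0.
apply: (@cvg_osc_seq _ (c / cbrt t ^+ n.+1) (cbrt t)^-1).
- by rewrite invr_gt0 cbrt_gt0.
- by rewrite divr_ge0// exprn_ge0// cbrt_ge0.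
- by move=> xi xi0; rewrite (le_trans (osn_le _ _ _ _ xi0))// h.
Qed.

Lemma norm_comb_le (E A B C D e a0 a b c : R) : 0 <= e ->
  `|E| <= a0 -> `|A| <= a -> `|B| <= b -> `|C| <= c -> `|D| <= b ->
  `|E + A + 3 * e * B + e * C + 3 * D| <= a0 + a + 3 * e * b + e * c + 3 * b.
Proof.
move=> e0 hE hA hB hC hD.
have e30 : 0 <= 3 * e by rewrite mulr_ge0.
apply: (le_trans (ler_normD _ _)); apply: lerD; last by rewrite normrM normr_nat ler_wpM2l.
apply: (le_trans (ler_normD _ _)); apply: lerD; last by rewrite normrM ger0_norm// ler_wpM2l.
apply: (le_trans (ler_normD _ _)); apply: lerD; last by rewrite normrM ger0_norm// ler_wpM2l.
by apply: (le_trans (ler_normD _ _)); exact: lerD.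
Qed.

Lemma continuous_lin5 (f1 f2 f3 f4 f5 : R -> R) (a1 a2 a3 a4 a5 : R) :
  continuous f1 -> continuous f2 -> continuous f3 -> continuous f4 -> continuous f5 ->
  continuous (fun z => a1 * f1 z + a2 * f2 z + a3 * f3 z + a4 * f4 z + a5 * f5 z).
Proof.
move=> c1 c2 c3 c4 c5 z.
have Z (f : R -> R) a : continuous f -> (fun y => a * f y) @ z --> a * f z.
  by move=> cf; apply: cvgMl_tmp; exact: cf.
by do 4 (apply: cvgD; last by apply: Z); apply: Z.
Qed.

(** Integration by parts in [xi]: the derivative of the phase is [x + 3 t xi^2], that of
    the damping exponent is [- eta t (3 xi^2 - 1)], and the boundary term at [0] is present
    only for [n = 0]. *)
Lemma osc_recS n t x : 0 < t ->
  x * As n t x = (n == 0)%:R + n%:R * Ac n.-1 t x - 3 * eta * t * Ac n.+2 t x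
    + eta * t * Ac n t x - 3 * t * As n.+2 t x.
Proof.
move=> t0.
have [fi fE] := @Rintegral_lin5 _ _ _ _ _ n%:R (- (3 * eta * t)) (eta * t) (- x) (- (3 * t))
  (osc_integrable heta n.-1 x t0) (osc_integrable heta n.+2 x t0)
  (osc_integrable heta n x t0) (osn_integrable heta n x t0) (osn_integrable heta n.+2 x t0).
have := @Rintegral_halfline R _ (osc eta n t x) fi _ (is_derive_osc eta n t x) (osc_tail n x t0).
rewrite fE -!/(Ac _ _ _) -!/(As _ _ _) => /(_ _)/wrap[].
  by apply: continuous_lin5; (exact: continuous_osc || exact: continuous_osn).
have -> : osc eta n t x 0 = (n == 0)%:R.
  rewrite /osc /damp expr0n !mulr0 /= expr0n mul0r addr0 cos0 mulr1.
  by rewrite !(subr0, mulr0, oppr0) expR0 mulr1.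
by move=> h; lra.
Qed.

Lemma osc_recC n t x : 0 < t ->
  x * Ac n t x = - (n%:R * As n.-1 t x) + 3 * eta * t * As n.+2 t x
    - eta * t * As n t x - 3 * t * Ac n.+2 t x.
Proof.
move=> t0.
have [fi fE] := @Rintegral_lin5 _ _ _ _ _ n%:R (- (3 * eta * t)) (eta * t) x (3 * t)
  (osn_integrable heta n.-1 x t0) (osn_integrable heta n.+2 x t0)
  (osn_integrable heta n x t0) (osc_integrable heta n x t0) (osc_integrable heta n.+2 x t0).
have := @Rintegral_halfline R _ (osn eta n t x) fi _ (is_derive_osn eta n t x) (osn_tail n x t0).
rewrite fE -!/(Ac _ _ _) -!/(As _ _ _) => /(_ _)/wrap[].
  by apply: continuous_lin5; (exact: continuous_osc || exact: continuous_osn).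
have -> : osn eta n t x 0 = 0.
  by rewrite /osn mulr0 (_ : 0 ^+ 3 * t = 0) ?addr0 ?sin0 ?mulr0// expr0n mul0r.
by move=> h; lra.
Qed.

(** Each use of the recursions exchanges a factor [x] for a factor [t xi^2] or [1 / xi], both
    of order [cbrt t] since [xi] is of order [1 / cbrt t]. *)
Lemma osc_decay1 T n : 0 < T -> exists2 c : R, 0 <= c &
  forall t x, 0 < t -> t <= T ->
  `|x * Ac n t x| * cbrt t ^+ n <= c /\ `|x * As n t x| * cbrt t ^+ n <= c.
Proof.
move=> T0; pose rho := cbrt T.
have [c1 c10 h1] := @osc_bound R eta heta T n.-1 T0.
have [c2 c20 h2] := @osc_bound R eta heta T n.+2 T0.
have [c3 c30 h3] := @osc_bound R eta heta T n T0.
exists (1 + n%:R * c1 + 3 * eta * c2 + eta * rho ^+ 2 * c3 + 3 * c2).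
  by rewrite !addr_ge0// ?mulr_ge0 ?exprn_ge0 ?cbrt_ge0// (ltW heta).
move=> t x t0 tT; have r0 := cbrt_gt0 t0.
have [h1c h1s] := h1 t x t0 tT; have [h2c h2s] := h2 t x t0 tT; have [h3c h3s] := h3 t x t0 tT.
have rrho : cbrt t ^+ 2 <= rho ^+ 2.
  by rewrite ler_pXn2r// ?nnegrE ?cbrt_ge0// cbrt_le// (ltW t0).
have tE : t = cbrt t ^+ 3 by rewrite cbrtK// (ltW t0).
set r := cbrt t in r0 rrho tE h1c h1s h2c h2s h3c h3s *.
have e0 := ltW heta.
have P1 (u : R) : `|u| * r ^+ n.-1.+1 <= c1 -> `|n%:R * u * r ^+ n| <= n%:R * c1.
  move=> hu; rewrite !normrM normr_nat (ger0_norm (exprn_ge0 _ (ltW r0))).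
  by case: n hu {h1 h2 h3 h1c h1s h2c h2s h3c h3s c30} => [|m] hu; rewrite ?mul0r// -mulrA ler_wpM2l.
have P2 (u : R) : `|u| * r ^+ n.+3 <= c2 -> `|t * u * r ^+ n| <= c2.
  move=> hu; rewrite !normrM (ger0_norm (exprn_ge0 _ (ltW r0))) (gtr0_norm t0).
  by rewrite tE (_ : _ * _ * _ = `|u| * r ^+ n.+3)// !exprS; ring.
have P3 (u : R) : `|u| * r ^+ n.+1 <= c3 -> `|t * u * r ^+ n| <= rho ^+ 2 * c3.
  move=> hu; rewrite !normrM (ger0_norm (exprn_ge0 _ (ltW r0))) (gtr0_norm t0).
  rewrite tE (_ : _ * _ * _ = r ^+ 2 * (`|u| * r ^+ n.+1)); last by rewrite !exprS; ring.
  by apply: ler_pM => //; rewrite ?exprn_ge0 ?mulr_ge0 ?exprn_ge0 ?(ltW r0).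
have P0 : `|(n == 0)%:R * r ^+ n| <= 1.
  by case: n {P1 P2 P3 h1 h2 h3 h1c h1s h2c h2s h3c h3s c30} => [|m]; rewrite ?mul0r ?normr0 ?expr0 ?mulr1 ?normr1.
have rn0 : 0 <= r ^+ n by rewrite exprn_ge0// ltW.
split; rewrite -{1}(ger0_norm rn0) -normrM.
- rewrite (osc_recC n x t0).
  rewrite (_ : (_ + _ - _ - _) * _ = - (n%:R * As n.-1 t x * r ^+ n) +
    3 * eta * (t * As n.+2 t x * r ^+ n) - eta * (t * As n t x * r ^+ n)
    - 3 * (t * Ac n.+2 t x * r ^+ n)); last by ring.
  move: (P1 _ h1s) (P2 _ h2s) (P3 _ h3s) (P2 _ h2c).
  move: (n%:R * As n.-1 t x * r ^+ n) (t * As n.+2 t x * r ^+ n) (t * As n t x * r ^+ n)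
    (t * Ac n.+2 t x * r ^+ n) => A B C D hA hB hC hD.
  rewrite [X in `|X|](_ : _ = 0 + - A + 3 * eta * B + eta * - C + 3 * - D); last by ring.
  by rewrite -[eta * _ * c3]mulrA; apply: norm_comb_le; rewrite ?normrN ?normr0.
- rewrite (osc_recS n x t0).
  rewrite (_ : (_ + _ - _ + _ - _) * _ = (n == 0)%:R * r ^+ n + n%:R * Ac n.-1 t x * r ^+ n -
    3 * eta * (t * Ac n.+2 t x * r ^+ n) + eta * (t * Ac n t x * r ^+ n)
    - 3 * (t * As n.+2 t x * r ^+ n)); last by ring.
  move: P0 (P1 _ h1c) (P2 _ h2c) (P3 _ h3c) (P2 _ h2s).
  move: ((n == 0)%:R * r ^+ n) (n%:R * Ac n.-1 t x * r ^+ n) (t * Ac n.+2 t x * r ^+ n) (t * Ac n t x * r ^+ n)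
    (t * As n.+2 t x * r ^+ n) => E A B C D hE hA hB hC hD.
  rewrite [X in `|X|](_ : _ = E + A + 3 * eta * - B + eta * C + 3 * - D); last by ring.
  by rewrite -[eta * _ * c3]mulrA; apply: norm_comb_le; rewrite ?normrN.
Qed.

(** The sine integral of order zero is excluded: its boundary term at the origin makes it
    decay like [1 / x] only. *)
Lemma osc_decay2 T n : 0 < T -> exists2 c : R, 0 <= c &
  forall t x, 0 < t -> t <= T ->
  `|x ^+ 2 * Ac n t x| * cbrt t ^+ n <= c * cbrt t /\
  ((0 < n)%N -> `|x ^+ 2 * As n t x| * cbrt t ^+ n <= c * cbrt t).
Proof.
move=> T0; pose rho := cbrt T.
have [c1 c10 h1] := @osc_decay1 T n.-1 T0.
have [c2 c20 h2] := @osc_decay1 T n.+2 T0.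
have [c3 c30 h3] := @osc_decay1 T n T0.
exists (n%:R * c1 + 3 * eta * c2 + eta * rho ^+ 2 * c3 + 3 * c2).
  by rewrite !addr_ge0// ?mulr_ge0 ?exprn_ge0 ?cbrt_ge0// (ltW heta).
move=> t x t0 tT; have r0 := cbrt_gt0 t0.
have [h1c h1s] := h1 t x t0 tT; have [h2c h2s] := h2 t x t0 tT; have [h3c h3s] := h3 t x t0 tT.
have rrho : cbrt t ^+ 2 <= rho ^+ 2.
  by rewrite ler_pXn2r// ?nnegrE ?cbrt_ge0// cbrt_le// (ltW t0).
have tE : t = cbrt t ^+ 3 by rewrite cbrtK// (ltW t0).
set r := cbrt t in r0 rrho tE h1c h1s h2c h2s h3c h3s *.
have e0 := ltW heta.
have rn0 : 0 <= r ^+ n by rewrite exprn_ge0// ltW.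
have P1 (u : R) : `|u| * r ^+ n.-1 <= c1 -> `|n%:R * u * r ^+ n| <= n%:R * c1 * r.
  move=> hu; rewrite !normrM normr_nat (ger0_norm rn0).
  case: n hu {rn0 h1 h2 h3 h1c h1s h2c h2s h3c h3s c30} => [|m] hu; first by rewrite !mul0r.
  by rewrite exprS -mulrA -[leRHS]mulrA ler_wpM2l// mulrCA mulrC ler_wpM2r// ltW.
have P2 (u : R) : `|u| * r ^+ n.+2 <= c2 -> `|t * u * r ^+ n| <= c2 * r.
  move=> hu; rewrite !normrM (ger0_norm rn0) (gtr0_norm t0).
  rewrite tE (_ : _ * _ * _ = `|u| * r ^+ n.+2 * r); last by rewrite !exprS; ring.
  by rewrite ler_wpM2r// ltW.
have P3 (u : R) : `|u| * r ^+ n <= c3 -> `|t * u * r ^+ n| <= rho ^+ 2 * c3 * r.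
  move=> hu; rewrite !normrM (ger0_norm rn0) (gtr0_norm t0).
  rewrite tE (_ : r ^+ 3 * `|u| * r ^+ n = r ^+ 2 * (`|u| * r ^+ n) * r); last by ring.
  rewrite ler_wpM2r ?(ltW r0)//.
  by apply: ler_pM => //; rewrite ?exprn_ge0 ?mulr_ge0 ?exprn_ge0 ?(ltW r0).
split.
  rewrite -{1}(ger0_norm rn0) -normrM.
  rewrite expr2 -(mulrA x) (osc_recC n x t0).
  rewrite (_ : x * (_ + _ - _ - _) * _ = - (n%:R * (x * As n.-1 t x) * r ^+ n) +
    3 * eta * (t * (x * As n.+2 t x) * r ^+ n) - eta * (t * (x * As n t x) * r ^+ n)
    - 3 * (t * (x * Ac n.+2 t x) * r ^+ n)); last by ring.
  move: (P1 _ h1s) (P2 _ h2s) (P3 _ h3s) (P2 _ h2c).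
  move: (n%:R * (x * As n.-1 t x) * r ^+ n) (t * (x * As n.+2 t x) * r ^+ n) (t * (x * As n t x) * r ^+ n)
    (t * (x * Ac n.+2 t x) * r ^+ n) => A B C D hA hB hC hD.
  rewrite [X in `|X|](_ : _ = 0 + - A + 3 * eta * B + eta * - C + 3 * - D); last by ring.
  rewrite [leRHS](_ : _ = 0 + n%:R * c1 * r + 3 * eta * (c2 * r) + eta * (rho ^+ 2 * c3 * r) + 3 * (c2 * r)); last by ring.
  by apply: norm_comb_le; rewrite ?normrN ?normr0.
move=> n0; rewrite -{1}(ger0_norm rn0) -normrM.
rewrite expr2 -(mulrA x) (osc_recS n x t0) (gtn_eqF n0) /= add0r.
rewrite (_ : x * (_ - _ + _ - _) * _ = n%:R * (x * Ac n.-1 t x) * r ^+ n -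
  3 * eta * (t * (x * Ac n.+2 t x) * r ^+ n) + eta * (t * (x * Ac n t x) * r ^+ n)
  - 3 * (t * (x * As n.+2 t x) * r ^+ n)); last by ring.
move: (P1 _ h1c) (P2 _ h2c) (P3 _ h3c) (P2 _ h2s).
move: (n%:R * (x * Ac n.-1 t x) * r ^+ n) (t * (x * Ac n.+2 t x) * r ^+ n) (t * (x * Ac n t x) * r ^+ n)
  (t * (x * As n.+2 t x) * r ^+ n) => A B C D hA hB hC hD.
rewrite [X in `|X|](_ : _ = 0 + A + 3 * eta * - B + eta * C + 3 * - D); last by ring.
rewrite [leRHS](_ : _ = 0 + n%:R * c1 * r + 3 * eta * (c2 * r) + eta * (rho ^+ 2 * c3 * r) + 3 * (c2 * r)); last by ring.
by apply: norm_comb_le; rewrite ?normrN ?normr0.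
Qed.

Lemma kernel_decay0 T : 0 < T -> exists2 c : R, 0 <= c &
  forall t x, 0 < t -> t <= T -> `|Ac 0 t x| <= c * pois (cbrt t) x.
Proof.
move=> T0; have [c1 c10 h1] := @osc_bound R eta heta T 0 T0.
have [c2 c20 h2] := @osc_decay2 T 0 T0.
exists (c1 + c2); first exact: addr_ge0.
move=> t x t0 tT; have r0 := cbrt_gt0 t0.
have [{}h1 _] := h1 t x t0 tT; have [{}h2 _] := h2 t x t0 tT.
set r := cbrt t in r0 h1 h2 *.
have D0 : 0 < r ^+ 2 + x ^+ 2 by rewrite ltr_pwDl ?exprn_gt0// sqr_ge0.
rewrite /pois mulrA ler_pdivlMr// mulrDr mulrDl.
apply: lerD; first by rewrite expr2 mulrA ler_wpM2r// ltW.
by move: h2; rewrite expr0 mulr1 normrM (ger0_norm (sqr_ge0 _)) mulrC.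
Qed.

(** The recursion for [As 1] involves only integrals with second-order decay, so that a third
    power of [1 / x] is available. *)
Lemma kernel_decay1 T : 0 < T -> exists2 c : R, 0 <= c &
  forall t x, 0 < t -> t <= T -> `|As 1 t x| <= c * gam (cbrt t) x.
Proof.
move=> T0; pose rho := cbrt T.
have [c0 c00 h0] := @osc_bound R eta heta T 1 T0.
have [c1 c10 h1] := @osc_decay2 T 0 T0.
have [c2 c20 h2] := @osc_decay2 T 3 T0.
have [c3 c30 h3] := @osc_decay2 T 1 T0.
pose C := c1 + 3 * eta * c2 + eta * rho ^+ 2 * c3 + 3 * c2.
exists (4 * (c0 + C)).
  by rewrite /C mulr_ge0 ?addr_ge0// ?mulr_ge0 ?exprn_ge0 ?cbrt_ge0// (ltW heta).
move=> t x t0 tT; have r0 := cbrt_gt0 t0.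
have [_ {}h0] := h0 t x t0 tT.
have [{}h1 _] := h1 t x t0 tT.
have [h2c /(_ isT) h2s] := h2 t x t0 tT; have [h3c /(_ isT) h3s] := h3 t x t0 tT.
have rrho : cbrt t ^+ 2 <= rho ^+ 2.
  by rewrite ler_pXn2r// ?nnegrE ?cbrt_ge0// cbrt_le// (ltW t0).
have tE : t = cbrt t ^+ 3 by rewrite cbrtK// (ltW t0).
set r := cbrt t in r0 rrho tE h0 h1 h2c h2s h3c h3s *.
have e0 := ltW heta.
have H3 : `|x ^+ 3 * As 1 t x| <= C * r.
  have -> : x ^+ 3 * As 1 t x = x ^+ 2 * Ac 0 t x - 3 * eta * (t * (x ^+ 2 * Ac 3 t x))
     + eta * (t * (x ^+ 2 * Ac 1 t x)) - 3 * (t * (x ^+ 2 * As 3 t x)).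
    by rewrite exprSr -(mulrA _ x) (osc_recS 1 x t0) /=; ring.
  have P2 (u : R) : `|u| * r ^+ 3 <= c2 * r -> `|t * u| <= c2 * r.
    by move=> hu; rewrite normrM (gtr0_norm t0) tE mulrC.
  have P3 (u : R) : `|u| * r ^+ 1 <= c3 * r -> `|t * u| <= rho ^+ 2 * c3 * r.
    move=> hu; rewrite normrM (gtr0_norm t0) tE.
    rewrite (_ : r ^+ 3 * `|u| = r ^+ 2 * (`|u| * r ^+ 1)); last by ring.
    by rewrite -mulrA; apply: ler_pM => //; rewrite ?exprn_ge0 ?mulr_ge0 ?exprn_ge0 ?(ltW r0).
  move: h1 (P2 _ h2c) (P3 _ h3c) (P2 _ h2s); rewrite expr0 mulr1.
  move: (x ^+ 2 * Ac 0 t x) (t * (x ^+ 2 * Ac 3 t x)) (t * (x ^+ 2 * Ac 1 t x))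
    (t * (x ^+ 2 * As 3 t x)) => A B C' D hA hB hC hD.
  rewrite [X in `|X|](_ : _ = 0 + A + 3 * eta * - B + eta * C' + 3 * - D); last by ring.
  rewrite [leRHS](_ : _ = 0 + c1 * r + 3 * eta * (c2 * r) + eta * (rho ^+ 2 * c3 * r) + 3 * (c2 * r)); last by rewrite /C; ring.
  by apply: norm_comb_le; rewrite ?normrN ?normr0.
have D0 : 0 < (r + `|x|) ^+ 3 by rewrite exprn_gt0// ltr_pwDl.
rewrite /gam mulrA ler_pdivlMr//.
have hx : (r + `|x|) ^+ 3 <= 4 * (r ^+ 3 + `|x| ^+ 3).
  have x0 := normr_ge0 x; have : 0 <= (r + `|x|) * (r - `|x|) ^+ 2.
    by rewrite mulr_ge0 ?sqr_ge0// addr_ge0// ltW.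
  by move: (`|x|) x0 => u u0; nra.
apply: (le_trans (ler_wpM2l (normr_ge0 _) hx)).
have -> : `|As 1 t x| * (4 * (r ^+ 3 + `|x| ^+ 3)) =
   4 * (`|As 1 t x| * r ^+ 2 * r + `|x ^+ 3 * As 1 t x|).
  by rewrite normrM normrX; ring.
rewrite -(mulrA 4) ler_wpM2l// mulrDl; apply: lerD => //.
by rewrite ler_wpM2r// ltW.
Qed.

(** The cusp of the symbol at the origin leaves a nonzero tail: [x^3 As 1] tends to
    [- 2 eta t], uniformly for times in a compact subset of [ ]0, +oo[]. *)
Lemma kernel_tail_lower s T : 0 < s -> s <= T -> exists Z : R, exists2 c : R, 0 < c & 0 < Z /\
  forall t x, s <= t -> t <= T -> Z <= `|x| -> c <= `|x| ^+ 3 * `|As 1 t x|.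
Proof.
move=> s0 sT; have T0 : 0 < T by rewrite (lt_le_trans s0).
pose rho := cbrt T; pose q := cbrt s.
have q0 : 0 < q by exact: cbrt_gt0.
have rho0 : 0 < rho by exact: cbrt_gt0.
have B1 n : exists2 c : R, 0 <= c & forall t x, s <= t -> t <= T ->
    `|t * (x * Ac n t x)| <= c /\ `|t * (x * As n t x)| <= c.
  have [c c0 h] := @osc_decay1 T n T0; exists (T * (c / q ^+ n)).
    by rewrite !mulr_ge0 ?invr_ge0 ?exprn_ge0// ltW.
  move=> t x st tT; have t0 : 0 < t by rewrite (lt_le_trans s0).
  have [h1 h2] := h t x t0 tT.
  have K (u : R) : `|u| * cbrt t ^+ n <= c -> `|t * u| <= T * (c / q ^+ n).
    move=> hu; rewrite normrM (gtr0_norm t0) ler_pM ?(ltW t0)// ler_pdivlMr ?exprn_gt0//.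
    apply: le_trans hu; rewrite ler_wpM2l// lerXn2r// ?nnegrE ?cbrt_ge0//.
    by rewrite cbrt_le// ltW.
  by split; exact: K.
have B2 n : exists2 c : R, 0 <= c & forall t x, s <= t -> t <= T ->
    `|t * (x ^+ 2 * Ac n t x)| <= c /\ ((0 < n)%N -> `|t * (x ^+ 2 * As n t x)| <= c).
  have [c c0 h] := @osc_decay2 T n T0; exists (T * (c * rho / q ^+ n)).
    by rewrite !mulr_ge0 ?invr_ge0 ?exprn_ge0// ltW.
  move=> t x st tT; have t0 : 0 < t by rewrite (lt_le_trans s0).
  have [h1 h2] := h t x t0 tT.
  have K (u : R) : `|u| * cbrt t ^+ n <= c * cbrt t -> `|t * u| <= T * (c * rho / q ^+ n).
    move=> hu; rewrite normrM (gtr0_norm t0) ler_pM ?(ltW t0)// ler_pdivlMr ?exprn_gt0//.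
    have hc : c * cbrt t <= c * rho by rewrite ler_wpM2l// cbrt_le// ltW.
    apply: le_trans hc; apply: le_trans hu; rewrite ler_wpM2l// lerXn2r// ?nnegrE ?cbrt_ge0//.
    by rewrite cbrt_le// ltW.
  by split=> [|n0]; apply: K => //; exact: h2.
have [a0 a00 A0] := B1 0%N; have [a1 a10 A1] := B1 1%N; have [a2 a20 A2] := B1 2%N.
have [a3 a30 A3] := B1 3%N.
have [b1 b10 H1] := B2 1%N; have [b2 b20 H2] := B2 2%N; have [b3 b30 H3] := B2 3%N.
have [b5 b50 H5] := B2 5%N.
pose M := a0 + a1 + a2 + a3 + b1 + b2 + b3 + b5.
have M0 : 0 <= M by rewrite !addr_ge0.
have [[m0 m2] n1 n2 n3 n5] : [/\ a0 <= M /\ a2 <= M, b1 <= M, b2 <= M, b3 <= M & b5 <= M].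
  by rewrite /M; clear -a00 a10 a20 a30 b10 b20 b30 b50; split; [split| | | |]; lra.
have e0 := ltW heta.
pose N := 24 * eta ^+ 2 + 30 * eta + 9.
pose L := M * (12 * eta + 12) + T * (M * N).
have N0 : 0 <= N by rewrite !addr_ge0// ?mulr_ge0// ?exprn_ge0.
have T0' := ltW T0.
have L0 : 0 <= L by rewrite addr_ge0 ?mulr_ge0 ?addr_ge0 ?mulr_ge0.
(* Expanding [x^4 As 1] by the recursions, all terms but [- 2 eta t x] contain one of the
   integrals bounded by [B1] or [B2]. *)
have key t x : s <= t -> t <= T -> `|x * (x ^+ 3 * As 1 t x + 2 * eta * t)| <= L.
  move=> st tT; have t0 : 0 < t by rewrite (lt_le_trans s0).
  have E1 := osc_recS 1 x t0; have E0 := osc_recC 0 x t0; have F0 := osc_recS 0 x t0.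
  have F1 := osc_recC 1 x t0; have E3 := osc_recC 3 x t0; have F3 := osc_recS 3 x t0.
  rewrite /= in E1 E0 F0 F1 E3 F3.
  have E : x * (x ^+ 3 * As 1 t x + 2 * eta * t) =
    12 * eta * (t * (x ^+ 2 * As 2 t x)) - 12 * (t * (x ^+ 2 * Ac 2 t x)) +
    t * (6 * (eta ^+ 2 * (t * (x * Ac 2 t x))) - 2 * (eta ^+ 2 * (t * (x * Ac 0 t x)))
     + 6 * (eta * (t * (x * As 2 t x))) + 6 * (eta ^+ 2 * (t * (x ^+ 2 * As 3 t x)))
     - eta ^+ 2 * (t * (x ^+ 2 * As 1 t x)) - 6 * (eta * (t * (x ^+ 2 * Ac 3 t x)))
     - 9 * (eta ^+ 2 * (t * (x ^+ 2 * As 5 t x))) + 18 * (eta * (t * (x ^+ 2 * Ac 5 t x)))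
     + 9 * (t * (x ^+ 2 * As 5 t x))).
    have -> : x ^+ 3 * As 1 t x = x ^+ 2 * (x * As 1 t x) by ring.
    rewrite E1.
    have -> : x ^+ 2 * (0 + 1 * Ac 0 t x - 3 * eta * t * Ac 3 t x + eta * t * Ac 1 t x - 3 * t * As 3 t x)
      = x * (x * Ac 0 t x) - 3 * eta * t * (x * (x * Ac 3 t x)) + eta * t * (x * (x * Ac 1 t x))
        - 3 * t * (x * (x * As 3 t x)) by ring.
    rewrite F1 E3 F3.
    have -> : x * (x * Ac 0 t x) = 3 * eta * t * (x * As 2 t x) - eta * t * (x * As 0 t x) - 3 * t * (x * Ac 2 t x).
      by rewrite E0; ring.
    have -> : x * (- (1 * As 0 t x) + 3 * eta * t * As 3 t x - eta * t * As 1 t x - 3 * t * Ac 3 t x) =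
      - (x * As 0 t x) + 3 * eta * t * (x * As 3 t x) - eta * t * (x * As 1 t x) - 3 * t * (x * Ac 3 t x).
      by ring.
    by rewrite F0; ring.
  rewrite E {E E1 E0 F0 F1 E3 F3}.
  have [y01 y02] := A0 t x st tT.
  have [y21 y22] := A2 t x st tT.
  have [x11 /(_ isT) x12] := H1 t x st tT; have [x21 /(_ isT) x22] := H2 t x st tT.
  have [x31 /(_ isT) x32] := H3 t x st tT; have [x51 /(_ isT) x52] := H5 t x st tT.
  have up (u c : R) : `|u| <= c -> c <= M -> `|u| <= M /\ `|eta * u| <= eta * M /\ `|eta ^+ 2 * u| <= eta ^+ 2 * M.
    move=> uc cM; have uM : `|u| <= M by exact: le_trans cM.
    have e2 : 0 <= eta ^+ 2 by exact: exprn_ge0.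
    rewrite (normrM eta) (normrM (eta ^+ 2)) (ger0_norm e0) (ger0_norm e2).
    by split=> //; split; apply: ler_wpM2l => //; exact: exprn_ge0.
  have [_ [_ k1]] := up _ _ y01 m0.
  have [_ [_ k2]] := up _ _ y21 m2.
  have [_ [k3 _]] := up _ _ y22 m2.
  have [_ [_ k4]] := up _ _ x12 n1.
  have [k5 [_ _]] := up _ _ x21 n2.
  have [_ [k6 _]] := up _ _ x22 n2.
  have [_ [k7 _]] := up _ _ x31 n3.
  have [_ [_ k8]] := up _ _ x32 n3.
  have [_ [k9 _]] := up _ _ x51 n5.
  have [k10 [_ k11]] := up _ _ x52 n5.
  rewrite -(mulrA 12 eta); clear -k1 k2 k3 k4 k5 k6 k7 k8 k9 k10 k11 M0 e0 N0 tT t0.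
  apply: (le_trans (ler_normD _ _)); apply: lerD.
    rewrite (_ : M * (12 * eta + 12) = 12 * (eta * M) + 12 * M); last by ring.
    apply: (le_trans (ler_normB _ _)).
    by apply: lerD; rewrite normrM normr_nat; apply: ler_wpM2l.
  rewrite normrM (gtr0_norm t0); apply: ler_pM => //; first exact: ltW.
  move: k1 k2 k3 k4 k7 k8 k9 k10 k11; clear.
  rewrite !ler_norml => /andP[? ?] /andP[? ?] /andP[? ?] /andP[? ?] /andP[? ?].
  move=> /andP[? ?] /andP[? ?] /andP[? ?] /andP[? ?].
  by rewrite /N; apply/andP; split; lra.
exists (L / (eta * s) + 1), (eta * s); first by rewrite mulr_gt0.
have es0 : 0 < eta * s by rewrite mulr_gt0.
split; first by rewrite ltr_wpDl// divr_ge0// ltW.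
move=> t x st tT Zx.
have x0 : 0 < `|x| by apply: lt_le_trans Zx; rewrite ltr_wpDl// divr_ge0// ltW.
have h := key t x st tT.
have h1 : L <= eta * s * `|x|.
  by rewrite -ler_pdivrMl// mulrC (le_trans _ Zx)// lerDl.
have h2 : `|x ^+ 3 * As 1 t x + 2 * eta * t| <= eta * s.
  by rewrite -(ler_pM2l x0) -normrM (le_trans h)// mulrC.
rewrite -normrX -normrM.
have h3 : eta * s <= eta * t by rewrite ler_pM2l.
move: h2; rewrite ler_norml => /andP[_ h2].
have h4 : - (x ^+ 3 * As 1 t x) <= `|x ^+ 3 * As 1 t x| by rewrite -normrN ler_norm.
move: h2 h3 h4; move: (x ^+ 3 * As 1 t x) => X; rewrite -(mulrA 2); clear.
move: (eta * s) (eta * t) (`|X|) => P Q N' h2 h3 h4; lra.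
Qed.

End kernel_decay.

(** * Real-valued Fubini theorem and changes of variables *)

Section real_integrals.
Context d (T : measurableType d) (R : realType) (m : {measure set T -> \bar R}).
Implicit Types (D : set T) (f g : T -> R).

Lemma integrable_RZ D f (a : R) : measurable D -> m.-integrable D (EFin \o f) ->
  m.-integrable D (EFin \o (fun x => a * f x)).
Proof.
move=> mD fi; change (m.-integrable D (fun z => a%:E * (f z)%:E)%E).
exact: integrableZl.
Qed.

Lemma integrable_RB D f g : measurable D -> m.-integrable D (EFin \o f) ->
  m.-integrable D (EFin \o g) -> m.-integrable D (EFin \o (fun x => f x - g x)).
Proof.
move=> mD fi gi; change (m.-integrable D (fun z => (f z)%:E - (g z)%:E)%E).
exact: integrableB.
Qed.

Lemma measurable_integrable D f : m.-integrable D (EFin \o f) -> measurable_fun D f.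
Proof. by move=> /measurable_int/measurable_EFinP. Qed.

Lemma le_integrable_R D f g : measurable D -> measurable_fun D f ->
  (forall x, D x -> `|f x| <= g x) -> m.-integrable D (EFin \o g) ->
  m.-integrable D (EFin \o f).
Proof.
move=> mD mf fg gi; apply: (le_integrable mD _ _ gi).
  exact/measurable_EFinP.
by move=> x Dx /=; rewrite lee_fin (le_trans (fg x Dx))// ler_norm.
Qed.

Lemma integrableR_lty D f : measurable_fun D f ->
  (\int[m]_(x in D) `|f x|%:E < +oo)%E -> m.-integrable D (EFin \o f).
Proof.
by move=> mf fi; apply/integrableP; split => //; exact/measurable_EFinP.
Qed.

Lemma integrableR_ltyE D f : m.-integrable D (EFin \o f) ->
  (\int[m]_(x in D) `|f x|%:E < +oo)%E.
Proof. by move=> /integrableP[]. Qed.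

Lemma abs_Rintegral_le D f : measurable D -> measurable_fun D f ->
  (`|\int[m]_(x in D) f x|%:E <= \int[m]_(x in D) `|f x|%:E)%E.
Proof.
move=> mD mf; have [fi|/negP] := boolP (m.-integrable D (EFin \o f)).
  have nfi : m.-integrable D (EFin \o (fun x => `|f x|)) by exact: integrable_norm fi.
  rewrite -[leRHS]fineK; last by apply: integrable_fin_num.
  by rewrite lee_fin; exact: le_normr_Rintegral.
move=> nfi; suff -> : (\int[m]_(x in D) `|f x|%:E = +oo)%E by rewrite leey.
apply/eqP; rewrite -leye_eq leNgt; apply/negP => h.
by apply: nfi; exact: integrableR_lty.
Qed.

Lemma Rintegral_fineK D f : measurable D -> m.-integrable D (EFin \o f) ->
  (\int[m]_(x in D) (f x)%:E)%E = (\int[m]_(x in D) f x)%:E.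
Proof. by move=> mD fi; rewrite /Rintegral fineK//; exact: integrable_fin_num. Qed.

End real_integrals.

Section real_fubini.
Context d1 d2 (T1 : measurableType d1) (T2 : measurableType d2) (R : realType).
Variable m1 : {sigma_finite_measure set T1 -> \bar R}.
Variable m2 : {sigma_finite_measure set T2 -> \bar R}.
Variable f : T1 * T2 -> R.
Local Notation m12 := (m1 \x m2)%E.

(** The partial integral is measurable even where it fails to converge, because it is
    obtained from the integrals of the positive and negative parts. *)
Lemma measurable_Rintegral_l : measurable_fun setT f ->
  measurable_fun setT (fun x => \int[m2]_y f (x, y)).
Proof.
move=> mf; apply: (measurableT_comp (fine_measurable measurableT)).
rewrite (_ : (fun x => _) =
  (fun x => fubini_F m2 (EFin \o f)^\+ x - fubini_F m2 (EFin \o f)^\- x)%E); last first.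
  apply/funext => x; rewrite integralE; congr (_ - _)%E.
    by apply: eq_integral => y _; rewrite !funeposE.
  by apply: eq_integral => y _; rewrite !funenegE.
have mEf : measurable_fun setT (EFin \o f) by exact/measurable_EFinP.
by apply: emeasurable_funB; apply: measurable_fun_fubini_tonelli_F;
  (exact: measurable_funepos || exact: measurable_funeneg || exact: funepos_ge0
   || exact: funeneg_ge0).
Qed.

Lemma measurable_Rintegral_r : measurable_fun setT f ->
  measurable_fun setT (fun y => \int[m1]_x f (x, y)).
Proof.
move=> mf; apply: (measurableT_comp (fine_measurable measurableT)).
rewrite (_ : (fun y => _) =
  (fun y => fubini_G m1 (EFin \o f)^\+ y - fubini_G m1 (EFin \o f)^\- y)%E); last first.
  apply/funext => x; rewrite integralE; congr (_ - _)%E.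
    by apply: eq_integral => y _; rewrite !funeposE.
  by apply: eq_integral => y _; rewrite !funenegE.
have mEf : measurable_fun setT (EFin \o f) by exact/measurable_EFinP.
by apply: emeasurable_funB; apply: measurable_fun_fubini_tonelli_G;
  (exact: measurable_funepos || exact: measurable_funeneg || exact: funepos_ge0
   || exact: funeneg_ge0).
Qed.

Hypothesis fi : m12.-integrable setT (EFin \o f).

Let mf : measurable_fun setT f := measurable_integrable fi.

Let aeF : {ae m1, forall x, (fubini_F m2 (EFin \o f) x = (\int[m2]_y f (x, y))%:E)%E}.
Proof.
apply: filterS (ae_integrable1 fi) => x xi.
by rewrite /fubini_F /Rintegral fineK//; exact: integrable_fin_num.
Qed.

Let aeG : {ae m2, forall y, (fubini_G m1 (EFin \o f) y = (\int[m1]_x f (x, y))%:E)%E}.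
Proof.
apply: filterS (ae_integrable2 fi) => x xi.
by rewrite /fubini_G /Rintegral fineK//; exact: integrable_fin_num.
Qed.

Lemma Rfubini_l : \int[m1]_x (\int[m2]_y f (x, y)) = \int[m12]_z f z.
Proof.
rewrite [in RHS]/Rintegral -(integral12_prod_meas1 fi); congr fine.
apply: ae_eq_integral => //.
- exact/measurable_EFinP/measurable_Rintegral_l.
- exact: (measurable_fubini_F fi).
- by apply: filterS aeF => x /= + _ => ->.
Qed.

Lemma Rfubini_r : \int[m2]_y (\int[m1]_x f (x, y)) = \int[m12]_z f z.
Proof.
rewrite [in RHS]/Rintegral -(integral21_prod_meas1 fi); congr fine.
apply: ae_eq_integral => //.
- exact/measurable_EFinP/measurable_Rintegral_r.
- exact: (measurable_fubini_G fi).
- by apply: filterS aeG => x /= + _ => ->.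
Qed.

Lemma Rfubini : \int[m1]_x (\int[m2]_y f (x, y)) = \int[m2]_y (\int[m1]_x f (x, y)).
Proof. by rewrite Rfubini_l Rfubini_r. Qed.

End real_fubini.

Section real_change_of_variables.
Context (R : realType).
Local Notation mu := (@lebesgue_measure R).

Lemma Rintegral_subl (c : R) (f : R -> R) : measurable_fun setT f ->
  \int[mu]_x f (c - x) = \int[mu]_x f x.
Proof.
move=> mf; congr fine; apply: (integral_subl c (f := EFin \o f)).
exact/measurable_EFinP.
Qed.

Lemma Rintegral_shift (c : R) (f : R -> R) : measurable_fun setT f ->
  \int[mu]_x f (x + c) = \int[mu]_x f x.
Proof.
move=> mf; congr fine; apply: (integral_shift c (f := EFin \o f)).
exact/measurable_EFinP.
Qed.

Lemma Rintegral_opp (f : R -> R) : measurable_fun setT f ->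
  \int[mu]_x f (- x) = \int[mu]_x f x.
Proof.
move=> mf; congr fine; apply: (integral_opp (f := EFin \o f)).
exact/measurable_EFinP.
Qed.

Lemma Rintegral_scale (a : R) (f : R -> R) : 0 < a -> mu.-integrable setT (EFin \o f) ->
  mu.-integrable setT (EFin \o (fun x => f (a * x))) /\
  a * (\int[mu]_x f (a * x)) = \int[mu]_x f x.
Proof.
move=> a0 fi; have mf : measurable_fun [set: R] f := measurable_integrable fi.
have ma : measurable_fun [set: R] (fun x => f (a * x)).
  by apply: measurableT_comp => //; exact: measurable_funM.
have mEf : measurable_fun [set: R] (EFin \o f) by exact/measurable_EFinP.
have E (g : R -> \bar R) : measurable_fun [set: R] g -> (forall x, 0 <= g x)%E ->
   (\int[mu]_x g (a * x)%R = (a^-1)%:E * \int[mu]_x g x)%E.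
  move=> mg g0; rewrite -(ge0_integral_scale a0 mg g0) muleA -EFinM mulVf ?gt_eqF//.
  by rewrite mul1e.
have h : mu.-integrable setT (EFin \o (fun x => f (a * x))).
  apply: integrableR_lty => //.
  rewrite (E (fun x => `|f x|%:E)) => //.
    by rewrite lte_mul_pinfty ?lee_fin ?invr_ge0 ?(ltW a0)// integrableR_ltyE.
  by apply/measurable_EFinP; exact: measurableT_comp.
split=> //.
rewrite /Rintegral integralE [in RHS]integralE.
have -> : (\int[mu]_x (fun z : R => (f (a * z)%R)%:E)^\+ x =
    (a^-1)%:E * \int[mu]_x (EFin \o f)^\+ x)%E.
  rewrite -E; [|exact: measurable_funepos|exact: funepos_ge0].
  by apply: eq_integral => x _; rewrite !funeposE.
have -> : (\int[mu]_x (fun z : R => (f (a * z)%R)%:E)^\- x =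
    (a^-1)%:E * \int[mu]_x (EFin \o f)^\- x)%E.
  rewrite -E; [|exact: measurable_funeneg|exact: funeneg_ge0].
  by apply: eq_integral => x _; rewrite !funenegE.
have aux (P Q : \bar R) : P \is a fin_num -> Q \is a fin_num ->
    a * fine ((a^-1)%:E * P - (a^-1)%:E * Q)%E = fine (P - Q)%E.
  by move: P Q => [u| |] [v| |]//= _ _; field; rewrite gt_eqF.
apply: aux; first exact: integrable_pos_fin_num.
exact: integrable_neg_fin_num.
Qed.

End real_change_of_variables.

(** * The kernel as an oscillatory integral *)

Section kernel_formulas.
Context (R : realType) (eta : R) (heta : 0 < eta).
Local Notation mu := (@lebesgue_measure R).
Local Notation hl := (`[0, +oo[%classic : set R).
Local Notation Ac := (Ac eta).
Local Notation As := (As eta).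
Local Notation damp := (damp eta).
Implicit Types (t x xi : R) (n : nat).

Definition fourier_integrand t x xi := damp t `|xi| * cos (x * xi + xi ^+ 3 * t).

Lemma Kernel_fourier t x :
  Defs.Kernel eta t x = (2 * pi)^-1 * \int[mu]_xi fourier_integrand t x xi.
Proof.
rewrite /Defs.Kernel /invFourier /cintegral /Ksymbol /cexp /= !(mul0r, addr0, subr0).
congr (_ * _); apply: eq_Rintegral => xi _.
by rewrite /fourier_integrand /damp cosD expR0; ring.
Qed.

Lemma fourier_integrandN t x xi :
  fourier_integrand t x (- xi) = fourier_integrand t x xi.
Proof.
rewrite /fourier_integrand normrN -cosN; congr (_ * cos _); ring.
Qed.

Lemma measurable_damp d (T : measurableType d) (D : set T) (f g : T -> R) :
  measurable_fun D f -> measurable_fun D g ->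
  measurable_fun D (fun u => damp (f u) (g u)).
Proof.
move=> mf mg; apply: (measurableT_comp (@measurable_expR R)).
apply: measurable_funN; apply: measurable_funM; first exact: measurable_funM.
by apply: measurable_funB => //; exact: measurable_funX.
Qed.

Lemma measurable_cos d (T : measurableType d) (D : set T) (f : T -> R) :
  measurable_fun D f -> measurable_fun D (fun u => cos (f u)).
Proof.
move=> mf; apply: measurableT_comp => //; apply: continuous_measurable_fun.
exact: continuous_cos.
Qed.

Lemma measurable_sin d (T : measurableType d) (D : set T) (f : T -> R) :
  measurable_fun D f -> measurable_fun D (fun u => sin (f u)).
Proof.
move=> mf; apply: measurableT_comp => //; apply: continuous_measurable_fun.
exact: continuous_sin.
Qed.

Lemma measurable_phase d (T : measurableType d) (D : set T) (f g h : T -> R) :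
  measurable_fun D f -> measurable_fun D g -> measurable_fun D h ->
  measurable_fun D (fun u => f u * g u + g u ^+ 3 * h u).
Proof.
move=> mf mg mh; apply: measurable_funD; apply: measurable_funM => //.
exact: measurable_funX.
Qed.

Lemma measurable_fourier_integrand t x : measurable_fun setT (fourier_integrand t x).
Proof.
apply: measurable_funM.
  by apply: measurable_damp => //.
by apply: measurable_cos; exact: measurable_phase.
Qed.

Lemma damp_integrable t : 0 < t -> mu.-integrable setT (EFin \o (fun xi => damp t `|xi|)).
Proof.
move=> t0; have [c c0 h] := @moment_le_pois R eta heta t 0 t0.
have r0 := cbrt_gt0 t0.
apply: (@le_integrable_R _ _ _ mu setT _ (fun xi => c / cbrt t ^+ 1 * pois (cbrt t)^-1 xi)) => //.
- exact: measurable_damp.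
- move=> xi _; rewrite ger0_norm ?damp_ge0//.
  have := h t `|xi| t0 (lexx _) (normr_ge0 _); rewrite mul1r => /le_trans; apply.
  by rewrite /pois real_normK ?num_real.
- by apply: integrable_RZ => //; apply: integrable_pois; rewrite invr_gt0.
Qed.

Lemma fourier_integrand_le t x xi : `|fourier_integrand t x xi| <= damp t `|xi|.
Proof.
by rewrite normrM ger0_norm ?damp_ge0// ler_piMr ?damp_ge0 ?cos_max.
Qed.

Lemma fourier_integrable t x : 0 < t ->
  mu.-integrable setT (EFin \o fourier_integrand t x).
Proof.
move=> t0; apply: (@le_integrable_R _ _ _ mu setT _ (fun xi => damp t `|xi|)) => //.
- exact: measurable_fourier_integrand.
- by move=> xi _; exact: fourier_integrand_le.
- exact: damp_integrable.
Qed.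

Lemma Kernel_Ac t x : 0 < t -> Defs.Kernel eta t x = pi^-1 * Ac 0 t x.
Proof.
move=> t0; rewrite Kernel_fourier.
have E : \int[mu]_xi fourier_integrand t x xi = 2 * Ac 0 t x.
  rewrite /Rintegral integral_even; last 2 first.
    exact: fourier_integrable.
    by move=> xi; rewrite fourier_integrandN.
  rewrite fineM//; last first.
    apply: integrable_fin_num => //; apply: integrableS (fourier_integrable x t0) => //.
  congr (_ * fine _); apply: eq_integral => xi; rewrite inE/= in_itv/= andbT => xi0.
  by rewrite /fourier_integrand /osc expr0 mul1r ger0_norm.
by rewrite E invfM -mulrA mulrCA mulKf.
Qed.

Lemma is_derive_osc_x t x xi :
  is_derive x (1 : R) (fun z => osc eta 0 t z xi) (- osn eta 1 t x xi).
Proof.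
have h3 : is_derive x (1 : R) (fun z => cos (z * xi + xi ^+ 3 * t))
   (- sin (x * xi + xi ^+ 3 * t) * xi).
  by apply: is_derive_eq; rewrite /GRing.scale/=; ring.
by rewrite /osc /osn; apply: is_derive_eq; rewrite /GRing.scale/= expr0 expr1; ring.
Qed.

Lemma is_derive_Kernel t x : 0 < t ->
  is_derive x (1 : R) (Defs.Kernel eta t) (- (pi^-1 * As 1 t x)).
Proof.
move=> t0.
have mom1 : mu.-integrable hl (EFin \o (fun xi => `|xi * damp t xi|)).
  have [c c0 h] := @moment_le_pois R eta heta t 1 t0.
  apply: (@le_integrable_R _ _ _ mu hl _ (fun xi => c / cbrt t ^+ 2 * pois (cbrt t)^-1 xi)) => //.
  - apply: measurableT_comp => //; apply: measurable_funM => //; exact: measurable_damp.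
  - move=> xi /=; rewrite in_itv/= andbT => xi0; rewrite normr_id ger0_norm ?h//.
    by rewrite mulr_ge0 ?damp_ge0.
  - apply: integrableS (_ : mu.-integrable setT _) => //.
    by apply: integrable_RZ => //; apply: integrable_pois; rewrite invr_gt0 cbrt_gt0.
have der := @is_derive_osc_x t.
have Ix : `]x - 1, x + 1[%classic x by rewrite /= in_itv/= ltrBlDr ltrDl ltr01.
have dx y xi : partial1of2 (fun x xi => osc eta 0 t x xi) y xi = - osn eta 1 t y xi.
  by rewrite partial1of2E; case: (der y xi).
have bd y xi : `]x - 1, x + 1[%classic y -> hl xi ->
    `|partial1of2 (fun x xi => osc eta 0 t x xi) y xi| <= `|xi * damp t xi|.
  move=> _ /=; rewrite in_itv/= andbT => xi0.
  rewrite dx normrN (le_trans (osn_le _ _ _ _ xi0))// expr1.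
  exact: ler_norm.
have dble y xi : `]x - 1, x + 1[%classic y -> hl xi ->
    derivable ((fun x xi => osc eta 0 t x xi)^~ xi) y 1.
  by move=> _ _; case: (der y xi).
have it y : `]x - 1, x + 1[%classic y -> mu.-integrable hl (EFin \o (fun xi => osc eta 0 t y xi)).
  by move=> _; exact: osc_integrable.
have mhl : measurable (hl : set (measurableTypeR R)) by [].
have d1 := derivable_under_integral mhl Ix it dble (fun _ => normr_ge0 _) mom1 bd.
have d2 := differentiation_under_integral mhl Ix it dble (fun _ => normr_ge0 _) mom1 bd.
have KE : Defs.Kernel eta t = (fun x => pi^-1 * Ac 0 t x).
  by apply/funext => z; exact: Kernel_Ac.
have h : is_derive x (1 : R) (fun z => Ac 0 t z) (- As 1 t x).
  apply: DeriveDef => //; rewrite -derive1E [LHS]d2.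
  under eq_Rintegral do rewrite dx -mulN1r.
  by rewrite RintegralZl ?mulN1r//; exact: osn_integrable.
by rewrite KE; apply: is_derive_eq; rewrite /GRing.scale/= mulrN.
Qed.

Lemma dxKernel_As t x : 0 < t -> dxKernel eta t x = - (pi^-1 * As 1 t x).
Proof. by move=> t0; rewrite /dxKernel derive1E; case: (is_derive_Kernel x t0). Qed.

Lemma is_derive_Kernel' t x : 0 < t ->
  is_derive x (1 : R) (Defs.Kernel eta t) (dxKernel eta t x).
Proof. by move=> t0; rewrite (dxKernel_As x t0); exact: is_derive_Kernel. Qed.

Lemma measurable_Ac n : measurable_fun setT (fun z : R * R => Ac n z.1 z.2).
Proof.
rewrite (_ : (fun z : R * R => Ac n z.1 z.2) =
  (fun z => \int[mu]_xi (osc eta n z.1 z.2 xi * \1_hl xi))); last first.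
  apply/funext => z; rewrite /Ac Rintegral_mkcond; apply: eq_Rintegral => xi _.
  by rewrite patchE indicE; case: ifPn; rewrite ?mulr1 ?mulr0.
have h : measurable_fun setT (fun w : R * R * measurableTypeR R => osc eta n w.1.1 w.1.2 w.2 * \1_hl w.2).
  apply: measurable_funM; last exact: measurableT_comp.
  apply: measurable_funM; last apply: measurable_cos.
    apply: measurable_funM; first exact: measurable_funX.
    by apply: measurable_damp => //; exact: measurableT_comp.
  by apply: measurable_phase => //; exact: measurableT_comp.
exact: (measurable_Rintegral_l mu h).
Qed.

Lemma measurable_As n : measurable_fun setT (fun z : R * R => As n z.1 z.2).
Proof.
rewrite (_ : (fun z : R * R => As n z.1 z.2) =
  (fun z => \int[mu]_xi (osn eta n z.1 z.2 xi * \1_hl xi))); last first.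
  apply/funext => z; rewrite /As Rintegral_mkcond; apply: eq_Rintegral => xi _.
  by rewrite patchE indicE; case: ifPn; rewrite ?mulr1 ?mulr0.
have h : measurable_fun setT (fun w : R * R * measurableTypeR R => osn eta n w.1.1 w.1.2 w.2 * \1_hl w.2).
  apply: measurable_funM; last exact: measurableT_comp.
  apply: measurable_funM; last apply: measurable_sin.
    apply: measurable_funM; first exact: measurable_funX.
    by apply: measurable_damp => //; exact: measurableT_comp.
  by apply: measurable_phase => //; exact: measurableT_comp.
exact: (measurable_Rintegral_l mu h).
Qed.

End kernel_formulas.

Section dominated_and_product.

Lemma Rdominated_cvg d (T : measurableType d) (R : realType) (m : {measure set T -> \bar R})
  (f_ : nat -> T -> R) (f g : T -> R) :
  (forall n, measurable_fun setT (f_ n)) -> measurable_fun setT f ->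
  (forall x, f_ ^~ x @ \oo --> f x) -> m.-integrable setT (EFin \o g) ->
  (forall n x, `|f_ n x| <= g x) ->
  \int[m]_x f_ n x @[n --> \oo] --> \int[m]_x f x.
Proof.
move=> mf_ mf ff gi fg.
have [] := @dominated_convergence _ _ R m setT measurableT (fun n x => (f_ n x)%:E)
    (EFin \o f) (EFin \o g).
- by move=> n; exact/measurable_EFinP.
- exact/measurable_EFinP.
- by apply/aeW => x _; apply: cvg_EFin; [exact: nearW|exact: ff].
- exact: gi.
- by apply/aeW => x n _; rewrite lee_fin.
move=> fi _ h; apply: fine_cvg => //.
by rewrite fineK//; exact: integrable_fin_num.
Qed.

Lemma integrable_prod_le d1 d2 (T1 : measurableType d1) (T2 : measurableType d2)
  (R : realType) (m1 : {sigma_finite_measure set T1 -> \bar R})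
  (m2 : {sigma_finite_measure set T2 -> \bar R}) (f : T1 * T2 -> R) (g : T1 -> R) (h : T2 -> R) :
  measurable_fun setT f -> (forall x, 0 <= g x) -> (forall y, 0 <= h y) ->
  m1.-integrable setT (EFin \o g) -> m2.-integrable setT (EFin \o h) ->
  (forall x y, `|f (x, y)| <= g x * h y) ->
  (m1 \x m2)%E.-integrable setT (EFin \o f).
Proof.
move=> mf g0 h0 gi hi fgh.
have mEf : measurable_fun setT (EFin \o f) by exact/measurable_EFinP.
apply/integrable12ltyP => //.
have mg := measurable_integrable gi; have mh := measurable_integrable hi.
apply: (@le_lt_trans _ _ (\int[m1]_x (g x * fine (\int[m2]_y (h y)%:E))%:E)%E).
  apply: ge0_le_integral => //.
  - by move=> x _; exact: integral_ge0.
  - apply: (measurable_fun_fubini_tonelli_F (fun z => `|(EFin \o f) z|)%E) => //.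
    exact: measurableT_comp.
  - by apply/measurable_EFinP; exact: measurable_funM.
  - move=> x _; rewrite EFinM fineK; last exact: integrable_fin_num.
    rewrite -ge0_integralMl//; apply: ge0_le_integral => //.
    + apply: measurableT_comp => //; apply/measurable_EFinP.
      by apply: measurableT_comp mf _; exact: pair1_measurable.
    + by apply/measurable_EFinP; exact: measurable_funM.
    + by move=> y _; rewrite lee_fin.
under eq_integral do rewrite mulrC.
rewrite ge0_integralMl//; last by apply: fine_ge0; apply: integral_ge0 => y _; rewrite lee_fin.
rewrite -(fineK (integrable_fin_num measurableT gi)) -EFinM; exact: ltry.
Qed.

End dominated_and_product.

#[local] Opaque Defs.Kernel dxKernel.

(** * Fourier inversion and the semigroup law *)

Section fourier_inversion.
Context (R : realType) (eta : R) (heta : 0 < eta).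
Local Notation mu := (@lebesgue_measure R).
Local Notation K := (Defs.Kernel eta).
Local Notation G := (dxKernel eta).
Local Notation damp := (damp eta).
Implicit Types (t x y xi a b c e k : R).

Lemma expR_le_pois e y : 0 < e -> 0 <= y -> expR (- (e * y)) <= 2 / e * pois e^-1 y.
Proof.
move=> e0 y0; have ey : 0 <= e * y by rewrite mulr_ge0// ltW.
have h := expR_ge1Dxn 1 ey; rewrite (_ : (2`!)%N = 2%N)// in h.
have -> : 2 / e * pois e^-1 y = 2 / (1 + (e * y) ^+ 2).
  rewrite /pois; field.
  have := gt_eqF e0; have : 0 < 1 + (e * y) ^+ 2 by rewrite ltr_pwDl ?sqr_ge0.
  by rewrite exprMn => /gt_eqF -> ->.
rewrite expRN ler_pdivlMr ?ltr_pwDl ?sqr_ge0//.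
rewrite mulrC ler_pdivrMr ?expR_gt0//.
move: h; have := sqr_ge0 (e * y); move: ((e * y) ^+ 2) => u; lra.
Qed.

Lemma exp_cos_integrable e c k : 0 < e ->
  mu.-integrable setT (EFin \o (fun y => expR (- (e * `|y|)) * cos (c + k * y))).
Proof.
move=> e0; apply: (@le_integrable_R _ _ _ mu setT _ (fun y => 2 / e * pois e^-1 y)) => //.
- apply: measurable_funM.
    apply: (measurableT_comp (@measurable_expR R)); apply: measurable_funN.
    by apply: measurable_funM => //; exact: measurableT_comp.
  by apply: measurable_cos; apply: measurable_funD => //; exact: measurable_funM.
- move=> y _; rewrite normrM ger0_norm ?expR_ge0//.
  apply: (@le_trans _ _ (expR (- (e * `|y|)))).
    by rewrite ler_piMr ?expR_ge0 ?cos_max.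
  apply: (le_trans (expR_le_pois e0 (normr_ge0 y))).
  by rewrite /pois real_normK ?num_real.
- by apply: integrable_RZ => //; apply: integrable_pois; rewrite invr_gt0.
Qed.

Lemma laplace_cos e k : 0 < e ->
  \int[mu]_(y in `[0, +oo[) (expR (- (e * y)) * cos (k * y)) = pois e k.
Proof.
move=> e0.
have D0 : e ^+ 2 + k ^+ 2 != 0 by rewrite gt_eqF// ltr_pwDl ?exprn_gt0 ?sqr_ge0.
pose F y := (e ^+ 2 + k ^+ 2)^-1 * (expR (- (e * y)) * (k * sin (k * y) - e * cos (k * y))).
have cE : continuous (fun y => expR (- (e * y)) : R).
  move=> z; apply: (@continuous_comp _ _ _ (fun y => - (e * y)) expR).
    by apply: cvgN; apply: cvgMl_tmp; exact: cvg_id.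
  exact: continuous_expR.
have cC : continuous (fun y => cos (k * y) : R).
  move=> z; apply: (@continuous_comp _ _ _ (fun y => k * y) cos).
    by apply: cvgMl_tmp; exact: cvg_id.
  exact: continuous_cos.
have cf : continuous (fun y => expR (- (e * y)) * cos (k * y) : R).
  by move=> z; apply: cvgM; [exact: cE|exact: cC].
have bd y : 0 <= y -> `|expR (- (e * y)) * cos (k * y)| <= 2 / e * pois e^-1 y.
  move=> y0; rewrite normrM ger0_norm ?expR_ge0//.
  apply: (le_trans _ (expR_le_pois e0 y0)).
  by rewrite ler_piMr ?expR_ge0 ?cos_max.
have e20 : 0 <= 2 / e by rewrite divr_ge0// ltW.
have ei0 : 0 < e^-1 by rewrite invr_gt0.
have [fi _] := halfline_pois_bound cf ei0 e20 bd.
have dF y : is_derive y (1 : R) F (expR (- (e * y)) * cos (k * y)).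
  have d1 : is_derive y (1 : R) (fun y => expR (- (e * y))) (- e * expR (- (e * y))).
    by apply: is_derive_eq; rewrite /GRing.scale/=; ring.
  have d2 : is_derive y (1 : R) (fun y => k * sin (k * y) - e * cos (k * y))
     (k * (cos (k * y) * k) + e * (sin (k * y) * k)).
    by apply: is_derive_eq; rewrite /GRing.scale/=; ring.
  rewrite /F; apply: is_derive_eq; rewrite /GRing.scale/=; field.
  exact: D0.
have tail : F n%:R @[n --> \oo] --> 0.
  apply: (@cvg_osc_seq _ _ ((e ^+ 2 + k ^+ 2)^-1 * ((`|k| + e) * (2 / e))) e^-1) => //.
    rewrite mulr_ge0// ?mulr_ge0 ?addr_ge0 ?(ltW e0)// invr_ge0 ?addr_ge0 ?sqr_ge0//.
    exact: ltW.
  move=> y y0; rewrite /F !normrM ger0_norm; last by rewrite invr_ge0 addr_ge0// sqr_ge0.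
  rewrite -!mulrA ler_wpM2l ?invr_ge0 ?addr_ge0 ?sqr_ge0//.
  rewrite (ger0_norm (expR_ge0 _)) mulrC; apply: ler_pM; rewrite ?expR_ge0//.
    apply: (le_trans (ler_normB _ _)); rewrite !normrM (gtr0_norm e0).
    apply: lerD; first by rewrite ler_piMr// sin_max.
    by rewrite ler_piMr ?cos_max// ltW.
  by rewrite mulrA; exact: expR_le_pois.
have /= -> := Rintegral_halfline fi cf dF tail.
by rewrite /F !mulr0 oppr0 expR0 sin0 cos0 /pois; field.
Qed.

Lemma laplace_cos_line e c k : 0 < e ->
  \int[mu]_y (expR (- (e * `|y|)) * cos (c + k * y)) = 2 * cos c * pois e k.
Proof.
move=> e0.
have i1 := exp_cos_integrable c k e0.
have i0 := exp_cos_integrable 0 k e0.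
have E1 : \int[mu]_y (expR (- (e * `|y|)) * cos (c + k * y)) =
          \int[mu]_y (expR (- (e * `|y|)) * cos (c - k * y)).
  rewrite -(Rintegral_opp (measurable_integrable i1)).
  by apply: eq_Rintegral => y _; rewrite normrN mulrN.
have i2 := exp_cos_integrable c (- k) e0.
have E2 : \int[mu]_y (expR (- (e * `|y|)) * cos (c + k * y)) +
          \int[mu]_y (expR (- (e * `|y|)) * cos (c - k * y)) =
   2 * cos c * \int[mu]_y (expR (- (e * `|y|)) * cos (0 + k * y)).
  rewrite -RintegralZl// -RintegralD//.
    by apply: eq_Rintegral => y _; rewrite add0r cosD cosB; ring.
  by apply: eq_integrable i2 => // y _ /=; rewrite mulNr.
have E3 : \int[mu]_y (expR (- (e * `|y|)) * cos (0 + k * y)) = 2 * pois e k.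
  rewrite -(laplace_cos k e0) /Rintegral integral_even//; last first.
    by move=> y; rewrite normrN !add0r mulrN cosN.
  rewrite fineM//; last by apply: integrable_fin_num => //; apply: integrableS i0.
  congr (_ * fine _); apply: eq_integral => y; rewrite inE/= in_itv/= andbT => y0.
  by rewrite add0r ger0_norm.
by move: E2; rewrite -E1 E3; lra.
Qed.

(** After rescaling to unit scale, this is dominated convergence. *)
Lemma pois_approx_id (h : R -> R) (B x : R) : continuous h -> (forall z, `|h z| <= B) ->
  \int[mu]_z (h z * pois n.+1%:R^-1 (z - x)) @[n --> \oo] --> pi * h x.
Proof.
move=> ch hB.
have mh : measurable_fun setT h by exact: continuous_measurable_fun.
have B0 : 0 <= B by exact: le_trans (normr_ge0 _) (hB 0).
have E n : \int[mu]_z (h z * pois n.+1%:R^-1 (z - x)) =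
    \int[mu]_z (h (x + n.+1%:R^-1 * z) * pois 1 z).
  set e := n.+1%:R^-1; have e0 : 0 < e by rewrite invr_gt0.
  rewrite -(Rintegral_shift x); last first.
    by apply: measurable_funM => //; apply: measurable_pois => //; exact: measurable_funB.
  have fi : mu.-integrable setT (EFin \o (fun z => h (z + x) * pois e (z + x - x))).
    apply: (@le_integrable_R _ _ _ mu setT _ (fun z => B * pois e z)) => //.
    - apply: measurable_funM; last by apply: measurable_pois => //; apply: measurable_funB => //; exact: measurable_funD.
      by apply: measurableT_comp => //; exact: measurable_funD.
    - move=> z _; rewrite addrK normrM (ger0_norm (pois_ge0 _ (ltW e0))).
      by rewrite ler_wpM2r ?pois_ge0// ltW.
    - by apply: integrable_RZ => //; exact: integrable_pois.
  have [fi' <-] := Rintegral_scale e0 fi.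
  rewrite -RintegralZl//; apply: eq_Rintegral => z _.
  rewrite addrK (addrC x) /pois exprMn expr1n.
  have : 0 < 1 + z ^+ 2 by rewrite ltr_pwDl ?sqr_ge0.
  have : 0 < e ^+ 2 + e ^+ 2 * z ^+ 2 by rewrite ltr_pwDl ?exprn_gt0// mulr_ge0// sqr_ge0.
  by move=> /gt_eqF z2 /gt_eqF z1; field; rewrite z1 exprMn z2.
under eq_fun do rewrite E.
have -> : pi * h x = \int[mu]_z (h x * pois 1 z).
  rewrite RintegralZl//; last exact: integrable_pois.
  by rewrite /Rintegral integral_pois1 mulrC.
apply: (@Rdominated_cvg _ _ _ mu _ _ (fun z => B * pois 1 z)).
- move=> n; apply: measurable_funM; last exact: measurable_pois.
  by apply: measurableT_comp => //; apply: measurable_funD => //; exact: measurable_funM.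
- by apply: measurable_funM => //; exact: measurable_pois.
- move=> z; apply: cvgMr_tmp.
  have lim : (fun n => x + harmonic n * z) @ \oo --> x.
    rewrite -[X in _ --> X]addr0; apply: cvgD; first exact: cvg_cst.
    by rewrite -[X in _ --> X](mul0r z); apply: cvgMr_tmp; exact: cvg_harmonic.
  by apply: (cvg_comp _ _ lim); exact: ch.
- by apply: integrable_RZ => //; exact: integrable_pois.
- move=> n z; rewrite normrM (ger0_norm (pois_ge0 _ ler01)).
  by rewrite ler_wpM2r ?pois_ge0.
Qed.

Lemma measurable_Kernel t : 0 < t -> measurable_fun setT (K t).
Proof.
move=> t0; apply: continuous_measurable_fun => x.
apply: differentiable_continuous; apply/derivable1_diffP.
by case: (is_derive_Kernel heta x t0).
Qed.

Lemma damp_norm_bounded t : 0 < t -> exists B : R, forall xi, damp t `|xi| <= B.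
Proof.
move=> t0; exists (expR (eta * t)) => xi.
apply: (le_trans (damp_le heta t0 (lexx t) (normr_ge0 xi))).
rewrite ler_piMr ?expR_ge0// -[leRHS]expR0 ler_expR oppr_le0 mulr_ge0 ?divr_ge0 ?(ltW heta)//.
by rewrite exprn_ge0// mulr_ge0// cbrt_ge0.
Qed.

Lemma Kernel_integrable t : 0 < t -> mu.-integrable setT (EFin \o K t).
Proof.
move=> t0; have [c c0 h] := @kernel_decay0 R eta heta t t0.
apply: (@le_integrable_R _ _ _ mu setT _ (fun x => pi^-1 * c * pois (cbrt t) x)) => //.
- exact: measurable_Kernel.
- move=> x _; rewrite Kernel_Ac// normrM ger0_norm ?invr_ge0 ?pi_ge0//.
  by rewrite -mulrA ler_wpM2l ?invr_ge0 ?pi_ge0// h.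
- by apply: integrable_RZ => //; apply: integrable_pois; exact: cbrt_gt0.
Qed.

Lemma exp_norm_integrable e : 0 < e -> mu.-integrable setT (EFin \o (fun y => expR (- (e * `|y|)))).
Proof.
move=> e0; have := exp_cos_integrable 0 0 e0; apply: eq_integrable => // y _ /=.
by rewrite mul0r addr0 cos0 mulr1.
Qed.

Lemma pois_le_inv e z : 0 < e -> pois e z <= e^-1.
Proof.
move=> e0; rewrite /pois ler_pdivrMr ?ltr_pwDl ?exprn_gt0 ?sqr_ge0//.
by rewrite ler_pdivlMl// -expr2 lerDl sqr_ge0.
Qed.

(** The symbol, with phase shifted by [a], smoothed by the Poisson kernel of scale [e]: this is
    what the factor [exp (- e |y|)] does on the side of the kernel. *)
Definition reg_symbol t a xi e z := damp t `|z| * cos (a + z ^+ 3 * t) * pois e (z - xi).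

Lemma reg_symbol_integrable t a xi e : 0 < t -> 0 < e ->
  mu.-integrable setT (EFin \o reg_symbol t a xi e) /\
  mu.-integrable setT (EFin \o (fun z => reg_symbol t a xi e (- z))).
Proof.
move=> t0 e0.
have mH : measurable_fun setT (reg_symbol t a xi e).
  apply: measurable_funM; last by apply: measurable_pois => //; exact: measurable_funB.
  apply: measurable_funM; first exact: measurable_damp.
  by apply: measurable_cos; apply: measurable_funD => //; apply: measurable_funM.
have Hi : mu.-integrable setT (EFin \o reg_symbol t a xi e).
  apply: (@le_integrable_R _ _ _ mu setT _ (fun z => e^-1 * damp t `|z|)) => //.
    move=> z _; rewrite /reg_symbol normrM (ger0_norm (pois_ge0 _ (ltW e0))) normrM.
    rewrite (ger0_norm (damp_ge0 _ _ _)) mulrC.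
    apply: ler_pM; rewrite ?pois_ge0 ?(ltW e0) ?mulr_ge0 ?damp_ge0 ?pois_le_inv//.
    by rewrite ler_piMr ?damp_ge0 ?cos_max.
  by apply: integrable_RZ => //; exact: (damp_integrable heta t0).
split=> //; have := integrable_subl 0 Hi; apply: eq_integrable => // z _ /=.
by rewrite sub0r.
Qed.

Lemma reg_symbol_laplace t a xi e z : 0 < e ->
  \int[mu]_y ((2 * pi)^-1 *
    (cos (a - y * xi) * expR (- (e * `|y|)) * fourier_integrand eta t y z)) =
  (2 * pi)^-1 * reg_symbol t a xi e z + (2 * pi)^-1 * reg_symbol t a xi e (- z).
Proof.
move=> e0; have p0 : pi != 0 :> R by rewrite gt_eqF ?pi_gt0.
have i1 := exp_cos_integrable (a + z ^+ 3 * t) (z - xi) e0.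
have i2 := exp_cos_integrable (a - z ^+ 3 * t) (- (xi + z)) e0.
pose q := (2 * pi)^-1 * damp t `|z| * 2^-1.
have E y : (2 * pi)^-1 * (cos (a - y * xi) * expR (- (e * `|y|)) * fourier_integrand eta t y z) =
  q * (expR (- (e * `|y|)) * cos (a + z ^+ 3 * t + (z - xi) * y))
  + q * (expR (- (e * `|y|)) * cos (a - z ^+ 3 * t + (- (xi + z)) * y)).
  rewrite /q /fourier_integrand.
  have -> : a + z ^+ 3 * t + (z - xi) * y = (a - y * xi) + (y * z + z ^+ 3 * t) by ring.
  have -> : a - z ^+ 3 * t + (- (xi + z)) * y = (a - y * xi) - (y * z + z ^+ 3 * t) by ring.
  move: (a - y * xi) (y * z + z ^+ 3 * t) => A B.
  rewrite cosD cosB; move: (2 * pi)^-1 => P.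
  by field.
under eq_Rintegral do rewrite E.
have j1 := integrable_RZ q measurableT i1; have j2 := integrable_RZ q measurableT i2.
rewrite (RintegralD measurableT j1 j2) (RintegralZl _ measurableT i1) (RintegralZl _ measurableT i2).
rewrite !laplace_cos_line// /reg_symbol normrN.
have -> : (- z) ^+ 3 * t = - (z ^+ 3 * t) by ring.
have -> : - z - xi = - (xi + z) by ring.
rewrite /q; move: (2 * pi)^-1 => P.
by field.
Qed.

Lemma reg_fubini t a xi e : 0 < t -> 0 < e ->
  \int[mu]_y (\int[mu]_z ((2 * pi)^-1 *
    (cos (a - y * xi) * expR (- (e * `|y|)) * fourier_integrand eta t y z))) =
  \int[mu]_z (\int[mu]_y ((2 * pi)^-1 *
    (cos (a - y * xi) * expR (- (e * `|y|)) * fourier_integrand eta t y z))).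
Proof.
move=> t0 e0.
pose F (w : R * R) := (2 * pi)^-1 *
  (cos (a - w.1 * xi) * expR (- (e * `|w.1|)) * fourier_integrand eta t w.1 w.2).
have pi2 : 0 <= (2 * pi)^-1 :> R by rewrite invr_ge0 mulr_ge0// pi_ge0.
have mF : measurable_fun setT (F : plane R -> R).
  apply: measurable_funM => //; apply: measurable_funM; first apply: measurable_funM.
  - apply: measurable_cos; apply: measurable_funB => //; exact: measurable_funM.
  - apply: (measurableT_comp (@measurable_expR R)); apply: measurable_funN.
    by apply: measurable_funM => //; exact: measurableT_comp.
  - apply: measurable_funM; first by apply: measurable_damp => //; exact: measurableT_comp.
    by apply: measurable_cos; exact: measurable_phase.
apply: (@Rfubini _ _ _ _ R mu mu F).
apply: (@integrable_prod_le _ _ _ _ R mu mu F (fun y => expR (- (e * `|y|)))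
   (fun z => (2 * pi)^-1 * damp t `|z|) mF).
- by move=> y; exact: expR_ge0.
- by move=> z; rewrite mulr_ge0// damp_ge0.
- exact: (exp_norm_integrable e0).
- by apply: integrable_RZ => //; exact: (damp_integrable heta t0).
- move=> y z; rewrite /F /= !normrM (ger0_norm pi2) (ger0_norm (expR_ge0 _)) (ger0_norm (damp_ge0 _ _ _)).
  rewrite [leRHS]mulrCA ler_wpM2l//.
  rewrite -[leRHS]mul1r -!mulrA; apply: ler_pM => //; first by rewrite mulr_ge0 ?expR_ge0 ?mulr_ge0 ?damp_ge0.
    exact: cos_max.
  by rewrite ler_wpM2l ?expR_ge0// ler_piMr ?damp_ge0 ?cos_max.
Qed.

Lemma regularized_inversion t a xi e : 0 < t -> 0 < e ->
  \int[mu]_y (cos (a - y * xi) * K t y * expR (- (e * `|y|))) =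
  pi^-1 * \int[mu]_z reg_symbol t a xi e z.
Proof.
move=> t0 e0; have p0 : pi != 0 :> R by rewrite gt_eqF ?pi_gt0.
transitivity (\int[mu]_y (\int[mu]_z ((2 * pi)^-1 *
    (cos (a - y * xi) * expR (- (e * `|y|)) * fourier_integrand eta t y z)))).
  apply: eq_Rintegral => y _; rewrite Kernel_fourier.
  have fi := fourier_integrable heta y t0.
  under [RHS]eq_Rintegral do rewrite mulrA.
  by rewrite (RintegralZl _ measurableT fi); ring.
rewrite reg_fubini//; under eq_Rintegral do rewrite reg_symbol_laplace//.
have [Hi HNi] := reg_symbol_integrable a xi t0 e0.
have j1 := integrable_RZ (2 * pi)^-1 measurableT Hi; have j2 := integrable_RZ (2 * pi)^-1 measurableT HNi.
rewrite (RintegralD measurableT j1 j2) (RintegralZl _ measurableT Hi) (RintegralZl _ measurableT HNi).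
rewrite (Rintegral_opp (measurable_integrable Hi)).
rewrite invfM; move: pi^-1 => P.
by field.
Qed.

(** Fourier inversion for the kernel.  The free phase [a] encodes both the real and the
    imaginary part.  The integral is regularized by [exp (- e |y|)], which makes Fubini's
    theorem available and smooths the symbol by a Poisson kernel; then [e] tends to [0]. *)
Lemma fourier_Kernel t a xi : 0 < t ->
  \int[mu]_y (cos (a - y * xi) * K t y) = damp t `|xi| * cos (a + xi ^+ 3 * t).
Proof.
move=> t0.
have mK := measurable_Kernel t0.
have mc : measurable_fun setT (fun y => cos (a - y * xi) : R).
  by apply: measurable_cos; apply: measurable_funB => //; exact: measurable_funM.
have lim1 : \int[mu]_y (cos (a - y * xi) * K t y * expR (- (harmonic n * `|y|))) @[n --> \oo] -->
    \int[mu]_y (cos (a - y * xi) * K t y).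
  apply: (@Rdominated_cvg _ _ _ mu _ _ (fun y => `|K t y|)).
  - move=> n; apply: measurable_funM; first exact: measurable_funM.
    apply: (measurableT_comp (@measurable_expR R)); apply: measurable_funN.
    by apply: measurable_funM => //; exact: measurableT_comp.
  - exact: measurable_funM.
  - move=> y; rewrite -[X in _ --> X]mulr1; apply: cvgMl_tmp.
    have l : (fun n => - (harmonic n * `|y|)) @ \oo --> (0 : R).
      rewrite -oppr0; apply: cvgN; rewrite -[X in _ --> X](mul0r `|y|).
      by apply: cvgMr_tmp; exact: cvg_harmonic.
    by rewrite -expR0; apply: (cvg_comp _ _ l); exact: continuous_expR.
  - exact: integrable_norm (Kernel_integrable t0).
  - move=> n y; rewrite !normrM (ger0_norm (expR_ge0 _)).
    rewrite -[leRHS]mulr1; apply: ler_pM; rewrite ?mulr_ge0 ?expR_ge0//.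
      by rewrite ler_piMl ?cos_max.
    by rewrite -expR0 ler_expR oppr_le0 mulr_ge0// ltW// harmonic_gt0.
have lim2 : \int[mu]_y (cos (a - y * xi) * K t y * expR (- (harmonic n * `|y|))) @[n --> \oo] -->
    damp t `|xi| * cos (a + xi ^+ 3 * t).
  have h0 n : 0 < harmonic n :> R by exact: harmonic_gt0.
  under eq_fun do rewrite regularized_inversion//.
  have [B hB] := damp_norm_bounded t0.
  have -> : damp t `|xi| * cos (a + xi ^+ 3 * t) = pi^-1 * (pi * (damp t `|xi| * cos (a + xi ^+ 3 * t))).
    by rewrite mulKf// gt_eqF// pi_gt0.
  apply: cvgMl_tmp.
  apply: (@pois_approx_id (fun z => damp t `|z| * cos (a + z ^+ 3 * t)) B xi).
    move=> z; apply: cvgM.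
      apply: (@continuous_comp _ _ _ (fun xi => `|xi|) (damp t)); first exact: norm_continuous.
      exact: continuous_damp.
    apply: (@continuous_comp _ _ _ (fun xi => a + xi ^+ 3 * t) cos); last exact: continuous_cos.
    apply: cvgD; first exact: cvg_cst.
    by apply: cvgMr_tmp; exact: exprn_continuous.
  move=> z; rewrite normrM (ger0_norm (damp_ge0 _ _ _)) (le_trans _ (hB z))//.
  by rewrite ler_piMr ?damp_ge0 ?cos_max.
exact: cvg_unique lim1 lim2.
Qed.

Lemma semigroup_fubini s t x : 0 < s -> 0 < t ->
  \int[mu]_y (\int[mu]_z ((2 * pi)^-1 * (fourier_integrand eta s (x - y) z * K t y))) =
  \int[mu]_z (\int[mu]_y ((2 * pi)^-1 * (fourier_integrand eta s (x - y) z * K t y))).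
Proof.
move=> s0 t0.
pose F (w : R * R) := (2 * pi)^-1 * (fourier_integrand eta s (x - w.1) w.2 * K t w.1).
have pi2 : 0 <= (2 * pi)^-1 :> R by rewrite invr_ge0 mulr_ge0// pi_ge0.
have mK := measurable_Kernel t0.
have mF : measurable_fun setT (F : plane R -> R).
  apply: measurable_funM => //; apply: measurable_funM.
    apply: measurable_funM; first by apply: measurable_damp => //; exact: measurableT_comp.
    by apply: measurable_cos; apply: measurable_phase => //; exact: measurable_funB.
  by apply: (measurableT_comp mK).
apply: (@Rfubini _ _ _ _ R mu mu F).
apply: (@integrable_prod_le _ _ _ _ R mu mu F (fun y => `|K t y|)
   (fun z => (2 * pi)^-1 * damp s `|z|) mF) => //.
- by move=> z; rewrite mulr_ge0// damp_ge0.
- exact: integrable_norm (Kernel_integrable t0).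
- by apply: integrable_RZ => //; exact: (damp_integrable heta s0).
- move=> y z; rewrite /F /= !normrM (ger0_norm pi2) (ger0_norm (damp_ge0 _ _ _)).
  rewrite [leRHS]mulrCA ler_wpM2l// [leRHS]mulrC ler_wpM2r// ler_piMr ?damp_ge0 ?cos_max//.
Qed.

Lemma cos_Kernel_integrable t a xi : 0 < t ->
  mu.-integrable setT (EFin \o (fun y => cos (a - y * xi) * K t y)).
Proof.
move=> t0; have mK := measurable_Kernel t0.
apply: (@le_integrable_R _ _ _ mu setT _ (fun y => `|K t y|) measurableT).
- apply: measurable_funM => //; apply: measurable_cos; apply: measurable_funB => //.
  exact: measurable_funM.
- by move=> y _; rewrite normrM ler_piMl ?cos_max.
- exact: integrable_norm (Kernel_integrable t0).
Qed.

(** The symbols at times [s] and [t] multiply to the symbol at time [s + t]. *)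
Lemma Kernel_semigroup s t x : 0 < s -> 0 < t ->
  \int[mu]_y (K s (x - y) * K t y) = K (s + t) x.
Proof.
move=> s0 t0.
transitivity (\int[mu]_y (\int[mu]_z ((2 * pi)^-1 * (fourier_integrand eta s (x - y) z * K t y)))).
  apply: eq_Rintegral => y _; rewrite [in LHS](Kernel_fourier eta s).
  have fi := fourier_integrable heta (x - y) s0.
  under [RHS]eq_Rintegral do rewrite (mulrC _ (K t y)) mulrA.
  by rewrite (RintegralZl _ measurableT fi); ring.
have fst := fourier_integrable heta x (addr_gt0 s0 t0).
rewrite semigroup_fubini// (Kernel_fourier _ (s + t)) -(RintegralZl _ measurableT fst).
apply: eq_Rintegral => z _.
have ci := cos_Kernel_integrable (x * z + z ^+ 3 * s) z t0.
have -> : \int[mu]_y ((2 * pi)^-1 * (fourier_integrand eta s (x - y) z * K t y)) =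
    (2 * pi)^-1 * damp s `|z| * \int[mu]_y (cos (x * z + z ^+ 3 * s - y * z) * K t y).
  rewrite -(RintegralZl _ measurableT ci); apply: eq_Rintegral => y _.
  rewrite /fourier_integrand.
  have -> : (x - y) * z + z ^+ 3 * s = x * z + z ^+ 3 * s - y * z by ring.
  by ring.
rewrite (fourier_Kernel _ _ t0) /fourier_integrand.
have -> : damp (s + t) `|z| = damp s `|z| * damp t `|z|.
  by rewrite /damp -expRD; congr expR; ring.
have -> : x * z + z ^+ 3 * (s + t) = x * z + z ^+ 3 * s + z ^+ 3 * t by ring.
by ring.
Qed.

Lemma Kernel_bounded t : 0 < t -> exists B : R, forall x, `|K t x| <= B.
Proof.
move=> t0; have [c c0 h] := @osc_bound R eta heta t 0 t0.
exists (pi^-1 * (c / cbrt t ^+ 1)) => x; have [h1 _] := h t x t0 (lexx t).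
rewrite Kernel_Ac// normrM ger0_norm ?invr_ge0 ?pi_ge0//.
by rewrite ler_wpM2l ?invr_ge0 ?pi_ge0// ler_pdivlMr ?exprn_gt0 ?cbrt_gt0.
Qed.

Lemma dxKernel_bounded t : 0 < t -> exists B : R, forall x, `|G t x| <= B.
Proof.
move=> t0; have [c c0 h] := @osc_bound R eta heta t 1 t0.
exists (pi^-1 * (c / cbrt t ^+ 2)) => x; have [_ h1] := h t x t0 (lexx t).
rewrite dxKernel_As// normrN normrM ger0_norm ?invr_ge0 ?pi_ge0//.
by rewrite ler_wpM2l ?invr_ge0 ?pi_ge0// ler_pdivlMr ?exprn_gt0 ?cbrt_gt0.
Qed.

Lemma measurable_dxKernel t : 0 < t -> measurable_fun setT (G t).
Proof.
move=> t0; rewrite (_ : G t = fun x => - (pi^-1 * As eta 1 t x)); last first.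
  by apply/funext => x; rewrite dxKernel_As.
apply: measurable_funN; apply: measurable_funM => //.
exact: (measurableT_comp (measurable_As eta 1) (@pair1_measurable _ _ R R t)).
Qed.

(** Differentiating the semigroup law under the integral, after a change of variables that
    moves [x] to the factor to be differentiated. *)
Lemma dxKernel_semigroup s t x : 0 < s -> 0 < t ->
  \int[mu]_y (K s (x - y) * G t y) = G (s + t) x.
Proof.
move=> s0 t0.
have mK := measurable_Kernel s0; have mKt := measurable_Kernel t0; have mG := measurable_dxKernel t0.
have [B hB] := dxKernel_bounded t0.
have [B' hB'] := Kernel_bounded t0.
have B0 : 0 <= B by exact: le_trans (normr_ge0 _) (hB 0).
have Ix : `]x - 1, x + 1[%classic x by rewrite /= in_itv/= ltrBlDr ltrDl ltr01.
pose f z y := K s y * K t (z - y).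
have der z y : is_derive z (1 : R) (f ^~ y) (K s y * G t (z - y)).
  have h := is_derive_Kernel' heta (z - y) t0.
  have h2 : is_derive z (1 : R) (fun z => K t (z - y)) (G t (z - y)).
    by apply: is_derive_eq; rewrite /GRing.scale/=; ring.
  by rewrite /f; apply: is_derive_eq; rewrite /GRing.scale/=; ring.
have mT : measurable ([set: measurableTypeR R]) by [].
have it z : `]x - 1, x + 1[%classic z -> mu.-integrable setT (EFin \o f z).
  move=> _; apply: (@le_integrable_R _ _ _ mu setT _ (fun y => B' * `|K s y|)) => //.
  - have mz : measurable_fun setT (fun y => z - y) by exact: measurable_funB.
    exact: (measurable_funM mK (measurableT_comp mKt mz)).
  - by move=> y _; rewrite normrM mulrC ler_wpM2r.
  - by apply: integrable_RZ => //; exact: integrable_norm (Kernel_integrable s0).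
have dble z y : `]x - 1, x + 1[%classic z -> [set: measurableTypeR R] y -> derivable (f ^~ y) z 1.
  by move=> _ _; case: (der z y).
have dx z y : partial1of2 f z y = K s y * G t (z - y).
  by rewrite partial1of2E; case: (der z y).
have bd z y : `]x - 1, x + 1[%classic z -> [set: measurableTypeR R] y ->
    `|partial1of2 f z y| <= B * `|K s y|.
  by move=> _ _; rewrite dx normrM mulrC ler_wpM2r.
have gi : mu.-integrable setT (EFin \o (fun y => B * `|K s y|)).
  by apply: integrable_RZ => //; exact: integrable_norm (Kernel_integrable s0).
have g0 y : 0 <= B * `|K s y| by rewrite mulr_ge0.
have -> : G (s + t) x = derive1 (K (s + t)) x by [].
have := differentiation_under_integral mT Ix it dble g0 gi bd.
have -> : (fun x' => \int[mu]_y f x' y) = K (s + t).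
  apply/funext => z; rewrite -(Kernel_semigroup z s0 t0).
  have mz : measurable_fun setT (fun y => K s (z - y) * K t y).
    have my : measurable_fun setT (fun y => z - y) by exact: measurable_funB.
    exact: (measurable_funM (measurableT_comp mK my) mKt).
  rewrite -(Rintegral_subl z mz).
  by apply: eq_Rintegral => y _; rewrite /f subKr.
move=> ->.
under [RHS]eq_Rintegral do rewrite dx.
have mx : measurable_fun setT (fun y => K s y * G t (x - y)).
  have mxy : measurable_fun setT (fun y => x - y) by exact: measurable_funB.
  apply: measurable_funM; first exact: mK.
  exact: (measurableT_comp mG mxy).
rewrite -[RHS](Rintegral_subl x mx).
by apply: eq_Rintegral => y _; rewrite subKr.
Qed.

End fourier_inversion.

(** * The singularity in time *)

Section time_singularity.
Context (R : realType).
Local Notation mu := (@lebesgue_measure R).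
Implicit Types (s t T l e : R).

(** [t ^ (-2/3)] cut off to [ ]0, T[]: the order of magnitude of the mass in space of the
    kernel [vker] defined below. *)
Definition sing T s : R := \1_(`]0%R, T[%classic) s * (cbrt s ^+ 2)^-1.

Lemma sing_ge0 T s : 0 <= sing T s.
Proof. by rewrite /sing mulr_ge0// invr_ge0 sqr_ge0. Qed.

Lemma singE T s : 0 < s -> s < T -> sing T s = (cbrt s ^+ 2)^-1.
Proof. by move=> s0 sT; rewrite /sing indicE mem_set ?mul1r//= in_itv/= s0. Qed.

Lemma sing_out T s : ~~ (0 < s < T) -> sing T s = 0.
Proof.
move=> h; rewrite /sing indicE memNset ?mul0r//= in_itv/=.
exact/negP.
Qed.

Lemma measurable_sing d (X : measurableType d) (D : set X) (f : X -> R) T :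
  measurable_fun D f -> measurable_fun D (fun u => sing T (f u)).
Proof.
move=> mf; apply: measurable_funM.
  by apply: (measurableT_comp _ mf); exact: measurable_indic.
by apply: measurable_fun_invr; apply: measurable_funX; exact: measurable_cbrt.
Qed.

Lemma is_derive_cbrt t : 0 < t ->
  is_derive t (1 : R) (fun t => 3 * cbrt t) ((cbrt t ^+ 2)^-1).
Proof.
move=> t0; have c0 := cbrt_gt0 t0.
have t_in : t \in `]0, +oo[ by rewrite in_itv/= andbT.
have d : derivable (fun t => cbrt t : R) t 1 by apply: (derivable_powR (x := 3^-1)).
have h := powR_derive1 3^-1 t_in; rewrite derive1E in h.
have hd : is_derive t (1 : R) (fun t => cbrt t : R) (3^-1 * t `^ (3^-1 - 1)).
  by split => //; exact: h.
have E : 3^-1 * t `^ (3^-1 - 1) = 3^-1 * (cbrt t ^+ 2)^-1.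
  congr (_ * _); rewrite -powR_mulrn ?cbrt_ge0// /cbrt -powRrM -powRN; congr (_ `^ _).
  by field.
rewrite E in hd; apply: is_derive_eq; rewrite /GRing.scale/=.
by rewrite mulrA divff ?mul1r.
Qed.

Lemma sing_integral_le T : 0 < T ->
  (\int[mu]_(s in `]0%R, T]) ((cbrt s ^+ 2)^-1)%:E <= (3 * cbrt T)%:E)%E.
Proof.
move=> T0.
pose F n := `[T / n.+2%:R, T]%classic : set R.
have nT n : 0 < T / n.+2%:R by rewrite divr_gt0.
have E : `]0%R, T]%classic = \bigcup_n F n.
  apply/seteqP; split=> x /=; rewrite in_itv/=.
    move=> /andP[x0 xT]; have [n _ hn] := near_infty_natSinv_lt (PosNum (divr_gt0 x0 T0)).
    exists n => //=; rewrite /F /= in_itv/= xT andbT.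
    have := hn n (leqnn n); rewrite /= ltr_pdivlMr// => /ltW h.
    apply: le_trans h; rewrite mulrC ler_wpM2r ?(ltW T0)//.
    by rewrite lef_pV2 ?posrE// ler_nat.
  move=> [n _]; rewrite /F /= in_itv/= => /andP[h ->]; rewrite andbT.
  exact: lt_le_trans h.
have mf : measurable_fun setT (fun s => ((cbrt s ^+ 2)^-1)%:E : \bar R).
  apply/measurable_EFinP; apply: measurable_fun_invr; apply: measurable_funX.
  exact: measurable_cbrt.
rewrite E.
have cvgF : (\int[mu]_(x in F n) ((cbrt x ^+ 2)^-1)%:E)%E @[n --> \oo] -->
    (\int[mu]_(x in \bigcup_n F n) ((cbrt x ^+ 2)^-1)%:E)%E.
  apply: ge0_nondecreasing_set_cvg_integral.
  - apply/nondecreasing_seqP => n; apply/subsetPset => x; rewrite /F /= !in_itv/=.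
    move=> /andP[h ->]; rewrite andbT; apply: le_trans h.
    by rewrite ler_wpM2l ?(ltW T0)// lef_pV2 ?posrE// ler_nat.
  - by move=> i; exact: measurable_itv.
  - by move=> i; apply: measurable_funTS; exact: mf.
  - by move=> i x _; rewrite lee_fin invr_ge0 sqr_ge0.
rewrite -(cvg_lim _ cvgF)//; apply: lime_le.
  by apply/cvg_ex; eexists; exact: cvgF.
apply: nearW => n; set a := T / n.+2%:R.
have aT : a < T by rewrite ltr_pdivrMr// ltr_pMr// ltr1n.
have a0 : 0 < a := nT n.
have cd z : 0 < z -> {for z, continuous (fun s => (cbrt s ^+ 2)^-1 : R)}.
  move=> z0; have c0 := cbrt_gt0 z0.
  have cc : {for z, continuous (fun s => cbrt s : R)}.
    apply: differentiable_continuous; apply/derivable1_diffP.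
    by apply: derivable_powR; rewrite in_itv/= andbT.
  apply: cvgV; first by rewrite gt_eqF// exprn_gt0.
  by under eq_fun do rewrite expr2; rewrite expr2; apply: cvgM.
have cF z : 0 < z -> {for z, continuous (fun s => 3 * cbrt s : R)}.
  move=> z0; apply: differentiable_continuous; apply/derivable1_diffP.
  by case: (is_derive_cbrt z0).
rewrite (@continuous_FTC2 _ _ (fun t => 3 * cbrt t))//; first last.
- move=> z; rewrite in_itv/= => /andP[az _]; rewrite derive1E.
  by case: (is_derive_cbrt (lt_trans a0 az)).
- split.
  + move=> z; rewrite in_itv/= => /andP[az _].
    by case: (is_derive_cbrt (lt_trans a0 az)).
  + by apply: cvg_at_right_filter; exact: cF.
  + by apply: cvg_at_left_filter; exact: cF.
- apply: continuous_in_subspaceT => z; rewrite inE/= in_itv/= => /andP[az _].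
  by apply: cd; exact: lt_le_trans az.
by rewrite -EFinB lee_fin gerBl mulr_ge0// cbrt_ge0.
Qed.

Lemma sing_integrable T : 0 < T -> mu.-integrable setT (EFin \o sing T).
Proof.
move=> T0; apply: integrableR_lty; first exact: measurable_sing.
apply: (@le_lt_trans _ _ (3 * cbrt T)%:E); last exact: ltry.
apply: le_trans (sing_integral_le T0); rewrite [leRHS]integral_mkcond/=.
apply: ge0_le_integral.
- by [].
- by move=> x _; rewrite lee_fin.
- by apply/measurable_EFinP; apply: measurableT_comp => //; exact: measurable_sing.
- apply/(measurable_restrictT _ _).1; first exact: measurable_itv.
  apply: measurable_funTS; apply/measurable_EFinP.
  apply: measurable_fun_invr; apply: measurable_funX; exact: measurable_cbrt.
- move=> x _; rewrite ger0_norm ?sing_ge0// /patch; case: ifPn => [|].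
    move=> _; rewrite /= lee_fin /sing; rewrite ler_piMl ?invr_ge0 ?sqr_ge0//.
  rewrite notin_setE/= in_itv/= => h; rewrite sing_out//.
  by apply/negP => /andP[x0 xT]; apply: h; rewrite x0 ltW.
Qed.

(** Dominated convergence, as [l] tends to infinity along the integers. *)
Lemma sing_laplace_small T e : 0 < T -> 0 < e -> exists2 l, 0 <= l &
  (\int[mu]_s (sing T s * expR (- (l * s)))%:E <= e%:E)%E.
Proof.
move=> T0 e0.
have si := sing_integrable T0; have ms := measurable_integrable si.
have mexp (l : R) : measurable_fun setT (fun s => expR (- (l * s)) : R).
  apply: (measurableT_comp (@measurable_expR R)); apply: measurable_funN.
  exact: measurable_funM.
have bd n s : `|sing T s * expR (- (n%:R * s))| <= sing T s.
  have [/andP[s0 _]|h] := boolP (0 < s < T); last by rewrite sing_out// mul0r normr0.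
  rewrite normrM (ger0_norm (sing_ge0 _ _)) ger0_norm ?expR_ge0//.
  by rewrite ler_piMr ?sing_ge0// -expR0 ler_expR oppr_le0 mulr_ge0// ltW.
have lim : \int[mu]_s (sing T s * expR (- (n%:R * s))) @[n --> \oo] --> \int[mu]_s (0 : R).
  apply: (@Rdominated_cvg _ _ _ mu _ _ (sing T)).
  - by move=> n; exact: (measurable_funM ms (mexp _)).
  - exact: measurable_cst.
  - move=> s; have [/andP[s0 _]|h] := boolP (0 < s < T); last first.
      rewrite sing_out//; under eq_fun do rewrite mul0r; exact: cvg_cst.
    rewrite -[X in _ --> X](mulr0 (sing T s)); apply: cvgMl_tmp.
    have h : (fun n : nat => expR (- s) ^+ n) @ \oo --> (0 : R).
      by apply: cvg_expr; rewrite ger0_norm ?expR_ge0// -expR0 ltr_expR oppr_lt0.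
    by under eq_fun do rewrite -mulrN expRM_natl.
  - exact: si.
  - exact: bd.
have E0 : \int[mu]_s (0 : R) = 0 by rewrite /Rintegral integral0.
rewrite E0 in lim.
have [n _ hn] := cvgr_lt _ lim _ e0.
exists n%:R => //; rewrite Rintegral_fineK//; last first.
  apply: (le_integrable_R measurableT _ _ si) => //.
  exact: (measurable_funM ms (mexp _)).
by rewrite lee_fin ltW//; exact: (hn n (leqnn n)).
Qed.

(** One of [s] and [t - s] is at least [t / 2], and the corresponding factor is then at most
    [4 t ^ (-2/3)]; the exponentials are arranged so that what remains has a small integral
    for large [l]. *)
Lemma sing_conv_le T l s t : 0 < t -> t < T -> 0 <= l ->
  sing T (t - s) * (sing T s * expR (l * s)) <=
  4 * (cbrt t ^+ 2)^-1 * expR (l * t) *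
   (sing T (t - s) * expR (- (l * (t - s))) + sing T s * expR (- (l * s))).
Proof.
move=> t0 tT l0.
have rhs0 : 0 <= 4 * (cbrt t ^+ 2)^-1 * expR (l * t) *
   (sing T (t - s) * expR (- (l * (t - s))) + sing T s * expR (- (l * s))).
  apply: mulr_ge0; last by rewrite addr_ge0// mulr_ge0 ?sing_ge0 ?expR_ge0.
  by rewrite mulr_ge0 ?expR_ge0// mulr_ge0// invr_ge0 sqr_ge0.
have [/andP[s0 sT]|h] := boolP (0 < s < T); last first.
  by rewrite [X in _ * (X * _)](sing_out h) mul0r mulr0.
have [/andP[u0 uT]|h] := boolP (0 < t - s < T); last first.
  by rewrite [X in X * _](sing_out h) mul0r.
have key z : 0 < z -> t <= 2 * z -> (cbrt z ^+ 2)^-1 <= 4 * (cbrt t ^+ 2)^-1.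
  move=> z0 tz; have cz := cbrt_gt0 z0; have ct := cbrt_gt0 t0.
  have h : cbrt t <= 2 * cbrt z.
    rewrite -(@ler_pXn2r _ 3) ?nnegrE ?mulr_ge0 ?ltW//.
    rewrite exprMn !cbrtK ?ltW//; have -> : 2 ^+ 3 = 8 :> R by ring.
    by lra.
  have -> : 4 * (cbrt t ^+ 2)^-1 = ((cbrt t / 2) ^+ 2)^-1 :> R.
    by field; rewrite gt_eqF.
  rewrite lef_pV2 ?posrE ?exprn_gt0 ?divr_gt0//.
  by rewrite ler_pXn2r ?nnegrE ?divr_ge0 ?(ltW ct) ?(ltW cz)// ler_pdivrMr// mulrC.
have E : expR (l * s) = expR (l * t) * expR (- (l * (t - s))).
  by rewrite -expRD; congr expR; ring.
have a0 : 0 <= expR (l * t) := expR_ge0 _.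
have b0 : 0 <= expR (- (l * (t - s))) := expR_ge0 _.
have c0 : 0 <= expR (- (l * s)) := expR_ge0 _.
have mono w z : 0 <= w -> w <= z -> expR (- (l * z)) <= expR (- (l * w)).
  by move=> w0 wz; rewrite ler_expR lerN2 ler_wpM2l.
have p1 : 0 <= (cbrt (t - s) ^+ 2)^-1 by rewrite invr_ge0 sqr_ge0.
have p2 : 0 <= (cbrt s ^+ 2)^-1 by rewrite invr_ge0 sqr_ge0.
have p3 : 0 <= (cbrt t ^+ 2)^-1 by rewrite invr_ge0 sqr_ge0.
rewrite !singE// E.
move: p1 p2 p3 b0 c0 a0 mono key.
have [c1|c1] := leP t (2 * s).
  move=> p1 p2 p3 b0 c0 a0 _ key; have := key s s0 c1.
  move: p1 p2 p3 b0 c0 a0.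
  move: ((cbrt (t - s) ^+ 2)^-1) ((cbrt s ^+ 2)^-1) ((cbrt t ^+ 2)^-1) => P Q Z.
  move: (expR (- (l * (t - s)))) (expR (- (l * s))) (expR (l * t)) => B C A P0 Q0 Z0 B0 C0 A0 h.
  rewrite (_ : P * (Q * (A * B)) = Q * (A * (P * B))); last by ring.
  apply: (@le_trans _ _ (4 * Z * (A * (P * B)))); first by rewrite ler_wpM2r ?mulr_ge0.
  by rewrite [leLHS]mulrA ler_wpM2l ?mulr_ge0// lerDl mulr_ge0.
move=> p1 p2 p3 b0 c0 a0 mono key.
have h1 : (cbrt (t - s) ^+ 2)^-1 <= 4 * (cbrt t ^+ 2)^-1 by apply: key => //; lra.
have h2 : expR (- (l * (t - s))) <= expR (- (l * s)) by apply: mono; lra.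
move: h1 h2 p1 p2 p3 b0 c0 a0.
move: ((cbrt (t - s) ^+ 2)^-1) ((cbrt s ^+ 2)^-1) ((cbrt t ^+ 2)^-1) => P Q Z.
move: (expR (- (l * (t - s)))) (expR (- (l * s))) (expR (l * t)) => B C A h1 h2 P0 Q0 Z0 B0 C0 A0.
apply: (@le_trans _ _ (4 * Z * (Q * (A * C)))).
  by apply: ler_pM; rewrite ?mulr_ge0// ler_wpM2l// ler_wpM2l.
by rewrite (mulrCA Q) [leLHS]mulrA ler_wpM2l ?mulr_ge0// lerDr mulr_ge0.
Qed.

End time_singularity.

(** * Estimates in Lebesgue spaces *)

Section real_tonelli.
Context d1 d2 (T1 : measurableType d1) (T2 : measurableType d2) (R : realType).
Variable m1 : {sigma_finite_measure set T1 -> \bar R}.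
Variable m2 : {sigma_finite_measure set T2 -> \bar R}.
Variable f : T1 * T2 -> R.
Hypothesis mf : measurable_fun setT f.
Hypothesis f0 : forall z, 0 <= f z.

Let mEf : measurable_fun setT (EFin \o f). Proof. exact/measurable_EFinP. Qed.

Let Ef0 z : (0 <= (EFin \o f) z)%E. Proof. by rewrite lee_fin. Qed.

Lemma measurable_tonelli : measurable_fun setT (fun x => \int[m2]_y (f (x, y))%:E)%E.
Proof. exact: (measurable_fun_fubini_tonelli_F (m2 := m2) _ mEf Ef0). Qed.

Lemma measurable_tonelli_r : measurable_fun setT (fun y => \int[m1]_x (f (x, y))%:E)%E.
Proof. exact: (measurable_fun_fubini_tonelli_G (m1 := m1) _ mEf Ef0). Qed.

Lemma tonelli_swap :
  (\int[m1]_x \int[m2]_y (f (x, y))%:E = \int[m2]_y \int[m1]_x (f (x, y))%:E)%E.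
Proof. exact: (fubini_tonelli (m1 := m1) (m2 := m2) _ mEf Ef0). Qed.

Lemma tonelli_l :
  (\int[m1 \x m2]_z (f z)%:E = \int[m1]_x \int[m2]_y (f (x, y))%:E)%E.
Proof. exact: (fubini_tonelli1 (m1 := m1) (m2 := m2) _ mEf Ef0). Qed.

Lemma tonelli_r :
  (\int[m1 \x m2]_z (f z)%:E = \int[m2]_y \int[m1]_x (f (x, y))%:E)%E.
Proof. by rewrite tonelli_l tonelli_swap. Qed.

End real_tonelli.

Section Lp_estimates.
Context (R : realType).
Local Notation mu := (@lebesgue_measure R).
Implicit Types (f g k : R -> R) (p : \bar R) (d B r : R).

Lemma ae_imp (P Q : R -> Prop) : (forall x, P x -> Q x) ->
  {ae mu, forall x, P x} -> {ae mu, forall x, Q x}.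
Proof. by move=> PQ; apply: (@filterS _ _ (ae_filter_ringOfSetsType mu)). Qed.

Lemma ae_and (P Q : R -> Prop) : {ae mu, forall x, P x} ->
  {ae mu, forall x, Q x} -> {ae mu, forall x, P x /\ Q x}.
Proof. exact: (@filterI _ _ (ae_filter_ringOfSetsType mu)). Qed.

Lemma lebesgue_measureT_gt0 : (0 < mu [set: R])%E.
Proof.
apply: (@lt_le_trans _ _ (mu `]0, 1[%classic)).
  by rewrite lebesgue_measure_itv/= lte_fin ltr01 oppr0 adde0 lte_fin.
apply: le_measure; rewrite ?inE//.
Qed.

Lemma Lnorm_le_integral r f d : 1 <= r -> 0 <= d ->
  ('N[mu]_r%:E[EFin \o f] <= d%:E)%E <-> (\int[mu]_x (`|f x| `^ r)%:E <= (d `^ r)%:E)%E.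
Proof.
move=> r1 d0; have r0 : 0 < r by exact: lt_le_trans r1.
have E : ('N[mu]_r%:E[EFin \o f] `^ r)%E = (\int[mu]_x (`|f x| `^ r)%:E)%E.
  by rewrite poweR_Lnorm ?gt_eqF//.
have N0 := Lnorm_ge0 mu r%:E (EFin \o f).
split=> h.
  by rewrite -E -poweR_EFin; apply: gt0_ler_poweR; rewrite ?(ltW r0)// in_itv/= ?leey ?andbT ?lee_fin//.
have : (('N[mu]_r%:E[EFin \o f] `^ r) `^ r^-1 <= (d%:E `^ r) `^ r^-1)%E.
  rewrite E; apply: gt0_ler_poweR; rewrite ?invr_ge0 ?(ltW r0)// ?in_itv/= ?leey ?andbT ?poweR_ge0 ?lee_fin ?powR_ge0//.
  by apply: integral_ge0 => x _; rewrite lee_fin powR_ge0.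
by rewrite -[X in (_ <= X)%E]poweRrM -poweRrM divff ?gt_eqF// !poweRe1// lee_fin.
Qed.

Lemma Lnorm_infty_le f d : ('N[mu]_+oo[EFin \o f] <= d%:E)%E <->
  {ae mu, forall x, `|f x| <= d}.
Proof.
rewrite unlock lebesgue_measureT_gt0; split.
  by move=> /ess_sup_inf.ess_supP; apply: filterS => x /=; rewrite lee_fin.
move=> h; apply/ess_sup_inf.ess_supP.
apply: (@filterS _ _ (ae_filter_ringOfSetsType mu) _ _ _ h) => x /=.
by rewrite lee_fin.
Qed.

Lemma le_1_powR (a r : R) : 0 <= a -> 1 <= r -> a <= 1 + a `^ r.
Proof.
move=> a0 r1; have [a1|a1] := leP a 1.
  by rewrite (le_trans a1)// lerDl powR_ge0.
by rewrite (le_trans (le1r_powR (ltW a1) r1))// lerDr.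
Qed.

(** A substitute for Hoelder's inequality that treats all exponents at once and needs only the
    mass and the supremum of [k]: it follows from [a <= 1 + a ^ p] with [a = |f| / d]. *)
Lemma Lnorm_pairing p f d k B : (1 <= p)%E -> measurable_fun setT f -> 0 < d ->
  ('N[mu]_p[EFin \o f] <= d%:E)%E -> measurable_fun setT k ->
  (forall x, 0 <= k x) -> (forall x, k x <= B) ->
  (\int[mu]_x (k x * `|f x|)%:E <= d%:E * (\int[mu]_x (k x)%:E + B%:E))%E.
Proof.
move=> p1 mf d0 Nf mk k0 kB.
have B0 : 0 <= B by exact: le_trans (k0 0) (kB 0).
have mn : measurable_fun setT (fun x => `|f x|) by exact: measurableT_comp.
have Ik : (0 <= \int[mu]_x (k x)%:E)%E by apply: integral_ge0 => x _; rewrite lee_fin.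
case: p p1 Nf => [r| |//]; last first.
  move=> _ /Lnorm_infty_le h.
  apply: (@le_trans _ _ (d%:E * \int[mu]_x (k x)%:E)%E); last first.
    by rewrite lee_wpmul2l ?lee_fin ?(ltW d0)// leeDl// lee_fin.
  rewrite -ge0_integralMl ?(ltW d0)//; apply: ae_ge0_le_integral => //.
  - by move=> x _; rewrite lee_fin mulr_ge0.
  - by apply/measurable_EFinP; exact: measurable_funM.
  - by move=> x _; rewrite lee_fin mulr_ge0// (ltW d0).
  - by apply/measurable_EFinP; exact: measurable_funM.
  - apply: ae_imp h => x fx _.
    by rewrite lee_fin mulrC ler_wpM2r.
rewrite lee_fin => r1 /(Lnorm_le_integral _ r1 (ltW d0)) h.
have r0 : 0 < r by exact: lt_le_trans r1.
have dr : 0 < d `^ r by rewrite powR_gt0.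
have mp : measurable_fun setT (fun x => `|f x| `^ r).
  by apply: (measurableT_comp (measurable_powR r)).
have p0 x : 0 <= `|f x| `^ r by exact: powR_ge0.
have c0 : 0 <= d * B / d `^ r by rewrite divr_ge0 ?mulr_ge0 ?(ltW d0) ?(ltW dr).
apply: (@le_trans _ _ (\int[mu]_x (d * k x + d * B / d `^ r * (`|f x| `^ r))%:E)%E).
  apply: le_ge0_integral.
  - by move=> x; rewrite mulr_ge0.
  - exact: measurable_funM.
  - by apply: measurable_funD; exact: measurable_funM.
  - move=> x; have a0 : 0 <= `|f x| / d by rewrite divr_ge0// ltW.
    have -> : d * B / d `^ r * `|f x| `^ r = d * B * (`|f x| / d) `^ r.
      have -> : (`|f x| / d) `^ r = `|f x| `^ r / d `^ r.
        rewrite powRM ?invr_ge0 ?(ltW d0)// -(powR_inv1 (ltW d0)) -powRrM mulN1r.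
        by rewrite powRN.
      by ring.
    have -> : k x * `|f x| = d * (k x * (`|f x| / d)) by field; rewrite gt_eqF.
    rewrite -mulrA -mulrDr ler_wpM2l ?(ltW d0)//.
    apply: (@le_trans _ _ (k x * (1 + (`|f x| / d) `^ r))); first by rewrite ler_wpM2l// le_1_powR.
    by rewrite mulrDr mulr1 lerD2l ler_wpM2r ?powR_ge0.
rewrite ge0_integralDr; first last.
- exact: measurable_funM.
- exact: measurable_funM.
- by move=> x; rewrite mulr_ge0.
- by move=> x; rewrite mulr_ge0// (ltW d0).
rewrite ge0_integralMl ?(ltW d0)// (ge0_integralMl mu c0 p0 mp).
have -> : (d%:E * (\int[mu]_x (k x)%:E + B%:E) = d%:E * \int[mu]_x (k x)%:E + (d * B)%:E)%E.
  by rewrite ge0_muleDr ?lee_fin.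
apply: leeD; first exact: lexx.
apply: (@le_trans _ _ ((d * B / d `^ r)%:E * (d `^ r)%:E)%E).
  by rewrite lee_wpmul2l ?lee_fin.
by rewrite -!EFinM lee_fin divfK// gt_eqF.
Qed.

(** The convex function [a ^ r] lies above its tangent at [b]: an instance of Young's inequality. *)
Lemma powR_tangent (a b r : R) : 0 <= a -> 0 <= b -> 1 <= r ->
  r * a * b `^ (r - 1) <= a `^ r + (r - 1) * b `^ r.
Proof.
move=> a0 b0; rewrite le_eqVlt => /predU1P[<-|r1].
  by rewrite subrr powRr0 powRr1// mul0r addr0 mul1r mulr1.
have r0 : 0 < r by exact: lt_trans r1.
have s0 : 0 < r - 1 by rewrite subr_gt0.
have := @conjugate_powR _ a (b `^ (r - 1)) r (r / (r - 1)) a0 (powR_ge0 _ _) r0.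
rewrite divr_gt0// => /(_ isT); have -> : r^-1 + (r / (r - 1))^-1 = 1.
  by field; rewrite !gt_eqF.
move=> /(_ erefl); rewrite -powRrM (_ : (r - 1) * (r / (r - 1)) = r); last by field; rewrite gt_eqF.
move=> h; rewrite -mulrA; apply: (le_trans (ler_wpM2l (ltW r0) h)).
rewrite le_eqVlt; apply/orP; left; apply/eqP; field.
by rewrite !gt_eqF.
Qed.

(** Jensen's inequality for the probability density [pois r / pi], by integrating
    [powR_tangent] at the mean value; Tonelli's theorem then gives the [L^p] bound. *)
Lemma pois_average_Lnorm p f d r (U g : R -> R) (A : R) : (1 <= p)%E ->
  measurable_fun setT f -> 0 < d -> 0 < r -> 0 <= A ->
  ('N[mu]_p[EFin \o f] <= d%:E)%E ->
  (forall x, (U x)%:E = \int[mu]_y (pois r (x - y) * `|f y|)%:E)%E ->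
  measurable_fun setT g -> (forall x, `|g x| <= A * U x) ->
  ('N[mu]_p[EFin \o g] <= (A * pi * d)%:E)%E.
Proof.
move=> p1 mf d0 r0 A0 Nf UE mg gU.
have mn : measurable_fun setT (fun x => `|f x|) by exact: measurableT_comp.
have P0 (y x : R) : 0 <= pois r (x - y) by rewrite pois_ge0// ltW.
have mP (x : R) : measurable_fun setT (fun y : R => pois r (x - y)).
  by apply: measurable_pois => //; exact: measurable_funB.
have U0 x : 0 <= U x.
  by rewrite -lee_fin UE; apply: integral_ge0 => y _; rewrite lee_fin mulr_ge0.
have pi0 : 0 < pi :> R := pi_gt0 R.
case: p p1 Nf => [q| |//]; last first.
  move=> _ /Lnorm_infty_le h; apply/Lnorm_infty_le; apply: aeW => x.
  apply: (le_trans (gU x)); rewrite -mulrA ler_wpM2l// -lee_fin UE.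
  apply: (@le_trans _ _ (\int[mu]_y (d * pois r (x - y))%:E)%E).
    have n0 : forall y, (0 <= (pois r (x - y) * `|f y|)%:E)%E.
      by move=> y; rewrite lee_fin mulr_ge0.
    have n1 : forall y, (0 <= (d * pois r (x - y))%:E)%E.
      by move=> y; rewrite lee_fin mulr_ge0// (ltW d0).
    have m0 := measurable_funM (mP x) mn.
    have m1 : measurable_fun setT (fun y : R => d * pois r (x - y)).
      by apply: measurable_funM => //; exact: mP.
    apply: ae_ge0_le_integral => //.
    - exact/measurable_EFinP.
    - exact/measurable_EFinP.
    - apply: ae_imp h => y fy _.
      by rewrite lee_fin mulrC ler_wpM2r.
  by move: (ge0_integralMl mu (ltW d0) (fun y => P0 y x) (mP x)) => /= ->; rewrite integral_pois_shift// -EFinM mulrC.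
rewrite lee_fin => q1 /(Lnorm_le_integral _ q1 (ltW d0)) h.
have q0 : 0 < q by exact: lt_le_trans q1.
apply/(Lnorm_le_integral _ q1); first by rewrite !mulr_ge0 ?(ltW d0) ?(ltW pi0).
have mp : measurable_fun setT (fun x => `|f x| `^ q).
  by apply: (measurableT_comp (measurable_powR q)).
have key x : ((pi * (U x / pi) `^ q)%:E <= \int[mu]_y (pois r (x - y) * `|f y| `^ q)%:E)%E.
  set b := U x / pi; have b0 : 0 <= b by rewrite divr_ge0// ltW.
  have c0 : 0 <= q * b `^ (q - 1) by rewrite mulr_ge0 ?powR_ge0// ltW.
  have e0 : 0 <= (q - 1) * b `^ q by rewrite mulr_ge0 ?powR_ge0// subr_ge0.
  have I1 : (\int[mu]_y (q * b `^ (q - 1) * (pois r (x - y) * `|f y|))%:E = (q * pi * b `^ q)%:E)%E.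
    have m1 : measurable_fun setT (fun y : R => pois r (x - y) * `|f y|) by exact: measurable_funM.
    have n1 y : 0 <= pois r (x - y) * `|f y| by rewrite mulr_ge0.
    move: (ge0_integralMl mu c0 n1 m1) => /= ->.
    rewrite -UE -EFinM; congr (_%:E).
    have -> : U x = pi * b by rewrite /b mulrC divfK// gt_eqF.
    have := mulr_powRB1 b0 q0; move=> <-; ring.
  have I2 : (\int[mu]_y ((q - 1) * b `^ q * pois r (x - y))%:E = (pi * ((q - 1) * b `^ q))%:E)%E.
    by move: (ge0_integralMl mu e0 (fun y => P0 y x) (mP x)) => /= ->; rewrite integral_pois_shift// -EFinM mulrC.
  have m2 : measurable_fun setT (fun y : R => pois r (x - y) * `|f y| `^ q) by exact: measurable_funM.
  have n2 y : 0 <= pois r (x - y) * `|f y| `^ q by rewrite mulr_ge0// powR_ge0.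
  have m3 : measurable_fun setT (fun y : R => (q - 1) * b `^ q * pois r (x - y)) by exact: measurable_funM.
  have n3 y : 0 <= (q - 1) * b `^ q * pois r (x - y) by rewrite mulr_ge0.
  have : (\int[mu]_y (q * b `^ (q - 1) * (pois r (x - y) * `|f y|))%:E <=
     \int[mu]_y (pois r (x - y) * `|f y| `^ q + (q - 1) * b `^ q * pois r (x - y))%:E)%E.
    apply: le_ge0_integral.
    - by move=> y; apply: mulr_ge0 => //; exact: mulr_ge0.
    - by apply: measurable_funM => //; apply: measurable_funM => //; exact: mP.
    - exact: measurable_funD.
    - move=> y; have t := @powR_tangent `|f y| b q (normr_ge0 _) b0 q1.
      have := ler_wpM2l (P0 y x) t; rewrite mulrDr.
      by congr (_ <= _); ring.
  rewrite (ge0_integralDr mu n2 n3 m2 m3) I1 I2.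
  case: (\int[mu]_y (pois r (x - y) * `|f y| `^ q)%:E)%E => [w| |//]; last by move=> _; rewrite leey.
  rewrite -EFinD !lee_fin; move: (b `^ q) => X; nra.
have mU : measurable_fun setT U.
  pose F (z : R * R) := pois r (z.1 - z.2) * `|f z.2|.
  have mF : measurable_fun setT (F : plane R -> R).
    apply: measurable_funM; last exact: (measurableT_comp mn).
    by apply: measurable_pois => //; exact: measurable_funB.
  have F0 z : 0 <= F z by rewrite mulr_ge0.
  apply/measurable_EFinP; rewrite (_ : EFin \o U = fun x => \int[mu]_y (F (x, y))%:E)%E; last first.
    by apply/funext => x /=; rewrite UE.
  exact: (measurable_tonelli mu mF F0).
have mV : measurable_fun setT (fun x => (U x / pi) `^ q).
  by apply: (measurableT_comp (measurable_powR q)); exact: measurable_funM.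
have Ap : 0 <= (A * pi) `^ q by exact: powR_ge0.
apply: (@le_trans _ _ (\int[mu]_x ((A * pi) `^ q * (U x / pi) `^ q)%:E)%E).
  apply: le_ge0_integral.
  - by move=> x; exact: powR_ge0.
  - by apply: (measurableT_comp (measurable_powR q)); exact: measurableT_comp.
  - exact: measurable_funM.
  - move=> x; rewrite -powRM; [|by rewrite mulr_ge0 ?(ltW pi0)|by rewrite divr_ge0 ?(ltW pi0)].
    have V0 : 0 <= A * pi * (U x / pi).
      by apply: mulr_ge0; [rewrite mulr_ge0 ?(ltW pi0)|rewrite divr_ge0 ?(ltW pi0)].
    apply: ge0_ler_powR; rewrite ?nnegrE ?(ltW q0)//.
    by rewrite (le_trans (gU x))// -mulrA [pi * _]mulrC divfK// gt_eqF.
have n4 x : 0 <= (U x / pi) `^ q by exact: powR_ge0.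
move: (ge0_integralMl mu Ap n4 mV) => /= ->.
rewrite [in leRHS]powRM ?(ltW d0)//; last by rewrite mulr_ge0 ?(ltW pi0).
rewrite EFinM; apply: lee_wpmul2l; first by rewrite lee_fin.
have : (pi%:E * \int[mu]_x ((U x / pi) `^ q)%:E <= pi%:E * (d `^ q)%:E)%E.
  move: (ge0_integralMl mu (ltW pi0) n4 mV) => /= <-.
  pose F (z : R * R) := pois r (z.1 - z.2) * `|f z.2| `^ q.
  have mF : measurable_fun setT (F : plane R -> R).
    apply: measurable_funM; last exact: (measurableT_comp mp).
    by apply: measurable_pois => //; exact: measurable_funB.
  have F0 z : 0 <= F z by rewrite mulr_ge0// powR_ge0.
  apply: (@le_trans _ _ (\int[mu]_x \int[mu]_y (F (x, y))%:E)%E).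
    apply: ge0_le_integral => //.
    - by move=> x _; rewrite lee_fin mulr_ge0 ?(ltW pi0).
    - by apply/measurable_EFinP; exact: measurable_funM.
    - exact: (measurable_tonelli mu mF F0).
  rewrite (tonelli_swap mu mu mF F0).
  rewrite (_ : (\int[mu]_y \int[mu]_x (F (x, y))%:E = \int[mu]_y (pi * `|f y| `^ q)%:E)%E); last first.
    apply: eq_integral => y _; rewrite /F/=.
    under eq_integral do rewrite mulrC.
    have my : measurable_fun setT (fun x : R => pois r (x - y)).
      by apply: measurable_pois => //; exact: measurable_funB.
    move: (ge0_integralMl mu (powR_ge0 `|f y| q) (fun x => P0 y x) my) => /= ->.
    by rewrite integral_pois_shiftr// -EFinM mulrC.
  have n5 y : 0 <= `|f y| `^ q by exact: powR_ge0.
  move: (ge0_integralMl mu (ltW pi0) n5 mp) => /= ->.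
  by rewrite lee_wpmul2l ?lee_fin ?(ltW pi0).
by rewrite lee_pmul2l// ?lte_fin.
Qed.

End Lp_estimates.

(** * Volterra operators in space and time *)

(** The product measure under a name of its own, to which its sigma-finiteness is attached. *)
Definition leb2 (R : realType) := (@lebesgue_measure R \x @lebesgue_measure R)%E.
Arguments leb2 R _ : clear implicits.
HB.instance Definition _ (R : realType) := Measure.on (leb2 R).

Lemma leb2_sigma_finite (R : realType) : sigma_finite setT (leb2 R).
Proof.
have /sigma_finiteP[F [TF ndF Foo]] := sigma_finiteT (@lebesgue_measure R).
exists (fun n => F n `*` F n).
  rewrite -setXTT TF predeqE => -[x y]; split.
    move=> [/= [n _ Fnx] [k _ Gky]]; exists (maxn n k) => //; split.
    - by move: x Fnx; exact/subsetPset/ndF/leq_maxl.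
    - by move: y Gky; exact/subsetPset/ndF/leq_maxr.
  by move=> [n _ []/= ? ?]; split; exists n.
move=> k; have [? ?] := Foo k.
split; first exact: measurableX.
by rewrite /leb2 product_measure1E// lte_mul_pinfty// ge0_fin_numE.
Qed.

HB.instance Definition _ (R : realType) :=
  Measure_isSigmaFinite.Build _ _ _ (leb2 R) (@leb2_sigma_finite R).

Section volterra_contraction.
Context (R : realType).
Local Notation mu := (@lebesgue_measure R).
Local Notation mu2 := (leb2 R).
Implicit Types (q Z f : R * R -> R) (k : R -> R) (l t x : R).

Definition volterra q f (z : R * R) : \bar R :=
  (\int[mu2]_w (q (z.1 - w.1, z.2 - w.2) * f w)%:E)%E.

Definition stwgt l (z : R * R) := expR (- (l * z.1)) * wgt z.2.

Lemma stwgt_gt0 l z : 0 < stwgt l z.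
Proof. by rewrite mulr_gt0 ?expR_gt0 ?wgt_gt0. Qed.

Lemma measurable_stwgt l :
  measurable_fun setT (stwgt l : plane R -> R).
Proof.
apply: measurable_funM; last by apply: measurable_wgt.
apply: (measurableT_comp (@measurable_expR R)); apply: measurable_funN.
by apply: measurable_funM.
Qed.

Lemma ge0_ae_eq0 (f : R -> \bar R) : measurable_fun setT f -> (forall x, (0 <= f x)%E) ->
  (\int[mu]_x f x = 0)%E -> {ae mu, forall x, f x = 0%E}.
Proof.
move=> mf f0 h.
have : (\int[mu]_x `|f x| = 0)%E.
  by rewrite -h; apply: eq_integral => x _; rewrite gee0_abs.
move=> /(ae_eq_integral_abs mu measurableT mf); apply: ae_imp => x; exact.
Qed.

Lemma measurable_shift_arg q : measurable_fun setT q ->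
  measurable_fun setT ((fun u => q (u.1.1 - u.2.1, u.1.2 - u.2.2)) :
   plane R * plane R -> R).
Proof.
move=> mq; apply: (measurableT_comp mq); apply: measurable_fun_pair.
  by apply: measurable_funB => //; apply: measurableT_comp.
by apply: measurable_funB => //; apply: measurableT_comp.
Qed.

(** The weight [stwgt l] is a product, and its exponential factor is multiplicative: the
    operator norm splits into the effect of [q] on the weight in space and the Laplace
    transform of [k] in time. *)
Lemma volterra_weighted_le q k f l : measurable_fun setT q -> (forall z, 0 <= q z) ->
  measurable_fun setT k -> (forall s, 0 <= k s) ->
  measurable_fun setT f -> (forall z, 0 <= f z) ->
  (forall s y, (\int[mu]_x (wgt x * q (s, x - y))%:E <= (k s * wgt y)%:E)%E) ->
  (\int[mu2]_z ((stwgt l z)%:E * volterra q f z) <=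
   (\int[mu]_s (k s * expR (- (l * s)))%:E) *
   \int[mu2]_z (stwgt l z * f z)%:E)%E.
Proof.
move=> mq q0 mk k0 mf f0 hq.
have me := measurable_stwgt l; have e0 z := ltW (stwgt_gt0 l z).
have msq := measurable_shift_arg mq.
pose F (u : (R * R) * (R * R)) := stwgt l u.1 * (q (u.1.1 - u.2.1, u.1.2 - u.2.2) * f u.2).
have F0 u : 0 <= F u by apply: mulr_ge0 => //; exact: mulr_ge0.
have mF : measurable_fun setT (F : plane R * plane R -> R).
  apply: measurable_funM; first exact: (measurableT_comp me).
  by apply: measurable_funM; [exact: msq|exact: (measurableT_comp mf)].
have mq1 z : measurable_fun setT (fun w : R * R => q (z.1 - w.1, z.2 - w.2)).
  exact: (measurableT_comp msq (@pair1_measurable _ _ _ _ z)).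
have mq2 w : measurable_fun setT (fun z : R * R => q (z.1 - w.1, z.2 - w.2)).
  exact: (measurableT_comp msq (@pair2_measurable _ _ _ _ w)).
rewrite (_ : (\int[mu2]_z ((stwgt l z)%:E * volterra q f z) =
    \int[mu2]_z \int[mu2]_w (F (z, w))%:E)%E); last first.
  apply: eq_integral => z _; rewrite /volterra/F/=.
  have m1 : measurable_fun setT (fun w : R * R => q (z.1 - w.1, z.2 - w.2) * f w).
    exact: measurable_funM.
  have n1 w : 0 <= q (z.1 - w.1, z.2 - w.2) * f w by rewrite mulr_ge0.
  by move: (ge0_integralMl mu2 (e0 z) n1 m1) => /= ->.
rewrite (tonelli_swap mu2 mu2 mF F0).
set kk := (\int[mu]_s _)%E.
have kk0 : (0 <= kk)%E by apply: integral_ge0 => s _; rewrite lee_fin mulr_ge0 ?expR_ge0.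
rewrite -ge0_integralZl//; last 2 first.
- by apply/measurable_EFinP; exact: measurable_funM.
- by move=> z _; rewrite lee_fin mulr_ge0.
apply: ge0_le_integral; first exact: measurableT.
- by move=> w _; apply: integral_ge0 => z _; rewrite lee_fin.
- exact: (measurable_tonelli_r mu2 mF F0).
- apply: emeasurable_funM => //; apply/measurable_EFinP; exact: measurable_funM.
move=> w _.
have mH : measurable_fun setT (fun z : R * R => stwgt l z * q (z.1 - w.1, z.2 - w.2)).
  exact: measurable_funM.
have H0 z : 0 <= stwgt l z * q (z.1 - w.1, z.2 - w.2) by rewrite mulr_ge0.
rewrite (_ : (\int[mu2]_z (F (z, w))%:E =
   (f w)%:E * \int[mu2]_z (stwgt l z * q (z.1 - w.1, z.2 - w.2))%:E)%E); last first.
  move: (ge0_integralMl mu2 (f0 w) H0 mH) => /= <-.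
  by apply: eq_integral => z _; rewrite /F/=; congr (_%:E); ring.
rewrite [X in (_ <= kk * X)%E]EFinM muleA muleC.
apply: lee_wpmul2r; first by rewrite lee_fin.
rewrite (tonelli_l mu mu mH H0)/=.
have ml : measurable_fun setT (fun s : R => expR (- (l * s))).
  apply: (measurableT_comp (@measurable_expR R)); apply: measurable_funN.
  exact: measurable_funM.
have mks : measurable_fun setT (fun s : R => k s * expR (- (l * s))) by exact: measurable_funM.
have kE : kk = (\int[mu]_t (k (t - w.1) * expR (- (l * (t - w.1))))%:E)%E.
  rewrite /kk; symmetry.
  apply: (ge0_integral_shift (- w.1) (f := fun s => (k s * expR (- (l * s)))%:E)).
    exact/measurable_EFinP.
  by move=> s; rewrite lee_fin mulr_ge0 ?expR_ge0.
have mks1 : measurable_fun setT (fun t : R => k (t - w.1) * expR (- (l * (t - w.1)))).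
  by apply: (measurableT_comp mks); exact: measurable_funB.
have ks0 t : 0 <= k (t - w.1) * expR (- (l * (t - w.1))) by rewrite mulr_ge0 ?expR_ge0.
rewrite kE muleC; move: (ge0_integralMl mu (e0 w) ks0 mks1) => /= <-.
apply: ge0_le_integral; first exact: measurableT.
- by move=> t _; apply: integral_ge0 => x _; rewrite lee_fin.
- exact: (measurable_tonelli mu mH H0).
- by apply/measurable_EFinP; exact: measurable_funM.
- move=> t _; rewrite /stwgt/=.
  have mx : measurable_fun setT (fun x : R => wgt x * q (t - w.1, x - w.2)).
    apply: measurable_funM; first exact: measurable_wgt.
    exact: (measurableT_comp (mq2 w) (@pair1_measurable _ _ R R t)).
  have nx x : 0 <= wgt x * q (t - w.1, x - w.2) by rewrite mulr_ge0 ?wgt_ge0.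
  under eq_integral do rewrite -mulrA.
  move: (ge0_integralMl mu (expR_ge0 (- (l * t))) nx mx) => /= ->.
  rewrite (_ : expR (- (l * w.1)) * _ * _ = expR (- (l * t)) * (k (t - w.1) * wgt w.2)).
    by rewrite EFinM lee_wpmul2l// lee_fin expR_ge0.
  have -> : expR (- (l * t)) = expR (- (l * w.1)) * expR (- (l * (t - w.1))).
    by rewrite -expRD; congr expR; ring.
  by ring.
Qed.

(** For a large exponential weight in time, [volterra_weighted_le] makes the operator a
    contraction of a weighted [L^1] space. *)
Lemma volterra_contraction q k Z l : measurable_fun setT q -> (forall z, 0 <= q z) ->
  measurable_fun setT k -> (forall s, 0 <= k s) ->
  measurable_fun setT Z -> (forall z, 0 <= Z z) ->
  (forall s y, (\int[mu]_x (wgt x * q (s, x - y))%:E <= (k s * wgt y)%:E)%E) ->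
  (\int[mu]_s (k s * expR (- (l * s)))%:E <= (2^-1)%:E)%E ->
  (\int[mu2]_z (stwgt l z * Z z)%:E < +oo)%E ->
  {ae mu, forall t, {ae mu, forall x, ((Z (t, x))%:E <= volterra q Z (t, x))%E}} ->
  {ae mu, forall t, {ae mu, forall x, Z (t, x) = 0}}.
Proof.
move=> mq q0 mk k0 mZ Z0 hq hk Zfin hZ.
have me := measurable_stwgt l; have e0 z := stwgt_gt0 l z.
have meZ : measurable_fun setT (fun z => stwgt l z * Z z : R) by exact: measurable_funM.
have eZ0 z : 0 <= stwgt l z * Z z by rewrite mulr_ge0// ltW.
set J := (\int[mu2]_z _)%E in Zfin.
have J0 : (0 <= J)%E by apply: integral_ge0 => z _; rewrite lee_fin; exact: eZ0.
have V0 z : (0 <= volterra q Z z)%E.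
  by apply: integral_ge0 => w _; rewrite lee_fin mulr_ge0.
have mV : measurable_fun setT (volterra q Z : plane R -> \bar R).
  have msq := measurable_shift_arg mq.
  pose F (u : (R * R) * (R * R)) := q (u.1.1 - u.2.1, u.1.2 - u.2.2) * Z u.2.
  have mF : measurable_fun setT (F : plane R * plane R -> R).
    apply: measurable_funM; first exact: msq.
    exact: (measurableT_comp mZ).
  have F0 u : 0 <= F u by apply: mulr_ge0.
  exact: (measurable_tonelli mu2 mF F0).
have meV : measurable_fun setT (fun z => (stwgt l z)%:E * volterra q Z z)%E.
  by apply: emeasurable_funM => //; exact/measurable_EFinP.
have eV0 z : (0 <= (stwgt l z)%:E * volterra q Z z)%E by rewrite mule_ge0// lee_fin ltW.
have JJ : (J <= (2^-1)%:E * J)%E.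
  apply: (@le_trans _ _ (\int[mu2]_z ((stwgt l z)%:E * volterra q Z z))%E); last first.
    apply: (le_trans (volterra_weighted_le l mq q0 mk k0 mZ Z0 hq)).
    by rewrite lee_wpmul2r.
  rewrite {1}/J (tonelli_l mu mu meZ eZ0) (fubini_tonelli1 (m1 := mu) (m2 := mu) _ meV eV0).
  have mV1 t : measurable_fun setT (fun x => (stwgt l (t, x))%:E * volterra q Z (t, x))%E.
    exact: (measurableT_comp meV (@pair1_measurable _ _ R R t)).
  apply: ae_ge0_le_integral; first exact: measurableT.
  - by move=> t _; apply: integral_ge0 => x _; rewrite lee_fin.
  - exact: (measurable_tonelli mu meZ eZ0).
  - by move=> t _; apply: integral_ge0.
  - exact: (measurable_fun_fubini_tonelli_F (m2 := mu) _ meV eV0).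
  - apply: ae_imp hZ => t ht _; apply: ae_ge0_le_integral; first exact: measurableT.
    + by move=> x _; rewrite lee_fin.
    + apply/measurable_EFinP; exact: (measurableT_comp meZ (@pair1_measurable _ _ R R t)).
    + by move=> x _; exact: eV0.
    + exact: mV1.
    + apply: ae_imp ht => x hx _; rewrite EFinM; apply: lee_wpmul2l => //.
      by rewrite lee_fin ltW.
have Jz : J = 0%E.
  move: JJ J0 Zfin; case: J => [r| |]//; rewrite -EFinM !lee_fin => h1 h2 _.
  by congr (_%:E); lra.
have := Jz; rewrite /J (tonelli_l mu mu meZ eZ0) => h.
have n1 t : (0 <= \int[mu]_x (stwgt l (t, x) * Z (t, x))%:E)%E.
  by apply: integral_ge0 => x _; rewrite lee_fin.
have := ge0_ae_eq0 (measurable_tonelli mu meZ eZ0) n1 h.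
apply: ae_imp => t ht.
have m2 : measurable_fun setT (fun x => (stwgt l (t, x) * Z (t, x))%:E).
  apply/measurable_EFinP; exact: (measurableT_comp meZ (@pair1_measurable _ _ R R t)).
have n2 x : (0 <= (stwgt l (t, x) * Z (t, x))%:E)%E by rewrite lee_fin.
apply: ae_imp (ge0_ae_eq0 m2 n2 ht) => x [] /eqP.
by rewrite mulf_eq0 gt_eqF//= => /eqP.
Qed.

End volterra_contraction.

(** * Averages of the initial datum *)

Section kernel_bounds.
Context (R : realType) (eta : R) (heta : 0 < eta).
Local Notation mu := (@lebesgue_measure R).
Local Notation K := (Defs.Kernel eta).
Local Notation G := (dxKernel eta).
Implicit Types (t x y s : R).

(** Extending the kernels by zero to negative times turns the Duhamel integral into a
    convolution over the plane. *)
Definition Kc (z : R * R) := if 0 < z.1 then K z.1 z.2 else 0.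
Definition Gc (z : R * R) := if 0 < z.1 then G z.1 z.2 else 0.

Lemma KcE t x : 0 < t -> Kc (t, x) = K t x. Proof. by rewrite /Kc/= => ->. Qed.
Lemma GcE t x : 0 < t -> Gc (t, x) = G t x. Proof. by rewrite /Gc/= => ->. Qed.
Lemma Gc0 t x : t <= 0 -> Gc (t, x) = 0. Proof. by rewrite /Gc/= leNgt => /negbTE ->. Qed.

Lemma measurable_gt0 d (X : measurableType d) (f : X -> R) (g : X -> R) :
  measurable_fun setT f -> measurable_fun setT g ->
  measurable_fun setT (fun u => if 0 < f u then g u else 0).
Proof.
move=> mf mg; apply: measurable_fun_ifT => //.
exact: measurable_fun_ltr.
Qed.

Lemma measurable_Kc : measurable_fun setT (Kc : plane R -> R).
Proof.
rewrite (_ : Kc = fun z => if 0 < z.1 then pi^-1 * Ac eta 0 z.1 z.2 else 0); last first.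
  by apply/funext => z; rewrite /Kc; case: ifPn => // z0; rewrite Kernel_Ac.
apply: measurable_gt0 => //; apply: measurable_funM => //.
exact: measurable_Ac.
Qed.

Lemma measurable_Gc : measurable_fun setT (Gc : plane R -> R).
Proof.
rewrite (_ : Gc = fun z => if 0 < z.1 then - (pi^-1 * As eta 1 z.1 z.2) else 0); last first.
  by apply/funext => z; rewrite /Gc; case: ifPn => // z0; rewrite dxKernel_As.
apply: measurable_gt0 => //; apply: measurable_funN; apply: measurable_funM => //.
exact: measurable_As.
Qed.

Lemma kernel_bounds T : 0 < T -> exists2 C : R, 1 <= C &
  forall t x, 0 < t -> t <= T ->
    `|K t x| <= C * pois (cbrt t) x /\ `|G t x| <= C * gam (cbrt t) x.
Proof.
move=> T0; have [c0 c00 h0] := kernel_decay0 heta T0.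
have [c1 c10 h1] := kernel_decay1 heta T0.
have pi0 : 0 <= pi^-1 :> R by rewrite invr_ge0 pi_ge0.
exists (1 + pi^-1 * (c0 + c1)); first by rewrite lerDl mulr_ge0// addr_ge0.
move=> t x t0 tT; have r0 := cbrt_ge0 t.
rewrite Kernel_Ac// dxKernel_As// normrN !normrM (ger0_norm pi0).
have k0 := h0 t x t0 tT; have k1 := h1 t x t0 tT.
split.
  rewrite (@le_trans _ _ (pi^-1 * (c0 * pois (cbrt t) x)))//; first by rewrite ler_wpM2l.
  rewrite mulrA ler_wpM2r ?pois_ge0//.
  by rewrite mulrDr addrCA lerDl addr_ge0// mulr_ge0.
rewrite (@le_trans _ _ (pi^-1 * (c1 * gam (cbrt t) x)))//; first by rewrite ler_wpM2l.
rewrite mulrA ler_wpM2r ?gam_ge0//.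
by rewrite mulrDr addrA lerDr addr_ge0// mulr_ge0.
Qed.

End kernel_bounds.

Section poisson_mean.
Context (R : realType).
Local Notation mu := (@lebesgue_measure R).
Implicit Types (f : R -> R) (p : \bar R) (d t x y s : R).

Definition poisson_mean f t x := \int[mu]_y (pois (cbrt t) (x - y) * `|f y|).

Lemma measurable_poisson_mean f : measurable_fun setT f ->
  measurable_fun setT ((fun z => poisson_mean f z.1 z.2) : plane R -> R).
Proof.
move=> mf.
pose F (u : (R * R) * R) := pois (cbrt u.1.1) (u.1.2 - u.2) * `|f u.2|.
have mF : measurable_fun setT (F : plane R * measurableTypeR R -> R).
  apply: measurable_funM.
    apply: measurable_pois; first by apply: measurable_cbrt; apply: measurableT_comp.
    by apply: measurable_funB => //; apply: measurableT_comp.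
  by apply: measurableT_comp => //; apply: measurableT_comp.
exact: (measurable_Rintegral_l mu mF).
Qed.

Context f (mf : measurable_fun setT f) p d (p1 : (1 <= p)%E) (d0 : 0 < d)
  (Nf : ('N[mu]_p[EFin \o f] <= d%:E)%E).

Lemma pois_f_ge0 t x y : 0 <= pois (cbrt t) (x - y) * `|f y|.
Proof. by rewrite mulr_ge0// pois_ge0// cbrt_ge0. Qed.

Lemma measurable_pois_f r x : measurable_fun setT (fun y : R => pois r (x - y) * `|f y|).
Proof.
apply: measurable_funM; last exact: measurableT_comp.
by apply: measurable_pois => //; exact: measurable_funB.
Qed.

Lemma poisson_mean_ge0 t x : 0 <= poisson_mean f t x.
Proof. by apply: Rintegral_ge0 => y _; exact: pois_f_ge0. Qed.

Lemma pois_f_integral_le t x : 0 < t ->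
  (\int[mu]_y (pois (cbrt t) (x - y) * `|f y|)%:E <= (d * (pi + (cbrt t)^-1))%:E)%E.
Proof.
move=> t0; have r0 := cbrt_gt0 t0.
have mP : measurable_fun setT (fun y : R => pois (cbrt t) (x - y)).
  by apply: measurable_pois => //; exact: measurable_funB.
have P0 (y : R) : 0 <= pois (cbrt t) (x - y) by rewrite pois_ge0// ltW.
have PB (y : R) : pois (cbrt t) (x - y) <= (cbrt t)^-1 by exact: pois_le_inv.
apply: (le_trans (Lnorm_pairing p1 mf d0 Nf mP P0 PB)).
by rewrite integral_pois_shift// -EFinD -EFinM.
Qed.

Lemma pois_f_integrable t x : 0 < t ->
  mu.-integrable setT (EFin \o (fun y : R => pois (cbrt t) (x - y) * `|f y|)).
Proof.
move=> t0; apply: integrableR_lty; first exact: measurable_pois_f.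
under eq_integral do rewrite (ger0_norm (pois_f_ge0 _ _ _)).
exact: (le_lt_trans (pois_f_integral_le x t0) (ltry _)).
Qed.

Lemma poisson_meanE t x : 0 < t ->
  ((poisson_mean f t x)%:E = \int[mu]_y (pois (cbrt t) (x - y) * `|f y|)%:E)%E.
Proof. by move=> t0; rewrite -(Rintegral_fineK measurableT (pois_f_integrable x t0)). Qed.

Lemma poisson_mean_le rho t x : 0 < t -> cbrt t <= rho ->
  poisson_mean f t x <= d * (pi * rho + 1) / cbrt t.
Proof.
move=> t0 tr; have r0 := cbrt_gt0 t0.
rewrite -lee_fin poisson_meanE//; apply: (le_trans (pois_f_integral_le x t0)).
rewrite lee_fin -mulrA ler_wpM2l ?(ltW d0)// mulrDl mul1r lerD2r.
by rewrite ler_pdivlMr// ler_wpM2l// pi_ge0.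
Qed.

Lemma cbrt_subadd s t : 0 <= s -> 0 <= t -> cbrt (s + t) <= cbrt s + cbrt t.
Proof.
move=> s0 t0; have a0 := cbrt_ge0 s; have b0 := cbrt_ge0 t.
rewrite -(@ler_pXn2r _ 3) ?nnegrE ?cbrt_ge0 ?addr_ge0//.
rewrite cbrtK ?addr_ge0// -{1}(cbrtK s0) -{1}(cbrtK t0).
move: (cbrt s) (cbrt t) a0 b0 => a b a0 b0.
have : 0 <= a * a * b by rewrite !mulr_ge0.
have : 0 <= a * b * b by rewrite !mulr_ge0.
nra.
Qed.

(** Poisson kernels convolve additively in the scale, and [cbrt s + cbrt t] lies between
    [cbrt (s + t)] and twice that value. *)
Lemma pois_poisson_mean_le s t x : 0 < s -> 0 < t ->
  (\int[mu]_y (pois (cbrt s) (x - y) * poisson_mean f t y)%:E <=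
   (4 * pi * poisson_mean f (s + t) x)%:E)%E.
Proof.
move=> s0 t0; have st0 := addr_gt0 s0 t0.
have a0 := cbrt_gt0 s0; have b0 := cbrt_gt0 t0; have r0 := cbrt_gt0 st0.
have pi0 : 0 <= pi :> R := pi_ge0 R.
pose F (z : R * R) := pois (cbrt s) (x - z.1) * (pois (cbrt t) (z.1 - z.2) * `|f z.2|).
have F0 z : 0 <= F z by rewrite mulr_ge0 ?pois_f_ge0// pois_ge0// ltW.
have mF : measurable_fun setT (F : plane R -> R).
  apply: measurable_funM; first by apply: measurable_pois => //; exact: measurable_funB.
  apply: measurable_funM; first by apply: measurable_pois => //; exact: measurable_funB.
  by apply: measurableT_comp => //; apply: measurableT_comp.
rewrite (_ : (\int[mu]_y (pois (cbrt s) (x - y) * poisson_mean f t y)%:E =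
    \int[mu]_y \int[mu]_z (F (y, z))%:E)%E); last first.
  apply: eq_integral => y _; rewrite EFinM poisson_meanE//.
  move: (ge0_integralMl mu (pois_ge0 (x - y) (ltW a0)) (fun z => pois_f_ge0 t y z) (measurable_pois_f (cbrt t) y)) => /= <-.
  by [].
rewrite (tonelli_swap mu mu mF F0).
have c0 : 0 <= 4 * pi :> R by rewrite mulr_ge0.
rewrite EFinM poisson_meanE//.
move: (ge0_integralMl mu c0 (fun z => pois_f_ge0 (s + t) x z) (measurable_pois_f (cbrt (s + t)) x)) => /= <-.
apply: ge0_le_integral => //.
- by move=> z _; apply: integral_ge0 => y _; rewrite lee_fin.
- exact: (measurable_tonelli_r mu mF F0).
- by apply/measurable_EFinP; apply: measurable_funM => //; exact: measurable_pois_f.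
- move=> z _; rewrite /F/=.
  have m1 : measurable_fun setT (fun y : R => pois (cbrt s) (x - y) * pois (cbrt t) (y - z)).
    by apply: measurable_funM; apply: measurable_pois => //; exact: measurable_funB.
  have n1 (y : R) : 0 <= pois (cbrt s) (x - y) * pois (cbrt t) (y - z).
    by rewrite mulr_ge0 ?pois_ge0// ltW.
  under eq_integral do rewrite mulrA mulrC.
  move: (ge0_integralMl mu (normr_ge0 (f z)) n1 m1) => /= ->.
  rewrite (mulrC _ `|f z|) mulrCA EFinM; apply: lee_wpmul2l; first by rewrite lee_fin.
  apply: (le_trans (pois_conv x z a0 b0)).
  rewrite lee_fin (_ : 4 * pi * pois (cbrt (s + t)) (x - z) = 2 * pi * (2 * pois (cbrt (s + t)) (x - z))); last by ring.
  apply: ler_wpM2l; first by rewrite mulr_ge0.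
  apply: pois_le_pois => //; first by apply: cbrt_subadd; exact: ltW.
  rewrite mulrDl mul1r; apply: lerD; apply: cbrt_le; rewrite ?(ltW s0) ?(ltW t0)//.
    by rewrite lerDl ltW.
  by rewrite lerDr ltW.
Qed.

End poisson_mean.

(** * The Duhamel operator *)

Section duhamel_operator.
Context (R : realType) (eta : R) (heta : 0 < eta).
Local Notation mu := (@lebesgue_measure R).
Local Notation mu2 := (leb2 R).
Local Notation G := (dxKernel eta).
Local Notation Gc := (Gc eta).
Implicit Types (f : R * R -> R) (t x : R).

Definition duh f (z : R * R) := \int[mu2]_w (Gc (z.1 - w.1, z.2 - w.2) * f w).

Lemma measurable_duh f :
  measurable_fun setT (f : plane R -> R) ->
  measurable_fun setT (duh f : plane R -> R).
Proof.
move=> mf.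
pose F (u : (R * R) * (R * R)) := Gc (u.1.1 - u.2.1, u.1.2 - u.2.2) * f u.2.
have mF : measurable_fun setT (F : plane R * plane R -> R).
  apply: measurable_funM; last exact: (measurableT_comp mf).
  exact: measurable_shift_arg (measurable_Gc heta).
exact: (measurable_Rintegral_l mu2 mF).
Qed.

Lemma measurable_duh_arg f z :
  measurable_fun setT (f : plane R -> R) ->
  measurable_fun setT ((fun w => Gc (z.1 - w.1, z.2 - w.2) * f w) :
     plane R -> R).
Proof.
move=> mf; apply: measurable_funM => //.
exact: (measurableT_comp (measurable_shift_arg (measurable_Gc heta)) (@pair1_measurable _ _ _ _ z)).
Qed.

Section agreement.
(** Only the values of [f] before time [t] matter, so the same [f] can serve all times
    of a strip. *)
Variables (v : R -> R -> R) (f : R * R -> R) (t : R).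
Hypothesis f0 : forall w, w.1 <= 0 -> f w = 0.
Hypothesis fv : forall w, 0 < w.1 -> w.1 < t -> f w = v w.1 w.2 ^+ 2.

Let patchE x : (fun w => Gc (t - w.1, x - w.2) * f w) =
  (fun w => G (t - w.1) (x - w.2) * v w.1 w.2 ^+ 2) \_ (`]0, t[ `*` [set: R]).
Proof.
apply/funext => w; rewrite /patch; case: ifPn.
  rewrite inE => -[/= + _]; rewrite in_itv/= => /andP[w0 wt].
  by rewrite GcE ?subr_gt0// fv.
rewrite notin_setE => h; have [w0|w0] := leP w.1 0; first by rewrite f0// mulr0.
have [wt|wt] := ltP w.1 t; last by rewrite Gc0 ?mul0r// subr_le0.
by exfalso; apply: h; split => //=; rewrite in_itv/= w0.
Qed.

Let mD : measurable (`]0, t[%classic `*` [set: R] : set (plane R)).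
Proof. by apply: measurableX => //; exact: measurable_itv. Qed.

Lemma duhamel_cvgE x : duhamel_cvg eta v t x <->
  mu2.-integrable setT (EFin \o (fun w => Gc (t - w.1, x - w.2) * f w)).
Proof.
rewrite patchE (_ : EFin \o _ = (fun w => (G (t - w.1) (x - w.2) * v w.1 w.2 ^+ 2)%:E) \_ (`]0, t[ `*` [set: R])).
  exact: (integrable_mkcond (mu := mu2) _ mD).
by apply/funext => w /=; rewrite /patch; case: ifPn.
Qed.

Lemma duhamelE x : duhamel_cvg eta v t x -> duhamel eta v t x = duh f (t, x).
Proof.
move=> /duhamel_cvgE fi; rewrite /duh /= -(Rfubini_l fi) /duhamel Rintegral_mkcond.
apply: eq_Rintegral => s _; rewrite /patch; case: ifPn.
  rewrite inE/= in_itv/= => /andP[s0 st]; apply: eq_Rintegral => y _ /=.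
  by rewrite GcE ?subr_gt0// fv.
rewrite notin_setE/= in_itv/= => h.
rewrite /Rintegral integral0_eq// => y _.
have [s0|s0] := leP s 0; first by rewrite f0// mulr0.
have [st|st] := ltP s t; last by rewrite Gc0 ?mul0r// subr_le0.
by exfalso; apply: h; rewrite s0.
Qed.

End agreement.
End duhamel_operator.

(** * Existence by successive approximations *)

Section existence.
Context (R : realType) (eta : R) (heta : 0 < eta) (T : R) (T0 : 0 < T).
Local Notation mu := (@lebesgue_measure R).
Local Notation mu2 := (leb2 R).
Local Notation K := (Defs.Kernel eta).
Local Notation G := (dxKernel eta).
Local Notation Gc := (Gc eta).
Local Notation Kc := (Kc eta).
Local Notation duh := (duh eta).
Context (C : R) (C1 : 1 <= C) (hC : forall t x, 0 < t -> t <= T ->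
    `|K t x| <= C * pois (cbrt t) x /\ `|G t x| <= C * gam (cbrt t) x).
Context (S : R) (hS : (\int[mu]_s (sing T s)%:E <= S%:E)%E).
Context (p : \bar R) (p1 : (1 <= p)%E) (d : R) (d0 : 0 < d).
Context (u0 : R -> R) (mu0 : measurable_fun setT u0)
  (Nu0 : ('N[mu]_p[EFin \o u0] <= d%:E)%E).
Context (d_small : 64 * pi * C ^+ 2 * (pi * cbrt T + 1) * S * d <= 1).
Local Notation U := (poisson_mean u0).
Implicit Types (t x y s : R) (u v : R * R -> R) (z w : R * R).

Let C0 : 0 < C. Proof. exact: lt_le_trans C1. Qed.
Let S0 : 0 <= S.
Proof.
rewrite -lee_fin; apply: le_trans hS; apply: integral_ge0 => s _.
by rewrite lee_fin sing_ge0.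
Qed.
Let U0 t x : 0 <= U t x. Proof. exact: poisson_mean_ge0. Qed.

Definition majorant z := if (0 < z.1) && (z.1 < T) then 2 * C * U z.1 z.2 else 0.
Local Notation W := majorant.

Lemma measurable_strip d' (X : measurableType d') (f g : X -> R) :
  measurable_fun setT f -> measurable_fun setT g ->
  measurable_fun setT (fun a : X => if (0 < f a) && (f a < T) then g a else 0).
Proof.
move=> mf mg; apply: measurable_fun_ifT => //.
by apply: measurable_and; exact: measurable_fun_ltr.
Qed.

Lemma majorant_ge0 z : 0 <= W z.
Proof. by rewrite /W; case: ifP => // _; rewrite !mulr_ge0// ltW. Qed.

Lemma measurable_majorant : measurable_fun setT (W : plane R -> R).
Proof.
apply: measurable_strip => //; apply: measurable_funM => //.
exact: measurable_poisson_mean.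
Qed.

(** One factor [W] is kept and averaged by [pois_poisson_mean_le], the other is replaced by
    its supremum, of order [d / cbrt s].  The smallness of [d] enters here only. *)
Lemma duhamel_majorant t x : 0 < t -> t < T ->
  (\int[mu2]_w (`|Gc (t - w.1, x - w.2)| * W w ^+ 2)%:E <= (W (t, x) / 4)%:E)%E.
Proof.
move=> t0 tT; set rho := cbrt T.
pose B := 8 * pi * C ^+ 2 * d * (pi * rho + 1) * W (t, x).
have rho0 : 0 <= rho by exact: cbrt_ge0.
have pi0 : 0 <= pi :> R := pi_ge0 R.
have e0 : 0 <= pi * rho + 1 by rewrite addr_ge0 ?mulr_ge0.
have W0 := majorant_ge0 (t, x).
have B0 : 0 <= B by rewrite !mulr_ge0// ?sqr_ge0// ltW.
pose F w := `|Gc (t - w.1, x - w.2)| * W w ^+ 2.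
have F0 w : 0 <= F w by rewrite mulr_ge0 ?sqr_ge0.
have mW := measurable_majorant.
have mGx : measurable_fun setT ((fun w => Gc (t - w.1, x - w.2)) : plane R -> R).
  exact: (measurableT_comp (measurable_shift_arg (measurable_Gc heta)) (@pair1_measurable _ _ _ _ (t, x))).
have mF : measurable_fun setT (F : plane R -> R).
  apply: measurable_funM; first exact: measurableT_comp.
  exact: measurable_funX.
rewrite (tonelli_l mu mu mF F0)/=.
have ms : measurable_fun setT (fun s : R => sing T (t - s) + sing T s).
  by apply: measurable_funD; apply: measurable_sing => //; exact: measurable_funB.
have ns s : 0 <= sing T (t - s) + sing T s by rewrite addr_ge0 ?sing_ge0.
(* The singularity [1 / (cbrt (t - s) * cbrt s)] is split by
   [1 / (a b) <= 1 / a^2 + 1 / b^2]. *)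
apply: (@le_trans _ _ (\int[mu]_s (B * (sing T (t - s) + sing T s))%:E)%E); last first.
  move: (ge0_integralMl mu B0 ns ms) => /= ->.
  have m1 : measurable_fun setT (fun s : R => sing T (t - s)).
    by apply: measurable_sing; exact: measurable_funB.
  have m2 : measurable_fun setT (fun s : R => sing T s) by exact: measurable_sing.
  have E1 : (\int[mu]_s (sing T (t - s))%:E = \int[mu]_s (sing T s)%:E)%E.
    apply: (ge0_integral_subl t (f := fun s => (sing T s)%:E)).
      exact/measurable_EFinP.
    by move=> s; rewrite lee_fin sing_ge0.
  move: (ge0_integralDr mu (fun s => sing_ge0 T (t - s)) (sing_ge0 T) m1 m2) => /= ->.
  rewrite E1; apply: (@le_trans _ _ (B%:E * (S%:E + S%:E))%E).
    by apply: lee_wpmul2l; [rewrite lee_fin|exact: (leeD hS hS)].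
  rewrite -EFinD -EFinM lee_fin /B -/rho.
  have := ler_wpM2r W0 d_small; rewrite mul1r -/rho.
  move: (W (t, x)) => X; nra.
apply: ge0_le_integral => //.
- by move=> s _; apply: integral_ge0 => y _; rewrite lee_fin.
- exact: (measurable_tonelli mu mF F0).
- by apply/measurable_EFinP; exact: measurable_funM.
move=> s _.
have [s0|s0] := leP s 0.
  rewrite integral0_eq; first by rewrite lee_fin mulr_ge0.
  by move=> y _; rewrite /F /W/= ltNge s0 /= expr0n mulr0.
have [st|st] := ltP s t; last first.
  rewrite integral0_eq; first by rewrite lee_fin mulr_ge0.
  by move=> y _; rewrite /F/= Gc0 ?subr_le0// normr0 mul0r.
have st0 : 0 < t - s by rewrite subr_gt0.
have stT : t - s < T by rewrite (le_lt_trans _ tT)// gerBl ltW.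
have sT : s < T by exact: lt_trans tT.
rewrite !singE//.
set a := cbrt (t - s); set b := cbrt s.
have a0 : 0 < a by exact: cbrt_gt0.
have b0 : 0 < b by exact: cbrt_gt0.
have bT : b <= rho by apply: cbrt_le; exact: ltW.
pose c := 4 * C ^+ 3 * d * (pi * rho + 1) / (a * b).
have c0 : 0 <= c by rewrite divr_ge0 ?mulr_ge0 ?exprn_ge0 ?(ltW C0) ?(ltW d0) ?(ltW a0) ?(ltW b0).
have mP : measurable_fun setT (fun y : R => pois a (x - y) * U s y).
  apply: measurable_funM; first by apply: measurable_pois => //; exact: measurable_funB.
  exact: (measurableT_comp (measurable_poisson_mean mu0) (@pair1_measurable _ _ R R s)).
have nP (y : R) : 0 <= pois a (x - y) * U s y by rewrite mulr_ge0// pois_ge0// ltW.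
apply: (@le_trans _ _ (\int[mu]_y (c * (pois a (x - y) * U s y))%:E)%E).
  apply: le_ge0_integral => //.
  - exact: (measurableT_comp mF (@pair1_measurable _ _ R R s)).
  - exact: measurable_funM.
  move=> y; rewrite /F/= GcE// /W/= s0 sT/=.
  have [_ hG] := hC (x - y) st0 (ltW stT).
  have hg := gam_le_pois (x - y) a0.
  have hU := poisson_mean_le mu0 p1 d0 Nu0 y s0 bT.
  have P0 : 0 <= pois a (x - y) by rewrite pois_ge0// ltW.
  apply: (@le_trans _ _ ((C * (pois a (x - y) / a)) * (4 * C ^+ 2 * U s y * (d * (pi * rho + 1) / b)))).
    apply: ler_pM => //; first exact: sqr_ge0.
      by apply: (le_trans hG); rewrite ler_wpM2l// ltW.
    rewrite (_ : (2 * C * U s y) ^+ 2 = 4 * C ^+ 2 * U s y * U s y); last by ring.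
    apply: ler_wpM2l; last exact: hU.
    by apply: mulr_ge0 => //; apply: mulr_ge0 => //; exact: sqr_ge0.
  rewrite le_eqVlt; apply/orP; left; apply/eqP; rewrite /c; field.
  by rewrite !gt_eqF.
move: (ge0_integralMl mu c0 nP mP) => /= ->.
apply: (@le_trans _ _ (c%:E * (4 * pi * U t x)%:E)%E).
  apply: lee_wpmul2l; first by rewrite lee_fin.
  have := pois_poisson_mean_le mu0 p1 d0 Nu0 x st0 s0.
  by rewrite subrK.
rewrite -EFinM lee_fin /B /W/= t0 tT/= /c.
have hab : (a * b)^-1 <= (a ^+ 2)^-1 + (b ^+ 2)^-1.
  rewrite invfM -!exprVn; have := sqr_ge0 (a^-1 - b^-1).
  have : 0 <= a^-1 * b^-1 by rewrite mulr_ge0 ?invr_ge0 ?(ltW a0) ?(ltW b0).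
  move: (a^-1) (b^-1) => X Y; nra.
rewrite (_ : 4 * C ^+ 3 * d * (pi * rho + 1) / (a * b) * (4 * pi * U t x) =
   8 * pi * C ^+ 2 * d * (pi * rho + 1) * (2 * C * U t x) * (a * b)^-1); last by ring.
apply: ler_wpM2l => //.
by rewrite !mulr_ge0 ?sqr_ge0 ?(ltW C0) ?(ltW d0).
Qed.

Lemma duhamel_integrable u z : measurable_fun setT (u : plane R -> R) ->
  0 < z.1 -> z.1 < T -> (forall w, `|u w| <= W w ^+ 2) ->
  mu2.-integrable setT (EFin \o (fun w => Gc (z.1 - w.1, z.2 - w.2) * u w)).
Proof.
case: z => t x /= mu_ t0 tT hu; apply: integrableR_lty.
  exact: (measurable_duh_arg heta (t, x)).
apply: (@le_lt_trans _ _ (W (t, x) / 4)%:E); last exact: ltry.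
apply: le_trans (duhamel_majorant x t0 tT).
apply: le_ge0_integral => //.
- by apply: measurableT_comp => //; exact: (measurable_duh_arg heta (t, x)).
- apply: measurable_funM; last by apply: measurable_funX; exact: measurable_majorant.
  apply: measurableT_comp => //.
  exact: (measurableT_comp (measurable_shift_arg (measurable_Gc heta)) (@pair1_measurable _ _ _ _ (t, x))).
- by move=> w; rewrite normrM ler_wpM2l.
Qed.

Lemma duhamel_le u z a : measurable_fun setT (u : plane R -> R) ->
  0 < z.1 -> z.1 < T -> 0 <= a -> (forall w, `|u w| <= a * W w ^+ 2) ->
  `|duh u z| <= a * (W z / 4).
Proof.
case: z => t x /= mu_ t0 tT a0 hu.
have mG : measurable_fun setT ((fun w => Gc (t - w.1, x - w.2)) : plane R -> R).
  exact: (measurableT_comp (measurable_shift_arg (measurable_Gc heta)) (@pair1_measurable _ _ _ _ (t, x))).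
have mGW : measurable_fun setT ((fun w => `|Gc (t - w.1, x - w.2)| * W w ^+ 2) : plane R -> R).
  apply: measurable_funM; last by apply: measurable_funX; exact: measurable_majorant.
  exact: measurableT_comp.
have nGW w : 0 <= `|Gc (t - w.1, x - w.2)| * W w ^+ 2 by rewrite mulr_ge0 ?sqr_ge0.
have mGu := measurable_duh_arg heta (t, x) mu_.
rewrite -lee_fin; apply: (le_trans (abs_Rintegral_le mu2 measurableT mGu)).
rewrite EFinM; apply: le_trans (lee_wpmul2l _ (duhamel_majorant x t0 tT)); last by rewrite lee_fin.
move: (ge0_integralMl mu2 a0 nGW mGW) => /= <-.
apply: le_ge0_integral => //.
- exact: measurableT_comp.
- exact: measurable_funM.
- by move=> w; rewrite normrM mulrCA ler_wpM2l.
Qed.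

Definition heat z := \int[mu]_y (Kc (z.1, z.2 - y) * u0 y).

Lemma heatE t x : 0 < t -> heat (t, x) = Defs.conv (K t) u0 x.
Proof. by move=> t0; apply: eq_Rintegral => y _; rewrite KcE. Qed.

Lemma measurable_heat : measurable_fun setT (heat : plane R -> R).
Proof.
pose F (u : (R * R) * R) := Kc (u.1.1, u.1.2 - u.2) * u0 u.2.
have mF : measurable_fun setT (F : plane R * measurableTypeR R -> R).
  apply: measurable_funM; last exact: measurableT_comp.
  apply: (measurableT_comp (measurable_Kc heta)); apply: measurable_fun_pair => //.
    exact: measurableT_comp.
  by apply: measurable_funB => //; exact: measurableT_comp.
exact: (measurable_Rintegral_l mu mF).
Qed.

Lemma heat_le z : 0 < z.1 -> z.1 < T -> `|heat z| <= C * U z.1 z.2.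
Proof.
case: z => t x /= t0 tT.
have mKt : measurable_fun setT (fun y : R => Kc (t, x - y)).
  apply: (measurableT_comp (measurable_Kc heta)).
  by apply: measurable_fun_pair => //; exact: measurable_funB.
have mh : measurable_fun setT (fun y : R => Kc (t, x - y) * u0 y) by exact: measurable_funM.
rewrite -lee_fin; apply: (le_trans (abs_Rintegral_le mu measurableT mh)).
rewrite EFinM (poisson_meanE mu0 p1 d0 Nu0)//.
move: (ge0_integralMl mu (ltW C0) (fun y => pois_f_ge0 u0 t x y) (measurable_pois_f mu0 (cbrt t) x)) => /= <-.
apply: le_ge0_integral => //.
- exact: measurableT_comp.
- by apply: measurable_funM => //; exact: measurable_pois_f.
- move=> y; rewrite KcE// normrM mulrA ler_wpM2r//.
  by have [] := hC (x - y) t0 (ltW tT).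
Qed.

Definition picard u z :=
  if (0 < z.1) && (z.1 < T) then heat z - 2%:R^-1 * duh (fun w => u w ^+ 2) z else 0.

Lemma measurable_picard u : measurable_fun setT (u : plane R -> R) ->
  measurable_fun setT (picard u : plane R -> R).
Proof.
move=> mu_; apply: measurable_strip => //; apply: measurable_funB; first exact: measurable_heat.
apply: measurable_funM => //; apply: (measurable_duh heta); exact: measurable_funX.
Qed.

Lemma picard_le u : measurable_fun setT (u : plane R -> R) ->
  (forall z, `|u z| <= W z) -> forall z, `|picard u z| <= W z.
Proof.
move=> mu_ hu z; rewrite /picard /W; case: ifPn; last by rewrite normr0.
move=> /andP[t0 tT]; have h1 := heat_le t0 tT.
have m2 : measurable_fun setT ((fun w => u w ^+ 2) : plane R -> R).
  exact: measurable_funX.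
have u2 w : `|u w ^+ 2| <= 1 * W w ^+ 2.
  by rewrite mul1r normrX ler_pXn2r ?nnegrE ?majorant_ge0.
have h2 := duhamel_le m2 t0 tT ler01 u2.
rewrite mul1r /W t0 tT/= in h2.
have := ler_normB (heat z) (2^-1 * duh (fun w => u w ^+ 2) z).
have CU : 0 <= C * U z.1 z.2 by rewrite mulr_ge0// ltW.
rewrite normrM ger0_norm// -(mulrA 2 C) in h2 *.
move: h1 h2 CU; move: (C * U z.1 z.2) => X; lra.
Qed.

(** [u^2 - v^2] is bounded by [2 a W^2]; the factor [1/2] comes from [duhamel_majorant]. *)
Lemma picard_contract u v a : measurable_fun setT (u : plane R -> R) ->
  measurable_fun setT (v : plane R -> R) ->
  (forall z, `|u z| <= W z) -> (forall z, `|v z| <= W z) -> 0 <= a ->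
  (forall z, `|u z - v z| <= a * W z) ->
  forall z, `|picard u z - picard v z| <= a / 2 * W z.
Proof.
move=> mu_ mv hu hv a0 huv z; rewrite /picard; case: ifPn; last first.
  by rewrite subrr normr0 mulr_ge0 ?divr_ge0 ?majorant_ge0.
move=> /andP[t0 tT].
have sq (f : R * R -> R) : measurable_fun setT (f : plane R -> R) ->
   (forall z, `|f z| <= W z) -> mu2.-integrable setT (EFin \o (fun w => Gc (z.1 - w.1, z.2 - w.2) * f w ^+ 2)).
  move=> mf hf; apply: duhamel_integrable => //; first exact: measurable_funX.
  by move=> w; rewrite normrX ler_pXn2r ?nnegrE ?majorant_ge0.
have D : duh (fun w => u w ^+ 2) z - duh (fun w => v w ^+ 2) z = duh (fun w => u w ^+ 2 - v w ^+ 2) z.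
  rewrite /duh -(RintegralB measurableT (sq u mu_ hu) (sq v mv hv)).
  by apply: eq_Rintegral => w _; rewrite mulrBr.
have -> : heat z - 2^-1 * duh (fun w => u w ^+ 2) z - (heat z - 2^-1 * duh (fun w => v w ^+ 2) z) =
  - (2^-1 * (duh (fun w => u w ^+ 2) z - duh (fun w => v w ^+ 2) z)) by ring.
have m2 : measurable_fun setT ((fun w => u w ^+ 2 - v w ^+ 2) : plane R -> R).
  by apply: measurable_funB; exact: measurable_funX.
have a20 : 0 <= 2 * a by rewrite mulr_ge0.
have b2 w : `|u w ^+ 2 - v w ^+ 2| <= 2 * a * W w ^+ 2.
  rewrite subr_sqr normrM (_ : 2 * a * W w ^+ 2 = (a * W w) * (W w + W w)); last by ring.
  by apply: ler_pM => //; apply: (le_trans (ler_normD _ _)); exact: lerD.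
rewrite D normrN normrM ger0_norm//.
apply: (le_trans (ler_wpM2l _ (duhamel_le m2 t0 tT a20 b2))) => //.
have : 0 <= a * W z by rewrite mulr_ge0 ?majorant_ge0.
move: (W z) => X; nra.
Qed.

Definition picard_seq n := iter n picard (fun=> 0).
Local Notation un := picard_seq.

Lemma picard_seq_spec n :
  measurable_fun setT (un n : plane R -> R) /\
  (forall z, `|un n z| <= W z).
Proof.
elim: n => [|n [m h]]; first by split=> [|z]; [exact: measurable_cst|rewrite normr0 majorant_ge0].
by split; [exact: measurable_picard|exact: picard_le].
Qed.

Lemma picard_seq_diff n z : `|un n.+1 z - un n z| <= 2^-1 ^+ n * W z.
Proof.
elim: n z => [|n IH] z.
  by rewrite expr0 mul1r /= subr0; have [_] := picard_seq_spec 1; apply.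
have [m1 h1] := picard_seq_spec n; have [m2 h2] := picard_seq_spec n.+1.
rewrite exprSr; apply: picard_contract => //; exact: exprn_ge0.
Qed.

Lemma picard_seq_cvg z : cvgn (fun n => un n z).
Proof.
have E : (fun n => un n z) = series (telescope (fun n => un n z)).
  by apply/funext => n; rewrite [LHS](eq_sum_telescope (fun n => un n z)) add0r.
rewrite E; apply: normed_cvg.
apply: (@series_le_cvg _ _ (geometric (W z) 2^-1)) => //.
- by move=> n; exact: normr_ge0.
- by move=> n; rewrite /geometric/= mulr_ge0 ?exprn_ge0 ?majorant_ge0.
- move=> n; rewrite /telescope /geometric/= mulrC; exact: picard_seq_diff.
- by apply: is_cvg_geometric_series; rewrite ger0_norm// invf_lt1// ltr1n.
Qed.

Definition picard_lim z := lim (un n z @[n --> \oo]).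
Local Notation u := picard_lim.

Lemma picard_limP z : un n z @[n --> \oo] --> u z.
Proof. exact: picard_seq_cvg. Qed.

Lemma measurable_picard_lim : measurable_fun setT (u : plane R -> R).
Proof.
apply: (measurable_fun_cvg (h := un)); first by move=> n; have [] := picard_seq_spec n.
by move=> z _; exact: picard_limP.
Qed.

Lemma picard_lim_le z : `|u z| <= W z.
Proof.
have c : cvgn (fun n => un n z) := @picard_seq_cvg z.
rewrite ler_norml; apply/andP; split.
  apply: limr_ge => //; apply: nearW => n; have [_ /(_ z)] := picard_seq_spec n.
  by rewrite ler_norml => /andP[].
apply: limr_le => //; apply: nearW => n; have [_ /(_ z)] := picard_seq_spec n.
by rewrite ler_norml => /andP[].
Qed.

(** Passing to the limit in the Duhamel term is dominated convergence, with [W^2] as the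
    dominating function. *)
Lemma picard_lim_fixed z : u z = picard u z.
Proof.
have lim2 : un n.+1 z @[n --> \oo] --> u z.
  by rewrite (cvg_shiftS (fun n => un n z)); exact: picard_limP.
have [/andP[t0 tT]|h] := boolP ((0 < z.1) && (z.1 < T)); last first.
  have E : (fun n => un n.+1 z) = fun=> 0.
    by apply/funext => n; rewrite /= /picard (negbTE h).
  rewrite /picard (negbTE h); apply: cvg_unique lim2 _ => //; rewrite E.
  exact: cvg_cst.
apply: cvg_unique lim2 _ => //=; rewrite /picard t0 tT/=.
apply: cvgB; first exact: cvg_cst.
apply: cvgMl_tmp; rewrite /duh.
have mG : measurable_fun setT ((fun w => Gc (z.1 - w.1, z.2 - w.2)) : plane R -> R).
  exact: (measurableT_comp (measurable_shift_arg (measurable_Gc heta)) (@pair1_measurable _ _ _ _ z)).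
apply: (@Rdominated_cvg _ _ _ mu2 _ _ (fun w => `|Gc (z.1 - w.1, z.2 - w.2) * W w ^+ 2|)).
- move=> n; apply: measurable_funM => //; apply: measurable_funX.
  by have [] := picard_seq_spec n.
- by apply: measurable_funM => //; apply: measurable_funX; exact: measurable_picard_lim.
- move=> w; apply: cvgMl_tmp; under eq_fun do rewrite expr2; rewrite expr2.
  by apply: cvgM; exact: picard_limP.
- apply: integrable_norm; apply: duhamel_integrable => //.
    by apply: measurable_funX; exact: measurable_majorant.
  by move=> w; rewrite ger0_norm ?sqr_ge0.
- move=> n w; rewrite normrM [leRHS]normrM ler_wpM2l// !normrX.
  have [_ /(_ w) h] := picard_seq_spec n.
  by rewrite (ger0_norm (majorant_ge0 w)) ler_pXn2r ?nnegrE ?majorant_ge0.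
Qed.

Lemma picard_lim_duhamel_cvg t x : 0 < t -> t < T ->
  duhamel_cvg eta (fun t x => u (t, x)) t x.
Proof.
move=> t0 tT; apply/(@duhamel_cvgE _ eta _ (fun w => u w ^+ 2)).
- move=> w w0; have := picard_lim_le w; rewrite /W ltNge w0/= normr_le0 => /eqP ->.
  by rewrite expr0n.
- by move=> [w1 w2].
- apply: (@duhamel_integrable _ (t, x)) => //.
    by apply: measurable_funX; exact: measurable_picard_lim.
  by move=> w; rewrite normrX ler_pXn2r ?nnegrE ?majorant_ge0// picard_lim_le.
Qed.

Lemma picard_lim_eq t x : 0 < t -> t < T ->
  u (t, x) = Defs.conv (K t) u0 x - 2%:R^-1 * duhamel eta (fun t x => u (t, x)) t x.
Proof.
move=> t0 tT; rewrite {1}picard_lim_fixed /picard/= t0 tT/= heatE//.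
rewrite (@duhamelE _ eta _ (fun w => u w ^+ 2))//; last exact: picard_lim_duhamel_cvg.
  move=> w w0; have := picard_lim_le w; rewrite /W ltNge w0/= normr_le0 => /eqP ->.
  by rewrite expr0n.
by move=> [w1 w2].
Qed.

Lemma picard_lim_Lnorm t : 0 < t -> t < T ->
  ('N[mu]_p[EFin \o (fun x => u (t, x))] <= (2 * C * pi * d)%:E)%E.
Proof.
move=> t0 tT.
apply: (@pois_average_Lnorm _ p u0 d (cbrt t) (U t)) => //.
- exact: cbrt_gt0.
- by rewrite mulr_ge0// ltW.
- by move=> x; rewrite (poisson_meanE mu0 p1 d0 Nu0).
- exact: (measurableT_comp measurable_picard_lim (@pair1_measurable _ _ R R t)).
- by move=> x; have := picard_lim_le (t, x); rewrite /W/= t0 tT.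
Qed.

End existence.

(** * Almost every time *)

Section almost_everywhere.
Context (R : realType).
Local Notation mu := (@lebesgue_measure R).
Implicit Types (P : R -> Prop) (a b c T : R).

Lemma ae_exists P a b : {ae mu, forall x, P x} -> a < b -> exists x, a < x < b /\ P x.
Proof.
move=> [A [mA A0 PA]] ab; apply: contrapT => h.
have : (mu `]a, b[%classic <= mu A)%E.
  apply: le_measure; rewrite ?inE//.
  move=> x; rewrite /= in_itv/= => xab; apply: PA => /= Px; apply: h.
  by exists x.
by rewrite A0 lebesgue_measure_itv/= lte_fin ab -EFinB lee_fin subr_le0 leNgt ab.
Qed.

Lemma ae_shift P c : {ae mu, forall x, P x} -> {ae mu, forall x, P (x + c)}.
Proof.
move=> [A [mA A0 PA]].
have ms : measurable_fun setT (fun x : R => x + c) by exact: measurable_funD.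
exists ((fun x : R => x + c) @^-1` A); split.
- by rewrite -[X in measurable X]setTI; exact: ms.
- by rewrite -[RHS]A0 -(lebesgue_measure_shift c mA).
- by move=> x /= nP; exact: PA.
Qed.

Lemma ae_nat (P : nat -> R -> Prop) : (forall n, {ae mu, forall x, P n x}) ->
  {ae mu, forall x, forall n, P n x}.
Proof. by move=> h; exact: ae_foralln. Qed.

(** A property valid almost everywhere holds along a dense sequence: a time is picked in each
    interval with rational endpoints.  Working with countably many restart times
    leaves only countably many null sets. *)
Lemma dense_ae_sequence P T : 0 < T -> {ae mu, forall t, 0 < t < T -> P t} ->
  exists e : nat -> R, (forall n, 0 < e n < T /\ P (e n)) /\
    forall a b, 0 <= a -> a < b -> b <= T -> exists n, a < e n < b.
Proof.
move=> T0 hP.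
have ex a b : 0 <= a -> a < b -> b <= T -> exists x, a < x < b /\ P x.
  move=> a0 ab bT; have [x [/andP[ax xb] h]] := ae_exists hP ab.
  by exists x; split; [rewrite ax|apply: h; rewrite (le_lt_trans a0)//= (lt_le_trans xb)].
have step (q : rat * rat) : exists x : R, (0 < x < T /\ P x) /\
   (0 <= ratr q.1 :> R -> ratr q.1 < ratr q.2 :> R -> ratr q.2 <= T -> ratr q.1 < x < ratr q.2).
  have [/and3P[h1 h2 h3]|h] := boolP [&& 0 <= ratr q.1 :> R, ratr q.1 < ratr q.2 :> R & ratr q.2 <= T].
    have [x [xq Px]] := ex _ _ h1 h2 h3; exists x; split=> //; split=> //.
    by case/andP: xq => q1 q2; rewrite (le_lt_trans h1)//= (lt_le_trans q2).
  have [x [xq Px]] := ex 0 T (lexx _) T0 (lexx _); exists x; split=> // a1 a2 a3.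
  by rewrite a1 a2 a3 in h.
have [F hF] := choice step.
exists (fun n => F (odflt (0, 0) (unpickle n))); split=> [n|a b a0 ab bT].
  by have [] := hF (odflt (0, 0) (unpickle n)).
have [q1 /andP[]] := rat_in_itvoo ab; rewrite !bnd_simp => aq1 q1b.
have [q2 /andP[]] := rat_in_itvoo q1b; rewrite !bnd_simp => q12 q2b.
have [_ h] := hF (q1, q2); exists (pickle (q1, q2)); rewrite pickleK/=.
have /andP[h1 h2] := h (ltW (le_lt_trans a0 aq1)) q12 (ltW (lt_le_trans q2b bT)).
by rewrite (lt_trans aq1)//= (lt_trans h2).
Qed.

Lemma ge0_integral_lty_ae (f : R -> \bar R) : measurable_fun setT f ->
  (forall x, (0 <= f x)%E) -> (\int[mu]_x f x < +oo)%E -> {ae mu, forall x, (f x < +oo)%E}.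
Proof.
move=> mf f0 h.
have fi : mu.-integrable setT f.
  by apply/integrableP; split=> //; under eq_integral do rewrite gee0_abs//.
have := integrable_ae measurableT fi; apply: ae_imp => x /(_ I).
by rewrite ge0_fin_numE.
Qed.

End almost_everywhere.

(** * The averaged Volterra kernel *)

Section volterra_kernel.
Context (R : realType) (T : R) (T0 : 0 < T).
Local Notation mu := (@lebesgue_measure R).
Implicit Types (s x y c : R) (z : R * R).

(** Up to constants, [vker] is a bound for the derivative of the kernel divided by
    [cbrt t].  The factor [cbrt t] set aside is at most [cbrt s] when a time [s] has
    elapsed since the restart; this is where smallness comes from.  [vavg] is its average over unit translations. *)
Definition vker z := if (0 < z.1) && (z.1 < T) then gam (cbrt z.1) z.2 / cbrt z.1 else 0.
Definition vavg z := \int[mu]_(c in `[0, 1]) vker (z.1, z.2 + c).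
Definition vkers z := vker z + vavg z.

Lemma vker_ge0 z : 0 <= vker z.
Proof.
by rewrite /vker; case: ifP => // _; rewrite divr_ge0 ?gam_ge0 ?cbrt_ge0.
Qed.

Lemma vavg_ge0 z : 0 <= vavg z.
Proof. by apply: Rintegral_ge0 => c _; exact: vker_ge0. Qed.

Lemma vkers_ge0 z : 0 <= vkers z.
Proof. by rewrite addr_ge0 ?vker_ge0 ?vavg_ge0. Qed.

Lemma measurable_vker : measurable_fun setT (vker : plane R -> R).
Proof.
apply: measurable_fun_ifT => //.
  by apply: measurable_and; exact: measurable_fun_ltr.
apply: measurable_funM; last by apply: measurable_fun_invr; exact: measurable_cbrt.
by apply: measurable_gam => //; exact: measurable_cbrt.
Qed.

Let shifted (u : (R * R) * R) := \1_(`[0%R, 1%R]%classic) u.2 * vker (u.1.1, u.1.2 + u.2).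

Let shifted_ge0 u : 0 <= shifted u.
Proof. by rewrite mulr_ge0 ?vker_ge0. Qed.

Let measurable_shifted :
  measurable_fun setT (shifted : plane R * measurableTypeR R -> R).
Proof.
apply: measurable_funM; first by apply: measurableT_comp => //; exact: measurable_indic.
apply: (measurableT_comp measurable_vker); apply: measurable_fun_pair.
  exact: measurableT_comp.
by apply: measurable_funD => //; exact: measurableT_comp.
Qed.

Let vavgE z : vavg z = \int[mu]_c shifted (z, c).
Proof.
rewrite /vavg Rintegral_mkcond; apply: eq_Rintegral => c _.
by rewrite /patch /shifted indicE; case: ifP => h /=; rewrite ?mul1r ?mul0r.
Qed.

Lemma measurable_vavg : measurable_fun setT (vavg : plane R -> R).
Proof.
rewrite (_ : vavg = fun z => \int[mu]_c shifted (z, c)); last by apply/funext => z; rewrite vavgE.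
exact: (measurable_Rintegral_l mu measurable_shifted).
Qed.

Lemma measurable_vkers : measurable_fun setT (vkers : plane R -> R).
Proof. by apply: measurable_funD; [exact: measurable_vker|exact: measurable_vavg]. Qed.

Lemma vker_le s x : vker (s, x) <= (cbrt s ^+ 3)^-1.
Proof.
rewrite /vker/=; case: ifP => [/andP[s0 _]|_]; last by rewrite invr_ge0 exprn_ge0// cbrt_ge0.
have r0 := cbrt_gt0 s0; rewrite /gam.
have -> : cbrt s / (cbrt s + `|x|) ^+ 3 / cbrt s = ((cbrt s + `|x|) ^+ 3)^-1.
  have h : cbrt s + `|x| != 0 by rewrite gt_eqF// ltr_pwDl.
  by field; rewrite h gt_eqF.
rewrite lef_pV2 ?posrE ?exprn_gt0// ?ltr_pwDl//.
by rewrite ler_pXn2r ?nnegrE ?addr_ge0 ?(ltW r0)// lerDl.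
Qed.

Let mu01 : mu `[0%R, 1%R]%classic = 1%E.
Proof. by rewrite lebesgue_measure_itv/= lte_fin ltr01 oppr0 adde0. Qed.

Lemma vavg_integral_unit s x : ((vavg (s, x))%:E = \int[mu]_(c in `[0%R, 1%R]) (vker (s, x + c))%:E)%E.
Proof.
have mv : measurable_fun setT (fun c : R => vker (s, x + c)).
  apply: (measurableT_comp measurable_vker); apply: measurable_fun_pair => //.
  exact: measurable_funD.
rewrite /vavg Rintegral_fineK//.
set a := (cbrt s ^+ 3)^-1.
apply: (le_integrable_R (g := cst a)).
- exact: measurable_itv.
- exact: measurable_funTS.
- by move=> c _; rewrite ger0_norm ?vker_ge0 ?vker_le.
- apply/integrableP; split; first by apply/measurable_EFinP; exact: measurable_cst.
  have -> : (\int[mu]_(c in `[0%R, 1%R]) `|(EFin \o cst a) c| =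
    \int[mu]_(c in `[0%R, 1%R]) cst `|a%:E| c)%E by [].
  rewrite integral_cst//.
  by rewrite [X in (_ * X)%E](_ : _ = 1%E) ?mule1 ?ltry//; exact: mu01.
Qed.

Lemma vavg_integral_line s x : ((vavg (s, x))%:E = \int[mu]_c (shifted ((s, x), c))%:E)%E.
Proof.
rewrite vavg_integral_unit integral_mkcond; apply: eq_integral => c _.
by rewrite /patch /shifted indicE; case: ifP => h /=; rewrite ?mul1r ?mul0r.
Qed.

Lemma vker_weight s y :
  (\int[mu]_x (wgt x * vker (s, x - y))%:E <= (4 * pi * (1 + cbrt T ^+ 2) * sing T s * wgt y)%:E)%E.
Proof.
have [/andP[s0 sT]|h] := boolP ((0 < s) && (s < T)); last first.
  rewrite integral0_eq; last by move=> x _; rewrite /vker/= (negbTE h) mulr0.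
  by rewrite sing_out// mulr0 mul0r.
have r0 := cbrt_gt0 s0; have ri : 0 <= (cbrt s)^-1 by rewrite invr_ge0 ltW.
have m1 : measurable_fun setT (fun x : R => wgt x * gam (cbrt s) (x - y)).
  apply: measurable_funM; first exact: measurable_wgt.
  by apply: measurable_gam => //; exact: measurable_funB.
have n1 x : 0 <= wgt x * gam (cbrt s) (x - y) by rewrite mulr_ge0 ?wgt_ge0 ?gam_ge0 ?ltW.
rewrite /vker/= s0 sT/=; under eq_integral do rewrite mulrA mulrC.
move: (ge0_integralMl mu ri n1 m1) => /= ->; rewrite singE//.
have h := integral_wgt_gam y r0 (cbrt_le (ltW s0) (ltW sT)).
apply: (@le_trans _ _ ((cbrt s)^-1%:E * (4 * pi * (1 + cbrt T ^+ 2) / cbrt s * wgt y)%:E)%E).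
  by apply: lee_wpmul2l; rewrite ?lee_fin.
rewrite -EFinM lee_fin.
rewrite le_eqVlt; apply/orP; left; apply/eqP; field.
by rewrite gt_eqF.
Qed.

Lemma vker_mass s y : (\int[mu]_x (vker (s, x - y))%:E <= (pi * sing T s)%:E)%E.
Proof.
have [/andP[s0 sT]|h] := boolP ((0 < s) && (s < T)); last first.
  rewrite integral0_eq; last by move=> x _; rewrite /vker/= (negbTE h).
  by rewrite sing_out// mulr0.
have r0 := cbrt_gt0 s0; have ri : 0 <= (cbrt s)^-1 by rewrite invr_ge0 ltW.
have m1 : measurable_fun setT (fun x : R => gam (cbrt s) (x - y)).
  by apply: measurable_gam => //; exact: measurable_funB.
have n1 (x : R) : 0 <= gam (cbrt s) (x - y) by rewrite gam_ge0 ?ltW.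
rewrite /vker/= s0 sT/=; under eq_integral do rewrite mulrC.
move: (ge0_integralMl mu ri n1 m1) => /= ->; rewrite singE//.
apply: (@le_trans _ _ ((cbrt s)^-1%:E * (pi / cbrt s)%:E)%E).
  by apply: lee_wpmul2l; rewrite ?lee_fin//; exact: integral_gam_shiftr.
rewrite -EFinM lee_fin.
rewrite le_eqVlt; apply/orP; left; apply/eqP; field.
by rewrite gt_eqF.
Qed.

(** A weight [k] that varies slowly on unit scale can be translated together with the kernel,
    which reduces the claim to [vker]. *)
Lemma vavg_integral (k : R -> R) (A B s y : R) : measurable_fun setT k ->
  (forall x, 0 <= k x) -> 0 <= A -> (forall x c, 0 <= c -> c <= 1 -> k x <= A * k (x + c)) ->
  (\int[mu]_x (k x * vker (s, x - y))%:E <= B%:E)%E ->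
  (\int[mu]_x (k x * vavg (s, x - y))%:E <= (A * B)%:E)%E.
Proof.
move=> mk k0 A0 kA hB.
have B0 : 0 <= B.
  rewrite -lee_fin; apply: le_trans hB; apply: integral_ge0 => x _.
  by rewrite lee_fin mulr_ge0 ?vker_ge0.
pose F (z : R * R) := k z.1 * shifted ((s, z.1 - y), z.2).
have F0 z : 0 <= F z by rewrite mulr_ge0.
have mF : measurable_fun setT (F : plane R -> R).
  apply: measurable_funM; first exact: measurableT_comp.
  apply: (measurableT_comp measurable_shifted); apply: measurable_fun_pair => //.
  by apply: measurable_fun_pair => //; exact: measurable_funB.
have ms x : measurable_fun setT (fun c : R => shifted ((s, x - y), c)).
  exact: (measurableT_comp measurable_shifted (@pair1_measurable _ _ _ _ (s, x - y))).
rewrite (_ : (\int[mu]_x (k x * vavg (s, x - y))%:E = \int[mu]_x \int[mu]_c (F (x, c))%:E)%E); last first.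
  apply: eq_integral => x _; rewrite EFinM vavg_integral_line.
  by move: (ge0_integralMl mu (k0 x) (fun c => shifted_ge0 ((s, x - y), c)) (ms x)) => /= <-.
rewrite (tonelli_swap mu mu mF F0).
apply: (@le_trans _ _ (\int[mu]_c (A * B * \1_(`[0%R, 1%R]%classic) c)%:E)%E); last first.
  have AB : 0 <= A * B by rewrite mulr_ge0.
  have mi : measurable_fun setT (fun c : R => \1_(`[0%R, 1%R]%classic) c : R) by exact: measurable_indic.
  have n1 (c : R) : 0 <= \1_(`[0%R, 1%R]%classic) c :> R by rewrite indicE.
  have -> := ge0_integralMl mu AB n1 mi; rewrite integral_indic// setIT.
  by rewrite [X in (_ * X)%E](_ : _ = 1%E) ?mule1//; exact: mu01.
apply: ge0_le_integral => //.
- by move=> c _; apply: integral_ge0 => x _; rewrite lee_fin.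
- exact: (measurable_tonelli_r mu mF F0).
- by apply/measurable_EFinP; apply: measurable_funM => //; exact: measurable_indic.
move=> c _; rewrite indicE; have [|] := boolP (c \in _); last first.
  move=> h; rewrite mulr0 integral0_eq// => x _.
  by rewrite /F/shifted/= indicE (negbTE h) mul0r mulr0.
rewrite inE/= in_itv/= => /andP[c0 c1]; rewrite mulr1.
have mk2 : measurable_fun setT (fun x : R => k x * vker (s, x - y)).
  apply: measurable_funM => //; apply: (measurableT_comp measurable_vker).
  by apply: measurable_fun_pair => //; exact: measurable_funB.
have nk2 x : 0 <= k x * vker (s, x - y) by rewrite mulr_ge0 ?vker_ge0.
apply: (@le_trans _ _ (A%:E * \int[mu]_x (k x * vker (s, x - y))%:E)%E); last first.
  by rewrite EFinM lee_wpmul2l ?lee_fin.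
move: (ge0_integralMl mu A0 nk2 mk2) => /= <-.
rewrite -(ge0_integral_shift c (f := fun x => (A * (k x * vker (s, x - y)))%:E)); last 2 first.
- by apply/measurable_EFinP; exact: measurable_funM.
- by move=> x; rewrite lee_fin mulr_ge0.
apply: le_ge0_integral => //.
- exact: (measurableT_comp mF (@pair2_measurable _ _ R R c)).
- have msh : measurable_fun setT (fun x : R => x + c) by exact: measurable_funD.
  by apply: measurable_funM => //; apply: (measurableT_comp mk2 msh).
move=> x; rewrite /F/shifted/= indicE mem_set ?mul1r/=; last by rewrite in_itv/= c0.
rewrite (_ : x + c - y = x - y + c); last by ring.
by rewrite mulrA ler_wpM2r ?vker_ge0// kA.
Qed.

Lemma vkers_split (k : R -> R) s y : measurable_fun setT k -> (forall x, 0 <= k x) ->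
  (\int[mu]_x (k x * vkers (s, x - y))%:E = \int[mu]_x (k x * vker (s, x - y))%:E +
     \int[mu]_x (k x * vavg (s, x - y))%:E)%E.
Proof.
move=> mk k0; under eq_integral do rewrite mulrDr.
have mp : measurable_fun setT (fun x : R => (s, x - y)).
  by apply: measurable_fun_pair => //; exact: measurable_funB.
apply: (ge0_integralDr mu).
- by move=> x; rewrite mulr_ge0 ?vker_ge0.
- by move=> x; rewrite mulr_ge0 ?vavg_ge0.
- by apply: measurable_funM => //; exact: (measurableT_comp measurable_vker).
- by apply: measurable_funM => //; exact: (measurableT_comp measurable_vavg).
Qed.

Lemma vkers_weight s y :
  (\int[mu]_x (wgt x * vkers (s, x - y))%:E <= (36 * pi * (1 + cbrt T ^+ 2) * sing T s * wgt y)%:E)%E.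
Proof.
rewrite vkers_split; [|exact: measurable_wgt|exact: wgt_ge0].
apply: (le_trans (leeD (vker_weight s y) (vavg_integral (A := 8) _ _ _ _ (vker_weight s y)))) => //.
- exact: measurable_wgt.
- exact: wgt_ge0.
- move=> x c c0 c1; apply: (le_trans (wgt_shift_le x c)).
  rewrite ler_wpM2r ?wgt_ge0// ger0_norm//.
  rewrite (_ : 8 = 2 ^+ 3); last by ring.
  by rewrite ler_pXn2r ?nnegrE ?addr_ge0//; lra.
rewrite -EFinD lee_fin le_eqVlt; apply/orP; left; apply/eqP; ring.
Qed.

Lemma vkers_mass s y : (\int[mu]_x (vkers (s, x - y))%:E <= (2 * pi * sing T s)%:E)%E.
Proof.
have c1 : measurable_fun setT (fun _ : R => 1 : R) by exact: measurable_cst.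
have h : (\int[mu]_x (1 * vker (s, x - y))%:E <= (pi * sing T s)%:E)%E.
  by under eq_integral do rewrite mul1r; exact: vker_mass.
have := @vkers_split (fun=> 1) s y c1 (fun _ => ler01).
under eq_integral do rewrite mul1r; move=> ->.
apply: (le_trans (leeD h (vavg_integral (A := 1) c1 _ _ _ h))) => //.
  by move=> *; rewrite mul1r.
by rewrite -EFinD lee_fin le_eqVlt; apply/orP; left; apply/eqP; ring.
Qed.

End volterra_kernel.

(** * Local square integrability of solutions *)

Section local_square_integrability.
Context (R : realType) (eta : R) (heta : 0 < eta).
Local Notation mu := (@lebesgue_measure R).
Local Notation mu2 := (leb2 R).
Local Notation Gc := (Gc eta).
Implicit Types (v : R -> R -> R) (t x y z s T : R).

Definition strip_sq T v (w : R * R) := if (0 < w.1) && (w.1 < T) then v w.1 w.2 ^+ 2 else 0.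

Lemma strip_sq_ge0 T v w : 0 <= strip_sq T v w.
Proof. by rewrite /strip_sq; case: ifP => // _; exact: sqr_ge0. Qed.

Lemma measurable_on_strip T (g : R * R -> R) :
  measurable_fun (`]0, T[%classic `*` [set: R]) (g : plane R -> R) ->
  measurable_fun setT ((fun w => if (0 < w.1) && (w.1 < T) then g w else 0) :
     plane R -> R).
Proof.
move=> mg.
have mD : measurable (`]0, T[%classic `*` [set: R] : set (plane R)).
  by apply: measurableX => //; exact: measurable_itv.
rewrite (_ : (fun w => _) = g \_ (`]0, T[ `*` [set: R])); first exact/(measurable_restrictT _ mD).
apply/funext => w; rewrite /patch; case: ifPn => h.
  by rewrite mem_set//; split=> //=; rewrite in_itv.
by rewrite memNset// => -[/= h1 _]; rewrite in_itv/= (negbTE h) in h1.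
Qed.

Lemma measurable_strip_sq T v :
  measurable_fun (`]0, T[ `*` [set: R]) (fun z : R * R => v z.1 z.2) ->
  measurable_fun setT (strip_sq T v : plane R -> R).
Proof.
move=> mv; apply: (@measurable_on_strip T (fun w => v w.1 w.2 ^+ 2)).
exact: (measurable_funX 2 mv).
Qed.

Lemma wgt_le_tail z : 0 < `|z| -> wgt z <= (`|z| ^+ 3)^-1.
Proof.
move=> z0; rewrite /wgt lef_pV2 ?posrE ?exprn_gt0// ?ltr_pwDl//.
by rewrite ler_pXn2r ?nnegrE ?addr_ge0// lerDr.
Qed.

(** The derivative of the kernel decays exactly like the weight, so absolute convergence of
    the Duhamel integral at [x] controls the weighted integral of [v^2] away from [x]; two
    distant points together control it everywhere. *)
Lemma strip_sq_weight_finite t1 T v : 0 < t1 -> t1 < T ->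
  measurable_fun (`]0, T[ `*` [set: R]) (fun z : R * R => v z.1 z.2) ->
  {ae mu, forall t, t \in `]0, T[ -> {ae mu, forall x, duhamel_cvg eta v t x}} ->
  (\int[mu2]_w (wgt w.2 * strip_sq t1 v w)%:E < +oo)%E.
Proof.
move=> t10 t1T mv hcv.
have [t [/andP[t1t tT] ht]] := ae_exists hcv t1T.
have t0 : 0 < t by exact: lt_trans t1t.
have hx : {ae mu, forall x, duhamel_cvg eta v t x} by apply: ht; rewrite in_itv/= t0.
have s0 : 0 < t - t1 by rewrite subr_gt0.
have sT : t - t1 <= T by rewrite (le_trans _ (ltW tT))// gerBl ltW.
have [Z [c c0 [Z0 hZ]]] := kernel_tail_lower heta s0 sT.
have [x1 [/andP[x10 x11] cv1]] := ae_exists hx (ltr01 : 0 < 1 :> R).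
(* No point is within distance [Z] of both [x1] and [x2]. *)
have [x2 [/andP[x20 x21] cv2]] : exists x, 2 * Z + 1 < x < 2 * Z + 2 /\ duhamel_cvg eta v t x.
  by apply: ae_exists => //; rewrite ltrD2l ltr1n.
have ms := measurable_strip_sq mv.
have f0 w : w.1 <= 0 -> strip_sq T v w = 0 by move=> w0; rewrite /strip_sq ltNge w0.
have fv w : 0 < w.1 -> w.1 < t -> strip_sq T v w = v w.1 w.2 ^+ 2.
  by move=> w0 wt; rewrite /strip_sq w0 (lt_trans wt).
have i1 := (duhamel_cvgE eta f0 fv x1).1 cv1; have i2 := (duhamel_cvgE eta f0 fv x2).1 cv2.
pose A x := (1 + `|x|) ^+ 3 * (pi / c).
have A0 x : 0 <= A x by rewrite mulr_ge0 ?exprn_ge0 ?addr_ge0 ?divr_ge0 ?pi_ge0 ?(ltW c0).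
pose H x w := A x * `|Gc (t - w.1, x - w.2) * strip_sq T v w|.
have H0 x w : 0 <= H x w by rewrite mulr_ge0.
have mH x : measurable_fun setT (H x : plane R -> R).
  apply: measurable_funM => //; apply: measurableT_comp => //.
  exact: (measurable_duh_arg heta (t, x)).
have iH x : mu2.-integrable setT (EFin \o (fun w => Gc (t - w.1, x - w.2) * strip_sq T v w)) ->
    (\int[mu2]_w (H x w)%:E < +oo)%E.
  move=> /integrable_norm/(integrable_RZ (A x) measurableT)/integrableR_ltyE.
  apply: le_lt_trans; apply: le_ge0_integral => //; first by apply: measurableT_comp => //; exact: mH.
  by move=> w; rewrite /H ler_norm.
have mw : measurable_fun setT ((fun w => wgt w.2 * strip_sq t1 v w) : plane R -> R).
  apply: measurable_funM; first exact: measurable_wgt.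
  apply: measurable_strip_sq; apply: measurable_funS mv.
    by apply: measurableX => //; exact: measurable_itv.
  move=> w [/= + _]; rewrite in_itv/= => /andP[w0 wt]; split=> //=.
  by rewrite in_itv/= w0 (lt_trans wt).
apply: (@le_lt_trans _ _ (\int[mu2]_w (H x1 w + H x2 w)%:E)%E); last first.
  move: (ge0_integralDr mu2 (H0 x1) (H0 x2) (mH x1) (mH x2)) => /= ->.
  by rewrite lte_add_pinfty// iH.
apply: le_ge0_integral => //.
- by move=> w; rewrite mulr_ge0 ?wgt_ge0 ?strip_sq_ge0.
- by apply: measurable_funD; exact: mH.
move=> w; rewrite {1}/strip_sq; case: ifPn => [/andP[w0 wt1]|_]; last by rewrite mulr0 addr_ge0.
have wt : w.1 < t by exact: lt_trans t1t.
have key x : Z <= `|x - w.2| -> wgt w.2 * v w.1 w.2 ^+ 2 <= H x w.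
  move=> hz; have z0 : 0 < `|x - w.2| by exact: lt_le_trans hz.
  have w1 : t - t1 <= t - w.1 by rewrite lerD2l lerN2 ltW.
  have w2 : t - w.1 <= T by rewrite (le_trans _ (ltW tT))// gerBl ltW.
  have hlow := hZ _ _ w1 w2 hz.
  rewrite /H fv// GcE ?subr_gt0// dxKernel_As ?subr_gt0// normrM normrN normrM.
  rewrite (ger0_norm (sqr_ge0 _)) [`|pi^-1|]ger0_norm ?invr_ge0 ?pi_ge0//.
  rewrite [leRHS]mulrA; apply: ler_wpM2r; first exact: sqr_ge0.
  apply: (le_trans (wgt_shift_le w.2 (- x))); rewrite normrN /A -mulrA.
  apply: ler_wpM2l; first by rewrite exprn_ge0 ?addr_ge0.
  apply: (@le_trans _ _ (`|x - w.2| ^+ 3)^-1).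
    by rewrite distrC; apply: wgt_le_tail; rewrite distrC.
  rewrite mulrA (mulrC pi) -(mulrA c^-1) divff ?gt_eqF ?pi_gt0// mulr1.
  by rewrite (mulrC c^-1) ler_pdivlMr// mulrC ler_pdivrMr ?exprn_gt0// mulrC.
have [h|h] := leP Z `|x1 - w.2|; first by rewrite (le_trans (key x1 h))// lerDl.
rewrite (le_trans (key x2 _)) ?lerDr//.
move: h; rewrite ltr_norml => /andP[h1 h2].
by rewrite (le_trans _ (ler_norm _))//; clear -h1 h2 x20 x11; lra.
Qed.

End local_square_integrability.

(** * Restarting the equation *)

Section restart.
Context (R : realType) (eta : R) (heta : 0 < eta) (T : R) (T0 : 0 < T).
Local Notation mu := (@lebesgue_measure R).
Local Notation mu2 := (leb2 R).
Local Notation K := (Defs.Kernel eta).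
Local Notation G := (dxKernel eta).
Local Notation Gc := (Gc eta).
Local Notation Kc := (Kc eta).
Local Notation duh := (duh eta).
Context (C : R) (C1 : 1 <= C) (hC : forall t x, 0 < t -> t <= T ->
    `|K t x| <= C * pois (cbrt t) x /\ `|G t x| <= C * gam (cbrt t) x).
Context (p : \bar R) (p1 : (1 <= p)%E) (d : R) (d0 : 0 < d).
Context (u0 : R -> R) (mu0 : measurable_fun setT u0)
  (Nu0 : ('N[mu]_p[EFin \o u0] <= d%:E)%E).
Local Notation heat := (heat eta u0).
Context (f : R * R -> R) (mf : measurable_fun setT (f : plane R -> R))
  (f0 : forall w, 0 <= f w) (fsupp : forall w, ~~ ((0 < w.1) && (w.1 < T)) -> f w = 0).
Implicit Types (t x y z s r : R) (w : R * R).

Let C0 : 0 < C. Proof. exact: lt_le_trans C1. Qed.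

Definition kernel_diff s x1 x2 y := K s (x1 - y) - K s (x2 - y).

Lemma kernel_diff_measurable s x1 x2 : 0 < s -> measurable_fun setT (kernel_diff s x1 x2).
Proof.
move=> s0; have mK := measurable_Kernel heta s0.
have m1 : measurable_fun setT (fun y : R => x1 - y) by exact: measurable_funB.
have m2 : measurable_fun setT (fun y : R => x2 - y) by exact: measurable_funB.
by apply: measurable_funB; [exact: (measurableT_comp mK m1)|exact: (measurableT_comp mK m2)].
Qed.

Lemma gam_le_wgt r z : 0 < r -> gam r z <= r * (1 + r^-1) ^+ 3 * wgt z.
Proof.
move=> r0; rewrite /gam /wgt -mulrA ler_wpM2l ?(ltW r0)//.
rewrite ler_pdivlMr ?exprn_gt0 ?ltr_pwDl// mulrC ler_pdivrMr ?exprn_gt0 ?ltr_pwDl//.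
rewrite -exprMn ler_pXn2r ?nnegrE ?mulr_ge0 ?addr_ge0 ?invr_ge0 ?(ltW r0)//.
rewrite mulrDl mul1r mulrDr mulVf ?gt_eqF//.
have : 0 <= r^-1 * `|z| by rewrite mulr_ge0 ?invr_ge0 ?(ltW r0).
by move: (`|z|) (r^-1 * `|z|) => a b; lra.
Qed.

(** By the mean value theorem, a difference of two translates of [K] inherits the decay of its
    derivative. *)
Lemma kernel_diff_le s x1 x2 : 0 < s -> s <= T -> exists2 c : R, 0 <= c &
  forall y, `|kernel_diff s x1 x2 y| <= c * wgt y.
Proof.
move=> s0 sT; have r0 := cbrt_gt0 s0; set r := cbrt s in r0.
pose m := `|x1| + `|x2|.
pose c := C * (r * (1 + r^-1) ^+ 3) * (1 + m) ^+ 3 * `|x1 - x2|.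
have r3 : 0 <= r * (1 + r^-1) ^+ 3.
  by rewrite mulr_ge0 ?exprn_ge0 ?addr_ge0 ?invr_ge0 ?(ltW r0).
have m0 : 0 <= m by rewrite addr_ge0.
have c0 : 0 <= c.
  apply: mulr_ge0 => //; apply: mulr_ge0; last by rewrite exprn_ge0 ?addr_ge0.
  by apply: mulr_ge0 => //; exact: ltW.
exists c => // y.
have mvt a b : a <= b -> exists2 xi, a <= xi <= b & `|K s b - K s a| = `|G s xi| * `|b - a|.
  move=> ab.
  have cK : {within `[a, b], continuous (K s)}.
    apply: continuous_subspaceT => z; apply: differentiable_continuous.
    by apply/derivable1_diffP; case: (is_derive_Kernel' heta z s0).
  have [xi] := MVT_segment ab (fun z _ => is_derive_Kernel' heta z s0) cK.
  by rewrite in_itv/= => xiab ->; exists xi => //; rewrite normrM.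
have : exists2 xi, `|xi + y| <= m & `|kernel_diff s x1 x2 y| = `|G s xi| * `|x1 - x2|.
  have bd xi a b : a - y <= xi -> xi <= b - y -> `|a| <= m -> `|b| <= m -> `|xi + y| <= m.
    by rewrite !ler_norml => h1 h2 /andP[h3 _] /andP[_ h4]; apply/andP; split; lra.
  have b1 : `|x1| <= m by rewrite lerDl.
  have b2 : `|x2| <= m by rewrite lerDr.
  have [x12|/ltW x12] := leP x1 x2.
    have [xi /andP[h1 h2] h] : exists2 xi, x1 - y <= xi <= x2 - y & `|K s (x2 - y) - K s (x1 - y)| = `|G s xi| * `|(x2 - y) - (x1 - y)|.
      by apply: mvt; rewrite lerD2r.
    exists xi; first exact: (bd xi x1 x2).
    rewrite /kernel_diff distrC h distrC; congr (_ * `|_|); ring.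
  have [xi /andP[h1 h2] h] : exists2 xi, x2 - y <= xi <= x1 - y & `|K s (x1 - y) - K s (x2 - y)| = `|G s xi| * `|(x1 - y) - (x2 - y)|.
    by apply: mvt; rewrite lerD2r.
  exists xi; first exact: (bd xi x2 x1).
  rewrite /kernel_diff h; congr (_ * `|_|); ring.
move=> [xi hxi ->]; have [_ hG] := hC xi s0 sT.
have -> : c * wgt y = C * (r * (1 + r^-1) ^+ 3 * ((1 + m) ^+ 3 * wgt y)) * `|x1 - x2|.
  by rewrite /c; move: ((1 + r^-1) ^+ 3) (`|x1 - x2|) => X Y; ring.
apply: ler_wpM2r => //; apply: (le_trans hG); apply: ler_wpM2l; first exact: ltW.
apply: (le_trans (gam_le_wgt xi r0)); apply: ler_wpM2l => //.
apply: (le_trans (wgt_shift_le xi (- (xi + y)))).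
rewrite normrN opprD addrA subrr add0r.
have -> : wgt (- y) = wgt y by rewrite /wgt normrN.
by rewrite ler_wpM2r ?wgt_ge0// ler_pXn2r ?nnegrE ?addr_ge0// lerD2l.
Qed.

Lemma wgt_integrable : mu.-integrable setT (EFin \o (@wgt R)).
Proof.
apply: integrableR_lty; first exact: measurable_wgt.
under eq_integral do rewrite (ger0_norm (wgt_ge0 _)).
exact: (le_lt_trans (integral_wgt_le R) (ltry _)).
Qed.

Lemma Kernel_semigroup_shift s t x y : 0 < s -> 0 < t ->
  \int[mu]_x' (K s (x - x') * K t (x' - y)) = K (s + t) (x - y).
Proof.
move=> s0 t0.
have mK := measurable_Kernel heta s0; have mKt := measurable_Kernel heta t0.
rewrite -(Kernel_semigroup heta (x - y) s0 t0).
have m1 : measurable_fun setT (fun x' : R => K s (x - x') * K t (x' - y)).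
  have a1 : measurable_fun setT (fun y : R => x - y) by exact: measurable_funB.
  have a2 : measurable_fun setT (fun z : R => z - y) by exact: measurable_funB.
  by apply: measurable_funM; [exact: (measurableT_comp mK a1)|exact: (measurableT_comp mKt a2)].
apply: (etrans (esym (Rintegral_shift y m1))); apply: eq_Rintegral => z _.
by rewrite addrK; congr (K s _ * _); ring.
Qed.

Lemma dxKernel_semigroup_shift s t x y : 0 < s -> 0 < t ->
  \int[mu]_x' (K s (x - x') * G t (x' - y)) = G (s + t) (x - y).
Proof.
move=> s0 t0.
have mK := measurable_Kernel heta s0; have mG := measurable_dxKernel heta t0.
rewrite -(dxKernel_semigroup heta (x - y) s0 t0).
have m1 : measurable_fun setT (fun x' : R => K s (x - x') * G t (x' - y)).
  have a1 : measurable_fun setT (fun y : R => x - y) by exact: measurable_funB.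
  have a2 : measurable_fun setT (fun z : R => z - y) by exact: measurable_funB.
  by apply: measurable_funM; [exact: (measurableT_comp mK a1)|exact: (measurableT_comp mG a2)].
apply: (etrans (esym (Rintegral_shift y m1))); apply: eq_Rintegral => z _.
by rewrite addrK; congr (K s _ * _); ring.
Qed.

Lemma kernel_conv_integrable s x (g : R -> R) (B : R) : 0 < s -> measurable_fun setT g ->
  (forall y, `|g y| <= B) -> mu.-integrable setT (EFin \o (fun y => K s (x - y) * g y)).
Proof.
move=> s0 mg gB.
have mK := measurable_Kernel heta s0.
have a1 : measurable_fun setT (fun y : R => x - y) by exact: measurable_funB.
have ki : mu.-integrable setT (EFin \o (fun y => K s (x - y))).
  exact: (integrable_subl x (Kernel_integrable heta s0)).
apply: (@le_integrable_R _ _ _ mu setT _ (fun y => B * `|K s (x - y)|)) => //.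
- exact: (measurable_funM (measurableT_comp mK a1) mg).
- by move=> y _; rewrite normrM mulrC ler_wpM2r.
- by apply: integrable_RZ => //; exact: integrable_norm ki.
Qed.

Lemma kernel_diff_Kernel s t x1 x2 y : 0 < s -> 0 < t ->
  \int[mu]_x' (kernel_diff s x1 x2 x' * K t (x' - y)) = K (s + t) (x1 - y) - K (s + t) (x2 - y).
Proof.
move=> s0 t0; have [B hB] := Kernel_bounded heta t0.
have mg : measurable_fun setT (fun x' : R => K t (x' - y)).
  have a2 : measurable_fun setT (fun z : R => z - y) by exact: measurable_funB.
  exact: (measurableT_comp (measurable_Kernel heta t0) a2).
have i1 := kernel_conv_integrable x1 s0 mg (fun x' => hB (x' - y)).
have i2 := kernel_conv_integrable x2 s0 mg (fun x' => hB (x' - y)).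
rewrite -!Kernel_semigroup_shift// -(RintegralB measurableT i1 i2).
by apply: eq_Rintegral => z _; rewrite /kernel_diff mulrBl.
Qed.

Lemma kernel_diff_dxKernel s t x1 x2 y : 0 < s -> 0 < t ->
  \int[mu]_x' (kernel_diff s x1 x2 x' * G t (x' - y)) = G (s + t) (x1 - y) - G (s + t) (x2 - y).
Proof.
move=> s0 t0; have [B hB] := dxKernel_bounded heta t0.
have mg : measurable_fun setT (fun x' : R => G t (x' - y)).
  have a2 : measurable_fun setT (fun z : R => z - y) by exact: measurable_funB.
  exact: (measurableT_comp (measurable_dxKernel heta t0) a2).
have i1 := kernel_conv_integrable x1 s0 mg (fun x' => hB (x' - y)).
have i2 := kernel_conv_integrable x2 s0 mg (fun x' => hB (x' - y)).
rewrite -!dxKernel_semigroup_shift// -(RintegralB measurableT i1 i2).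
by apply: eq_Rintegral => z _; rewrite /kernel_diff mulrBl.
Qed.

Lemma heat_integrable t x : 0 < t -> t < T ->
  mu.-integrable setT (EFin \o (fun y => K t (x - y) * u0 y)).
Proof.
move=> t0 tT; have mK := measurable_Kernel heta t0.
have a1 : measurable_fun setT (fun y : R => x - y) by exact: measurable_funB.
apply: (@le_integrable_R _ _ _ mu setT _ (fun y => C * (pois (cbrt t) (x - y) * `|u0 y|))) => //.
- exact: (measurable_funM (measurableT_comp mK a1) mu0).
- move=> y _; rewrite normrM mulrA ler_wpM2r//.
  by have [] := hC (x - y) t0 (ltW tT).
- by apply: integrable_RZ => //; exact: (pois_f_integrable mu0 p1 d0 Nu0).
Qed.

Lemma restart_heat s t x1 x2 : 0 < s -> 0 < t -> s + t < T ->
  mu.-integrable setT (EFin \o (fun x' => kernel_diff s x1 x2 x' * heat (t, x'))) /\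
  \int[mu]_x' (kernel_diff s x1 x2 x' * heat (t, x')) = heat (s + t, x1) - heat (s + t, x2).
Proof.
move=> s0 t0 stT; have st0 := addr_gt0 s0 t0.
have sT : s <= T by rewrite ltW// (le_lt_trans _ stT)// lerDl ltW.
have tT : t < T by rewrite (le_lt_trans _ stT)// lerDr ltW.
have [c c0 hc] := kernel_diff_le x1 x2 s0 sT.
have mk := kernel_diff_measurable x1 x2 s0.
have mh : measurable_fun setT (fun x' : R => heat (t, x')).
  exact: (measurableT_comp (measurable_heat heta mu0) (@pair1_measurable _ _ R R t)).
pose B := d * (pi * cbrt t + 1) / cbrt t.
have hB x' : poisson_mean u0 t x' <= B by exact: (poisson_mean_le mu0 p1 d0 Nu0).
split.
  apply: (@le_integrable_R _ _ _ mu setT _ (fun x' => c * (C * B) * wgt x')) => //.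
  - exact: measurable_funM.
  - move=> x' _; rewrite normrM mulrAC; apply: ler_pM => //.
    apply: (le_trans (heat_le heta C1 hC p1 d0 mu0 Nu0 (z := (t, x')) t0 tT)).
    by rewrite ler_wpM2l ?(ltW C0).
  - by apply: integrable_RZ => //; exact: wgt_integrable.
pose F (w : R * R) := kernel_diff s x1 x2 w.1 * (Kc (t, w.1 - w.2) * u0 w.2).
have mKc := measurable_Kc heta.
have mF : measurable_fun setT (F : plane R -> R).
  apply: measurable_funM; first exact: (measurableT_comp mk).
  apply: measurable_funM; last exact: (measurableT_comp mu0).
  apply: (measurableT_comp mKc); apply: measurable_fun_pair => //.
  exact: measurable_funB.
have Fi : (leb2 R).-integrable setT (EFin \o F).
  apply: integrableR_lty => //.
  have mnF : measurable_fun setT ((fun w => `|F w|) : plane R -> R).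
    exact: measurableT_comp.
  have h0 w : 0 <= `|F w| by exact: normr_ge0.
  rewrite (tonelli_l mu mu mnF h0).
  apply: (@le_lt_trans _ _ (\int[mu]_x' (c * (C * B) * wgt x')%:E)%E); last first.
    have cCB : 0 <= c * (C * B).
      rewrite mulr_ge0// mulr_ge0 ?(ltW C0)// (le_trans _ (hB 0))//; exact: poisson_mean_ge0.
    have -> := ge0_integralMl mu cCB (@wgt_ge0 R) (measurable_wgt (@measurable_id _ _ setT)).
    rewrite (le_lt_trans (lee_wpmul2l _ (integral_wgt_le R))) ?lee_fin//; exact: ltry.
  have cw x' : 0 <= c * wgt x' by rewrite mulr_ge0 ?wgt_ge0.
  apply: ge0_le_integral => //.
  - by move=> x' _; apply: integral_ge0 => y _; rewrite lee_fin.
  - exact: (measurable_tonelli mu mnF h0).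
  - by apply/measurable_EFinP; apply: measurable_funM => //; exact: measurable_wgt.
  move=> x' _.
  have mpf := measurable_pois_f mu0 (cbrt t) x'.
  apply: (@le_trans _ _ (\int[mu]_y (c * wgt x' * C * (pois (cbrt t) (x' - y) * `|u0 y|))%:E)%E).
    apply: le_ge0_integral => //.
    - exact: (measurableT_comp mnF (@pair1_measurable _ _ R R x')).
    - exact: measurable_funM.
    - move=> y; rewrite /F/= KcE// !normrM -mulrA.
      apply: ler_pM; [exact: normr_ge0|by rewrite mulr_ge0|exact: hc|].
      rewrite mulrA ler_wpM2r//; by have [] := hC (x' - y) t0 (ltW tT).
  have cwC : 0 <= c * wgt x' * C by rewrite mulr_ge0 ?(ltW C0).
  have -> := ge0_integralMl mu cwC (pois_f_ge0 u0 t x') mpf.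
  rewrite -(poisson_meanE mu0 p1 d0 Nu0)// -EFinM lee_fin.
  by rewrite (_ : c * (C * B) * wgt x' = c * wgt x' * C * B); [exact: ler_wpM2l|ring].
have E1 : \int[mu]_x' (kernel_diff s x1 x2 x' * heat (t, x')) = \int[mu]_x' \int[mu]_y F (x', y).
  apply: eq_Rintegral => x' _; rewrite /heat/=.
  have ki := heat_integrable x' t0 tT.
  have Ek : \int[mu]_y (Kc (t, x' - y) * u0 y) = \int[mu]_y (K t (x' - y) * u0 y).
    by apply: eq_Rintegral => y _; rewrite KcE.
  rewrite Ek -(RintegralZl _ measurableT ki).
  by apply: eq_Rintegral => y _; rewrite /F/= KcE.
rewrite E1 (Rfubini Fi) (heatE eta u0 x1 st0) (heatE eta u0 x2 st0) /Defs.conv.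
have k1 := heat_integrable x1 st0 stT; have k2 := heat_integrable x2 st0 stT.
rewrite -(RintegralB measurableT k1 k2); apply: eq_Rintegral => y _.
have [Bt hBt] := Kernel_bounded heta t0.
have mg : measurable_fun setT (fun x' : R => K t (x' - y)).
  have a2 : measurable_fun setT (fun z : R => z - y) by exact: measurable_funB.
  exact: (measurableT_comp (measurable_Kernel heta t0) a2).
have i1 := kernel_conv_integrable x1 s0 mg (fun x' => hBt (x' - y)).
have i2 := kernel_conv_integrable x2 s0 mg (fun x' => hBt (x' - y)).
have i12 : mu.-integrable setT (EFin \o (fun x' => kernel_diff s x1 x2 x' * K t (x' - y))).
  have := integrable_RB measurableT i1 i2; apply: eq_integrable => // z _ /=.
  by congr (_%:E); exact: esym (mulrBl _ _ _).
rewrite -mulrBl -kernel_diff_Kernel// mulrC -(RintegralZl _ measurableT i12).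
by apply: eq_Rintegral => x' _; rewrite /F/= KcE//; ring.
Qed.

End restart.

Section integrable_partial.
Context d1 d2 (T1 : measurableType d1) (T2 : measurableType d2) (R : realType).
Variable m1 : {sigma_finite_measure set T1 -> \bar R}.
Variable m2 : {sigma_finite_measure set T2 -> \bar R}.

Lemma integrable_Rintegral_l (f : T1 * T2 -> R) : (m1 \x m2)%E.-integrable setT (EFin \o f) ->
  m1.-integrable setT (EFin \o (fun x => \int[m2]_y f (x, y))).
Proof.
move=> fi; have mf : measurable_fun setT f := measurable_integrable fi.
have mI := measurable_Rintegral_l m2 mf.
have mn : measurable_fun setT (fun z => `|f z|) by exact: measurableT_comp.
have n0 z : 0 <= `|f z| by exact: normr_ge0.
apply: (integrableR_lty mI).
apply: (@le_lt_trans _ _ (\int[m1]_x \int[m2]_y `|f (x, y)|%:E)%E).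
  apply: ge0_le_integral => //.
  - by apply/measurable_EFinP; exact: measurableT_comp.
  - exact: (measurable_tonelli m2 mn n0).
  - move=> x _; apply: abs_Rintegral_le => //.
    exact: (measurableT_comp mf (@pair1_measurable _ _ T1 T2 x)).
rewrite -(tonelli_l m1 m2 mn n0); exact: integrableR_ltyE.
Qed.

End integrable_partial.

Section volterra_measurable.
Context (R : realType).
Local Notation mu := (@lebesgue_measure R).
Local Notation mu2 := (leb2 R).

Lemma volterra_ge0 (q f : R * R -> R) z : (forall z, 0 <= q z) -> (forall z, 0 <= f z) ->
  (0 <= volterra q f z)%E.
Proof. by move=> q0 f0; apply: integral_ge0 => w _; rewrite lee_fin mulr_ge0. Qed.

Lemma measurable_volterra (q f : R * R -> R) :
  measurable_fun setT (q : plane R -> R) -> (forall z, 0 <= q z) ->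
  measurable_fun setT (f : plane R -> R) -> (forall z, 0 <= f z) ->
  measurable_fun setT (volterra q f : plane R -> \bar R).
Proof.
move=> mq q0 mf f0; have msq := measurable_shift_arg mq.
pose F (u : (R * R) * (R * R)) := q (u.1.1 - u.2.1, u.1.2 - u.2.2) * f u.2.
have mF : measurable_fun setT (F : plane R * plane R -> R).
  by apply: measurable_funM; [exact: msq|exact: (measurableT_comp mf)].
have F0 u : 0 <= F u by apply: mulr_ge0.
exact: (measurable_tonelli mu2 mF F0).
Qed.

Lemma measurable_volterra_arg (q f : R * R -> R) z :
  measurable_fun setT (q : plane R -> R) ->
  measurable_fun setT (f : plane R -> R) ->
  measurable_fun setT ((fun w => q (z.1 - w.1, z.2 - w.2) * f w) :
    plane R -> R).
Proof.
move=> mq mf; apply: measurable_funM => //.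
exact: (measurableT_comp (measurable_shift_arg mq) (@pair1_measurable _ _ _ _ z)).
Qed.

Lemma volterraD (q1 q2 f : R * R -> R) z :
  measurable_fun setT (q1 : plane R -> R) -> (forall z, 0 <= q1 z) ->
  measurable_fun setT (q2 : plane R -> R) -> (forall z, 0 <= q2 z) ->
  measurable_fun setT (f : plane R -> R) -> (forall z, 0 <= f z) ->
  volterra (fun z => q1 z + q2 z) f z = (volterra q1 f z + volterra q2 f z)%E.
Proof.
move=> m1 n1 m2 n2 mf f0; rewrite /volterra.
under eq_integral do rewrite mulrDl.
have a1 := measurable_volterra_arg z m1 mf; have a2 := measurable_volterra_arg z m2 mf.
have b1 (w : R * R) : 0 <= q1 (z.1 - w.1, z.2 - w.2) * f w by rewrite mulr_ge0.
have b2 (w : R * R) : 0 <= q2 (z.1 - w.1, z.2 - w.2) * f w by rewrite mulr_ge0.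
exact: (ge0_integralDr mu2 b1 b2 a1 a2).
Qed.

Lemma volterraZ (c : R) (q f : R * R -> R) z : 0 <= c ->
  measurable_fun setT (q : plane R -> R) -> (forall z, 0 <= q z) ->
  measurable_fun setT (f : plane R -> R) -> (forall z, 0 <= f z) ->
  volterra (fun z => c * q z) f z = (c%:E * volterra q f z)%E.
Proof.
move=> c0 m1 n1 mf f0; rewrite /volterra.
under eq_integral do rewrite -mulrA.
have a1 := measurable_volterra_arg z m1 mf.
have b1 (w : R * R) : 0 <= q (z.1 - w.1, z.2 - w.2) * f w by rewrite mulr_ge0.
exact: (ge0_integralMl mu2 c0 b1 a1).
Qed.

Lemma volterra_average (T : R) (f : R * R -> R) t x :
  measurable_fun setT (f : plane R -> R) -> (forall z, 0 <= f z) ->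
  (\int[mu]_(c in `[0%R, 1%R]) volterra (vker T) f (t, (x + c)%R) = volterra (vavg T) f (t, x))%E.
Proof.
move=> mf f0.
pose H (u : R * (R * R)) := \1_(`[0%R, 1%R]%classic) u.1 *
   (vker T (t - u.2.1, x - u.2.2 + u.1) * f u.2).
have mH : measurable_fun setT (H : measurableTypeR R * plane R -> R).
  apply: measurable_funM; first by apply: measurableT_comp => //; exact: measurable_indic.
  apply: measurable_funM; last exact: measurableT_comp.
  apply: (measurableT_comp (measurable_vker T)); apply: measurable_fun_pair.
    by apply: measurable_funB => //; exact: measurableT_comp.
  by apply: measurable_funD => //; apply: measurable_funB => //; exact: measurableT_comp.
have H0 u : 0 <= H u by apply: mulr_ge0 => //; apply: mulr_ge0 => //; exact: vker_ge0.
transitivity (\int[mu]_c \int[mu2]_w (H (c, w))%:E)%E.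
  rewrite integral_mkcond; apply: eq_integral => c _.
  rewrite /patch; case: ifPn => hc.
    apply: eq_integral => w _; rewrite /H/= indicE hc mul1r.
    by congr ((vker T (_, _) * _)%:E); ring.
  rewrite integral0_eq// => w _.
  by rewrite /H/= indicE (negbTE hc) mul0r.
rewrite (tonelli_swap mu mu2 mH H0); apply: eq_integral => w _.
rewrite mulrC EFinM vavg_integral_unit.
have mv : measurable_fun setT (fun c : R => vker T (t - w.1, x - w.2 + c)).
  apply: (measurableT_comp (measurable_vker T)); apply: measurable_fun_pair => //.
  exact: measurable_funD.
have mi : measurable_fun setT (fun c : R => \1_(`[0%R, 1%R]%classic) c * vker T (t - w.1, x - w.2 + c) : R).
  by apply: measurable_funM => //; exact: measurable_indic.
have ni (c : R) : 0 <= \1_(`[0%R, 1%R]%classic) c * vker T (t - w.1, x - w.2 + c) :> R.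
  by rewrite mulr_ge0 ?vker_ge0.
have -> : (\int[mu]_(c in `[0%R, 1%R]) (vker T ((t, x).1 - w.1, (t, x).2 - w.2 + c))%:E =
   \int[mu]_c (\1_(`[0%R, 1%R]%classic) c * vker T (t - w.1, x - w.2 + c))%:E)%E.
  rewrite integral_mkcond; apply: eq_integral => c _.
  rewrite /patch indicE; case: ifPn => hc; first by rewrite mul1r.
  by rewrite mul0r.
rewrite -(ge0_integralMl mu (f0 w) ni mi).
by apply: eq_integral => c _; rewrite /H/=; congr (_%:E); ring.
Qed.

End volterra_measurable.

Section restart_duhamel.
Context (R : realType) (eta : R) (heta : 0 < eta) (T : R) (T0 : 0 < T).
Local Notation mu := (@lebesgue_measure R).
Local Notation mu2 := (leb2 R).
Local Notation K := (Defs.Kernel eta).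
Local Notation G := (dxKernel eta).
Local Notation Gc := (Gc eta).
Local Notation Kc := (Kc eta).
Local Notation duh := (duh eta).
Local Notation kernel_diff := (kernel_diff eta).
Context (C : R) (C1 : 1 <= C) (hC : forall t x, 0 < t -> t <= T ->
    `|K t x| <= C * pois (cbrt t) x /\ `|G t x| <= C * gam (cbrt t) x).
Context (f : R * R -> R) (mf : measurable_fun setT (f : plane R -> R))
  (f0 : forall w, 0 <= f w) (fsupp : forall w, ~~ ((0 < w.1) && (w.1 < T)) -> f w = 0).
Implicit Types (t x y z s r : R) (w : R * R).

Let C0 : 0 < C. Proof. exact: lt_le_trans C1. Qed.

Definition before t w := if w.1 < t then f w else 0.
Definition after t w := if w.1 < t then 0 else f w.

(** The finiteness hypothesis is what Fubini's theorem requires.  It yields convergence of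
    [duh f (t, x')] for almost every [x'] only, hence the detour through a function [D] equal
    to the integrand almost everywhere. *)
Lemma restart_duh s t x1 x2 : 0 < s -> 0 < t -> s + t < T ->
  (\int[mu2]_w (sing T (t - w.1) * (wgt w.2 * f w))%:E < +oo)%E ->
  exists D : R -> R, [/\ mu.-integrable setT (EFin \o D),
    {ae mu, forall x', D x' = kernel_diff s x1 x2 x' * duh f (t, x')} &
  \int[mu]_x' D x' = \int[mu2]_w ((Gc (s + t - w.1, x1 - w.2) - Gc (s + t - w.1, x2 - w.2)) * before t w)].
Proof.
move=> s0 t0 stT fin.
have sT : s <= T by rewrite ltW// (le_lt_trans _ stT)// lerDl ltW.
have tT : t < T by rewrite (le_lt_trans _ stT)// lerDr ltW.
have [c c0 hc] := kernel_diff_le heta C1 hC x1 x2 s0 sT.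
have mk := kernel_diff_measurable heta x1 x2 s0.
pose F (u : R * (R * R)) := kernel_diff s x1 x2 u.1 * (Gc (t - u.2.1, u.1 - u.2.2) * f u.2).
have mF : measurable_fun setT (F : measurableTypeR R * plane R -> R).
  apply: measurable_funM; first exact: (measurableT_comp mk).
  apply: measurable_funM; last exact: (measurableT_comp mf).
  apply: (measurableT_comp (measurable_Gc heta)); apply: measurable_fun_pair.
    by apply: measurable_funB => //; exact: measurableT_comp.
  by apply: measurable_funB => //; exact: measurableT_comp.
pose B := c * C * (4 * pi * (1 + cbrt T ^+ 2)) * cbrt T.
have pT : 0 <= 4 * pi * (1 + cbrt T ^+ 2) :> R.
  by apply: mulr_ge0; [rewrite mulr_ge0 ?pi_ge0|rewrite addr_ge0 ?sqr_ge0].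
have B0 : 0 <= B.
  apply: mulr_ge0; last exact: cbrt_ge0.
  by apply: mulr_ge0 => //; apply: mulr_ge0 => //; exact: ltW.
have mnF : measurable_fun setT ((fun u => `|F u|) : measurableTypeR R * plane R -> R).
  exact: measurableT_comp.
have nF0 u : 0 <= `|F u| by exact: normr_ge0.
have msw : measurable_fun setT ((fun w => sing T (t - w.1) * (wgt w.2 * f w)) : plane R -> R).
  apply: measurable_funM; first by apply: measurable_sing; exact: measurable_funB.
  by apply: measurable_funM => //; exact: measurable_wgt.
have nsw w : 0 <= sing T (t - w.1) * (wgt w.2 * f w).
  by rewrite mulr_ge0 ?sing_ge0// mulr_ge0 ?wgt_ge0.
have Fi : (mu \x mu2)%E.-integrable setT (EFin \o F).
  apply: integrableR_lty => //.
  rewrite (tonelli_r mu mu2 mnF nF0).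
  apply: (@le_lt_trans _ _ (\int[mu2]_w (B * (sing T (t - w.1) * (wgt w.2 * f w)))%:E)%E); last first.
    have -> := ge0_integralMl mu2 B0 nsw msw; exact: lte_mul_pinfty.
  apply: ge0_le_integral => //.
  - by move=> w _; apply: integral_ge0 => y _; rewrite lee_fin.
  - exact: (measurable_tonelli_r mu mnF nF0).
  - by apply/measurable_EFinP; exact: measurable_funM.
  move=> w _.
  have [h|h] := boolP ((0 < w.1) && (w.1 < T)); last first.
    by rewrite fsupp// !mulr0 integral0_eq// => y _; rewrite /F/= fsupp// !mulr0 normr0.
  have [wt|tw] := ltP w.1 t; last first.
    rewrite integral0_eq; first by rewrite lee_fin mulr_ge0.
    by move=> y _; rewrite /F/= Gc0 ?subr_le0// mul0r mulr0 normr0.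
  have tw0 : 0 < t - w.1 by rewrite subr_gt0.
  have /andP[w0 wT] := h.
  have twT : t - w.1 < T by rewrite (le_lt_trans _ tT)// gerBl ltW.
  have r0 := cbrt_gt0 tw0; have rT := cbrt_le (ltW tw0) (ltW twT).
  have mg : measurable_fun setT (fun x' : R => wgt x' * gam (cbrt (t - w.1)) (x' - w.2)).
    apply: measurable_funM; first exact: measurable_wgt.
    by apply: measurable_gam => //; exact: measurable_funB.
  have ng (x' : R) : 0 <= wgt x' * gam (cbrt (t - w.1)) (x' - w.2).
    by rewrite mulr_ge0 ?wgt_ge0 ?gam_ge0 ?(ltW r0).
  have cc : 0 <= c * C * f w by rewrite !mulr_ge0 ?(ltW C0).
  apply: (@le_trans _ _ (\int[mu]_x' (c * C * f w * (wgt x' * gam (cbrt (t - w.1)) (x' - w.2)))%:E)%E).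
    apply: le_ge0_integral => //.
    - exact: (measurableT_comp mnF (@pair2_measurable _ _ R (R * R)%type w)).
    - exact: measurable_funM.
    move=> y; rewrite /F/= GcE// !normrM (ger0_norm (f0 w)).
    rewrite (_ : c * C * f w * (wgt y * gam (cbrt (t - w.1)) (y - w.2)) =
       c * wgt y * (C * gam (cbrt (t - w.1)) (y - w.2) * f w)); last by ring.
    apply: ler_pM; [exact: normr_ge0|by rewrite mulr_ge0|exact: hc|].
    by apply: ler_wpM2r => //; have [] := hC (y - w.2) tw0 (ltW twT).
  have -> := ge0_integralMl mu cc ng mg.
  apply: (@le_trans _ _ ((c * C * f w)%:E * (4 * pi * (1 + cbrt T ^+ 2) / cbrt (t - w.1) * wgt w.2)%:E)%E).
    by apply: lee_wpmul2l; rewrite ?lee_fin//; exact: integral_wgt_gam.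
  rewrite -EFinM lee_fin singE//.
  have ri : (cbrt (t - w.1))^-1 <= cbrt T * (cbrt (t - w.1) ^+ 2)^-1.
    by rewrite expr2 invfM mulrA ler_peMl ?invr_ge0 ?(ltW r0)// ler_pdivlMr// mul1r.
  rewrite [leRHS](_ : _ = c * C * f w * (4 * pi * (1 + cbrt T ^+ 2)) * wgt w.2 * (cbrt T * (cbrt (t - w.1) ^+ 2)^-1)); last first.
    by rewrite /B; move: ((cbrt (t - w.1) ^+ 2)^-1) => X; ring.
  rewrite [leLHS](_ : _ = c * C * f w * (4 * pi * (1 + cbrt T ^+ 2)) * wgt w.2 * (cbrt (t - w.1))^-1); last first.
    by move: ((cbrt (t - w.1))^-1) => X; ring.
  by apply: ler_wpM2l => //; rewrite mulr_ge0 ?wgt_ge0// mulr_ge0.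
have mGf x' : measurable_fun setT ((fun w => Gc (t - w.1, x' - w.2) * f w) : plane R -> R).
  exact: (measurable_duh_arg heta (t, x')).
exists (fun x' => \int[mu2]_w F (x', w)); split; first exact: integrable_Rintegral_l.
  apply: ae_imp (ae_integrable1 Fi) => x' ix'.
  have [k0|k0] := eqVneq (kernel_diff s x1 x2 x') 0.
    rewrite k0 mul0r /Rintegral integral0_eq// => w _.
    by rewrite /F/= k0 mul0r.
  rewrite /duh -RintegralZl//.
  have := integrable_RZ (kernel_diff s x1 x2 x')^-1 measurableT ix'.
  by apply: eq_integrable => // w _ /=; rewrite /F/= mulKf.
rewrite (Rfubini Fi); apply: eq_Rintegral => w _; rewrite /before.
have [h|h] := boolP ((0 < w.1) && (w.1 < T)); last first.
  rewrite fsupp// if_same mulr0 /Rintegral integral0_eq// => y _.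
  by rewrite /F/= fsupp// !mulr0.
have [wt|tw] := ltP w.1 t; last first.
  rewrite mulr0 /Rintegral integral0_eq// => y _.
  by rewrite /F/= Gc0 ?subr_le0// mul0r mulr0.
have tw0 : 0 < t - w.1 by rewrite subr_gt0.
have stw0 : 0 < s + t - w.1 by rewrite -addrA addr_gt0.
rewrite !GcE// -addrA -kernel_diff_dxKernel//.
have [Bt hBt] := dxKernel_bounded heta tw0.
have mg : measurable_fun setT (fun x' : R => G (t - w.1) (x' - w.2)).
  have a2 : measurable_fun setT (fun z : R => z - w.2) by exact: measurable_funB.
  exact: (measurableT_comp (measurable_dxKernel heta tw0) a2).
have i1 := kernel_conv_integrable heta x1 s0 mg (fun x' => hBt (x' - w.2)).
have i2 := kernel_conv_integrable heta x2 s0 mg (fun x' => hBt (x' - w.2)).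
have i12 : mu.-integrable setT (EFin \o (fun x' => kernel_diff s x1 x2 x' * G (t - w.1) (x' - w.2))).
  have := integrable_RB measurableT i1 i2; apply: eq_integrable => // z _ /=.
  by congr (_%:E); exact: esym (mulrBl _ _ _).
rewrite mulrC -(RintegralZl _ measurableT i12).
by apply: eq_Rintegral => x' _; rewrite /F/= GcE//; ring.
Qed.

End restart_duhamel.

(** * A linear inequality for the square of a solution *)

Section linear_inequality.
Context (R : realType) (eta : R) (heta : 0 < eta) (T : R) (T0 : 0 < T).
Local Notation mu := (@lebesgue_measure R).
Local Notation mu2 := (leb2 R).
Local Notation K := (Defs.Kernel eta).
Local Notation G := (dxKernel eta).
Local Notation Gc := (Gc eta).
Local Notation duh := (duh eta).
Local Notation kernel_diff := (kernel_diff eta).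
Context (C : R) (C1 : 1 <= C) (hC : forall t x, 0 < t -> t <= T ->
    `|K t x| <= C * pois (cbrt t) x /\ `|G t x| <= C * gam (cbrt t) x).
Context (p : \bar R) (p1 : (1 <= p)%E) (d : R) (d0 : 0 < d).
Context (u0 : R -> R) (mu0 : measurable_fun setT u0)
  (Nu0 : ('N[mu]_p[EFin \o u0] <= d%:E)%E).
Local Notation heat := (heat eta u0).
Context (f : R * R -> R) (mf : measurable_fun setT (f : plane R -> R))
  (f0 : forall w, 0 <= f w) (fsupp : forall w, ~~ ((0 < w.1) && (w.1 < T)) -> f w = 0).
Context (v : R -> R -> R) (M : R) (M0 : 0 < M).
Implicit Types (t x y z s r : R) (w : R * R).

Let C0 : 0 < C. Proof. exact: lt_le_trans C1. Qed.

Let mu01 : mu `[0%R, 1%R]%classic = 1%E.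
Proof. by rewrite lebesgue_measure_itv/= lte_fin ltr01 oppr0 adde0. Qed.

Definition solves t x :=
  mu2.-integrable setT (EFin \o (fun w => Gc (t - w.1, x - w.2) * f w)) /\
  v t x = heat (t, x) - 2%:R^-1 * duh f (t, x).

(** The times at which everything known for almost every time holds; the last clause is the
    hypothesis of [restart_duh]. *)
Definition good_time t := [/\ measurable_fun setT (v t),
  ('N[mu]_p[EFin \o v t] <= M%:E)%E, {ae mu, forall x, solves t x} &
  (\int[mu2]_w (sing T (t - w.1) * (wgt w.2 * f w))%:E < +oo)%E].

Lemma measurable_before t : measurable_fun setT (before f t : plane R -> R).
Proof. by apply: measurable_fun_ifT => //; exact: measurable_fun_ltr. Qed.

Lemma measurable_after t : measurable_fun setT (after f t : plane R -> R).
Proof. by apply: measurable_fun_ifT => //; exact: measurable_fun_ltr. Qed.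

Lemma duh_split t s x :
  mu2.-integrable setT (EFin \o (fun w => Gc (s - w.1, x - w.2) * f w)) ->
  mu2.-integrable setT (EFin \o (fun w => Gc (s - w.1, x - w.2) * before f t w)) /\
  duh f (s, x) = duh (before f t) (s, x) + duh (after f t) (s, x).
Proof.
move=> fi.
have ib : mu2.-integrable setT (EFin \o (fun w => Gc (s - w.1, x - w.2) * before f t w)).
  apply: (@le_integrable_R _ _ _ mu2 setT _ (fun w => `|Gc (s - w.1, x - w.2) * f w|)) => //.
  - exact: (measurable_duh_arg heta (s, x) (measurable_before t)).
  - move=> w _; rewrite /before; case: ifP => // _; by rewrite mulr0 normr0.
  - exact: integrable_norm.
have ia : mu2.-integrable setT (EFin \o (fun w => Gc (s - w.1, x - w.2) * after f t w)).
  apply: (@le_integrable_R _ _ _ mu2 setT _ (fun w => `|Gc (s - w.1, x - w.2) * f w|)) => //.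
  - exact: (measurable_duh_arg heta (s, x) (measurable_after t)).
  - move=> w _; rewrite /after; case: ifP => // _; by rewrite mulr0 normr0.
  - exact: integrable_norm.
split=> //; rewrite /duh/= -(RintegralD measurableT ib ia).
apply: eq_Rintegral => w _; rewrite -mulrDr /before /after.
by case: ifP => _; rewrite ?addr0 ?add0r.
Qed.

(** By the semigroup property, differences in space of the solution at time [s + t] involve
    only the solution at time [t] and the forcing after [t].  Differences are needed because
    the difference of two translates of the kernel decays like the weight, while the kernel
    itself does not. *)
Lemma restart_difference s t x1 x2 : 0 < s -> 0 < t -> s + t < T -> good_time t ->
  solves (s + t) x1 -> solves (s + t) x2 ->
  v (s + t) x1 - v (s + t) x2 = \int[mu]_y (kernel_diff s x1 x2 y * v t y) -
    2%:R^-1 * (duh (after f t) (s + t, x1) - duh (after f t) (s + t, x2)).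
Proof.
move=> s0 t0 stT [mv Nv hsol fin] [i1 ->] [i2 ->].
have [ih Eh] := restart_heat heta C1 hC p1 d0 mu0 Nu0 x1 x2 s0 t0 stT.
have [D [iD aeD ED]] := restart_duh heta C1 hC mf f0 fsupp x1 x2 s0 t0 stT fin.
have mk := kernel_diff_measurable heta x1 x2 s0.
have -> : \int[mu]_y (kernel_diff s x1 x2 y * v t y) =
    \int[mu]_y (kernel_diff s x1 x2 y * heat (t, y) - 2^-1 * D y).
  congr fine; apply: ae_eq_integral => //.
  - by apply/measurable_EFinP; exact: measurable_funM.
  - apply/measurable_EFinP; apply: measurable_funB; first exact: (measurable_integrable ih).
    by apply: measurable_funM => //; exact: (measurable_integrable iD).
  - apply: ae_imp (ae_and hsol aeD) => y [[_ vy] Dy] _.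
    by congr (_%:E); rewrite Dy vy; ring.
have iD2 := integrable_RZ 2^-1 measurableT iD.
rewrite (RintegralB measurableT ih iD2) (RintegralZl _ measurableT iD) Eh ED.
have [ib1 ->] := duh_split t i1; have [ib2 ->] := duh_split t i2.
have -> : \int[mu2]_w ((Gc (s + t - w.1, x1 - w.2) - Gc (s + t - w.1, x2 - w.2)) * before f t w) =
    duh (before f t) (s + t, x1) - duh (before f t) (s + t, x2).
  rewrite /duh/= -(RintegralB measurableT ib1 ib2).
  by apply: eq_Rintegral => w _; rewrite mulrBl.
move: (heat _) (heat _) (duh (before f t) (_, x1)) (duh (before f t) (_, x2))
  (duh (after f t) (_, x1)) (duh (after f t) (_, x2)) => h1 h2 b1 b2 a1 a2.
by ring.
Qed.

Lemma duh_after_le s t x : 0 < s -> 0 < t -> s + t < T ->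
  (`|duh (after f t) (s + t, x)|%:E <= (C * cbrt s)%:E * volterra (vker T) f (s + t, x)%R)%E.
Proof.
move=> s0 t0 stT.
have sT : s < T by rewrite (le_lt_trans _ stT)// lerDl ltW.
have mG := measurable_duh_arg heta (s + t, x) (measurable_after t).
have c0 : 0 <= C * cbrt s by rewrite mulr_ge0 ?cbrt_ge0 ?(ltW C0).
have mV := measurable_volterra_arg (s + t, x) (measurable_vker T) mf.
have nV w : 0 <= vker T (s + t - w.1, x - w.2) * f w by rewrite mulr_ge0 ?vker_ge0.
apply: (le_trans (abs_Rintegral_le mu2 measurableT mG)).
rewrite /volterra -(ge0_integralMl mu2 c0 nV mV).
apply: le_ge0_integral => //.
- exact: measurableT_comp.
- exact: measurable_funM.
move=> w /=; rewrite /after; case: ifPn => [_|].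
  by rewrite mulr0 normr0 mulr_ge0.
rewrite -leNgt => tw.
have [wst|wst] := ltP w.1 (s + t); last first.
  by rewrite Gc0 ?subr_le0// mul0r normr0 mulr_ge0.
have w0 : 0 < s + t - w.1 by rewrite subr_gt0.
have ws : s + t - w.1 <= s by lra.
have wT : s + t - w.1 < T by exact: le_lt_trans sT.
rewrite GcE// normrM (ger0_norm (f0 w)) mulrA; apply: ler_wpM2r => //.
have [_ h] := hC (x - w.2) w0 (ltW wT); apply: (le_trans h).
rewrite /vker/= w0 wT/=; have r0 := cbrt_gt0 w0.
rewrite -mulrA ler_wpM2l ?(ltW C0)// mulrCA ler_peMr ?gam_ge0 ?(ltW r0)//.
by rewrite ler_pdivlMr// mul1r; apply: cbrt_le => //; exact: ltW.
Qed.

Lemma kernel_diff_mean_le s t x1 x2 : 0 < s -> s <= T -> measurable_fun setT (v t) ->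
  ('N[mu]_p[EFin \o v t] <= M%:E)%E ->
  `|\int[mu]_y (kernel_diff s x1 x2 y * v t y)| <= 2 * C * M * (pi + (cbrt s)^-1).
Proof.
move=> s0 sT mv Nv; have r0 := cbrt_gt0 s0.
have mk := kernel_diff_measurable heta x1 x2 s0.
have mkv : measurable_fun setT (fun y => kernel_diff s x1 x2 y * v t y) by exact: measurable_funM.
have mP x : measurable_fun setT (fun y : R => pois (cbrt s) (x - y) * `|v t y|) by exact: measurable_pois_f.
have nP x y : 0 <= pois (cbrt s) (x - y) * `|v t y| by exact: pois_f_ge0.
have hP x := pois_f_integral_le mv p1 M0 Nv x s0.
have mCP x : measurable_fun setT (fun y : R => C * (pois (cbrt s) (x - y) * `|v t y|)).
  by apply: measurable_funM => //; exact: mP.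
have nCP x y : 0 <= C * (pois (cbrt s) (x - y) * `|v t y|) by rewrite mulr_ge0// ltW.
rewrite -lee_fin; apply: (le_trans (abs_Rintegral_le mu measurableT mkv)).
apply: (@le_trans _ _ (\int[mu]_y (C * (pois (cbrt s) (x1 - y) * `|v t y|) +
   C * (pois (cbrt s) (x2 - y) * `|v t y|))%:E)%E).
  apply: le_ge0_integral => //.
  - exact: measurableT_comp.
  - by apply: measurable_funD; exact: mCP.
  - move=> y; rewrite normrM [X in _ <= X + _]mulrA [X in _ <= _ + X]mulrA -mulrDl ler_wpM2r//.
    have [h1 _] := hC (x1 - y) s0 sT; have [h2 _] := hC (x2 - y) s0 sT.
    by apply: (le_trans (ler_normB _ _)); exact: lerD.
have -> := ge0_integralDr mu (nCP x1) (nCP x2) (mCP x1) (mCP x2).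
have -> := ge0_integralMl mu (ltW C0) (nP x1) (mP x1).
have -> := ge0_integralMl mu (ltW C0) (nP x2) (mP x2).
rewrite (_ : 2 * C * M * (pi + (cbrt s)^-1) = C * (M * (pi + (cbrt s)^-1)) + C * (M * (pi + (cbrt s)^-1))); last by ring.
by rewrite EFinD EFinM; apply: leeD; apply: lee_wpmul2l; rewrite ?lee_fin ?(ltW C0)//; exact: hP.
Qed.

Lemma pointwise_difference s t x1 x2 : 0 < s -> 0 < t -> s + t < T -> good_time t ->
  solves (s + t) x1 -> solves (s + t) x2 ->
  (`|v (s + t) x1|%:E <= `|v (s + t) x2|%:E + ((2 * C * M * (pi + (cbrt s)^-1))%:E +
     (C * cbrt s)%:E * (volterra (vker T) f (s + t, x1)%R + volterra (vker T) f (s + t, x2)%R)))%E.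
Proof.
move=> s0 t0 stT gt so1 so2; have E := restart_difference s0 t0 stT gt so1 so2.
have [mv Nv _ _] := gt.
have sT : s <= T by rewrite ltW// (le_lt_trans _ stT)// lerDl ltW.
have h1 := duh_after_le x1 s0 t0 stT; have h2 := duh_after_le x2 s0 t0 stT.
have h3 := kernel_diff_mean_le x1 x2 s0 sT mv Nv.
rewrite ge0_muleDr; [|exact: (volterra_ge0 _ (@vker_ge0 _ _) f0)|exact: (volterra_ge0 _ (@vker_ge0 _ _) f0)].
apply: (@le_trans _ _ (`|v (s + t) x2|%:E + ((2 * C * M * (pi + (cbrt s)^-1))%:E +
   (`|duh (after f t) ((s + t)%R, x1)|%:E + `|duh (after f t) ((s + t)%R, x2)|%:E)))%E); last first.
  apply: leeD2l; apply: leeD2l; exact: (leeD h1 h2).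
rewrite -!EFinD lee_fin.
move: E h3; move: (\int[mu]_y _) (duh _ _) (duh _ _) => I B A E h3.
have -> : v (s + t) x1 = v (s + t) x2 + (I - 2^-1 * (A - B)) by rewrite -E; ring.
apply: (le_trans (ler_normD _ _)); rewrite lerD2l.
apply: (le_trans (ler_normB _ _)); apply: lerD => //.
rewrite normrM ger0_norm//; have := ler_normB A B; have := normr_ge0 A; have := normr_ge0 B; lra.
Qed.

Definition restart_cst := M * (2 * cbrt T + 2 * C * (pi * cbrt T) + 2 * C).
Local Notation C3 := restart_cst.

Lemma restart_cst_gt0 : 0 < C3.
Proof.
rewrite mulr_gt0// ltr_wpDl ?mulr_gt0//.
by rewrite addr_ge0 ?mulr_ge0 ?cbrt_ge0 ?pi_ge0 ?(ltW C0).
Qed.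

Lemma unit_average_le t x : measurable_fun setT (v t) -> ('N[mu]_p[EFin \o v t] <= M%:E)%E ->
  (\int[mu]_(c in `[0%R, 1%R]) `|v t (x + c)%R|%:E <= (2 * M)%:E)%E.
Proof.
move=> mv Nv.
pose k (y : R) := \1_(`[0%R, 1%R]%classic) (y - x) : R.
have mi : measurable_fun setT (fun y : R => \1_(`[0%R, 1%R]%classic) y : R) by exact: measurable_indic.
have ms : measurable_fun setT (fun y : R => y - x) by exact: measurable_funB.
have mk : measurable_fun setT k by exact: (measurableT_comp mi ms).
have k0 y : 0 <= k y by rewrite /k indicE.
have k1 y : k y <= 1 by rewrite /k indicE lern1 leq_b1.
have := Lnorm_pairing p1 mv M0 Nv mk k0 k1.
have -> : (\int[mu]_y (k y)%:E = 1)%E.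
  have -> : (\int[mu]_y (k y)%:E = \int[mu]_y (\1_(`[0%R, 1%R]%classic) y)%:E)%E.
    apply: (ge0_integral_shift (- x) (f := fun y => (\1_(`[0%R, 1%R]%classic) y)%:E)).
      exact/measurable_EFinP.
    by move=> y; rewrite lee_fin indicE.
  rewrite integral_indic// setIT; exact: mu01.
rewrite -EFinD -EFinM (mulrC M); apply: le_trans.
rewrite le_eqVlt; apply/orP; left; apply/eqP.
have mkv : measurable_fun setT (fun y => k y * `|v t y|).
  by apply: measurable_funM => //; exact: measurableT_comp.
have <- := ge0_integral_shift x (f := fun y => (k y * `|v t y|)%:E); last 2 first.
- exact/measurable_EFinP.
- by move=> y; rewrite lee_fin mulr_ge0.
rewrite integral_mkcond; apply: eq_integral => c _.
rewrite /patch /k addrK indicE addrC; case: ifPn => hc; first by rewrite mul1r.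
by rewrite mul0r.
Qed.

(** Averaging [pointwise_difference] over the second point, taken at distance at most [1] from
    [x], trades the value there for the [L^p] norm. *)
Lemma averaged_inequality s t x : 0 < s -> 0 < t -> s + t < T -> good_time t ->
  good_time (s + t) -> solves (s + t) x ->
  (`|v (s + t) x|%:E <= (C3 / cbrt s)%:E +
     (C * cbrt s)%:E * volterra (vkers T) f (s + t, x)%R)%E.
Proof.
move=> s0 t0 stT gt [mv Nv hsol _] so.
have sT : s <= T by rewrite ltW// (le_lt_trans _ stT)// lerDl ltW.
have r0 := cbrt_gt0 s0; have rT := cbrt_le (ltW s0) sT.
set r := cbrt s in r0 rT *; set N := volterra (vker T) f.
pose I := `[0%R, 1%R]%classic : set R.
have mI : measurable (I : set (measurableTypeR R)) by exact: measurable_itv.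
have muI : mu I = 1%E := mu01.
have cstI (a : \bar R) : (\int[mu]_(c in I) a = a)%E.
  by rewrite (integral_cst mu mI a) [X in (_ * X)%E](_ : _ = 1%E) ?mule1//; exact: muI.
pose A := 2 * C * M * (pi + r^-1).
have A0 : 0 <= A.
  apply: mulr_ge0; last by rewrite addr_ge0 ?pi_ge0 ?invr_ge0 ?(ltW r0).
  by apply: mulr_ge0; [rewrite mulr_ge0 ?(ltW C0)|exact: ltW].
have N0 (z : R * R) : (0 <= N z)%E by exact: (volterra_ge0 _ (@vker_ge0 _ _) f0).
have Cr0 : 0 <= C * r by rewrite mulr_ge0 ?(ltW C0) ?(ltW r0).
have mN : measurable_fun setT (fun c : R => N (s + t, x + c)).
  apply: (measurableT_comp (measurable_volterra (measurable_vker T) (@vker_ge0 _ T) mf f0)).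
  by apply: measurable_fun_pair => //; exact: measurable_funD.
have mva : measurable_fun setT (fun c : R => `|v (s + t) (x + c)|%:E).
  apply/measurable_EFinP; apply: measurableT_comp => //.
  have a1 : measurable_fun setT (fun c : R => x + c) by exact: measurable_funD.
  exact: (measurableT_comp mv a1).
pose P (c : R) := (N ((s + t)%R, x) + N ((s + t)%R, (x + c)%R))%E.
pose Q (c : R) := ((C * r)%:E * P c)%E.
pose W (c : R) := (A%:E + Q c)%E.
have P0 c : (0 <= P c)%E by exact: adde_ge0.
have Q0 c : (0 <= Q c)%E by rewrite mule_ge0// lee_fin.
have W0 c : (0 <= W c)%E by rewrite adde_ge0// lee_fin.
have mP : measurable_fun setT P by exact: (emeasurable_funD (measurable_cst _) mN).
have mQ : measurable_fun setT Q by exact: (emeasurable_funM (measurable_cst _) mP).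
have mW : measurable_fun setT W by exact: (emeasurable_funD (measurable_cst _) mQ).
have va0 c : (0 <= `|v (s + t) (x + c)%R|%:E)%E by rewrite lee_fin.
rewrite -(cstI (`|v (s + t) x|%:E)).
apply: (@le_trans _ _ (\int[mu]_(c in I) (`|v (s + t) (x + c)%R|%:E + W c))%E).
  have n2 c : (0 <= `|v (s + t) (x + c)%R|%:E + W c)%E by exact: adde_ge0.
  have m2 := emeasurable_funD mva mW.
  apply: ae_ge0_le_integral; first exact: mI.
  - by move=> c _; rewrite lee_fin.
  - exact: measurable_cst.
  - by move=> c _; exact: n2.
  - exact: (measurable_funTS m2).
  - apply: ae_imp (ae_shift x hsol) => c sc _; rewrite (addrC c x) in sc.
    exact: (pointwise_difference s0 t0 stT gt so sc).
have -> : (\int[mu]_(c in I) (`|v (s + t) (x + c)%R|%:E + W c) =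
    \int[mu]_(c in I) `|v (s + t) (x + c)%R|%:E + \int[mu]_(c in I) W c)%E.
  exact: (ge0_integralD mu mI (fun c _ => va0 c) (measurable_funTS mva) (fun c _ => W0 c) (measurable_funTS mW)).
have -> : (\int[mu]_(c in I) W c = \int[mu]_(c in I) A%:E + \int[mu]_(c in I) Q c)%E.
  apply: (ge0_integralD mu mI _ _ (fun c _ => Q0 c) (measurable_funTS mQ)) => [c _|].
    by rewrite lee_fin.
  exact: measurable_cst.
have -> : (\int[mu]_(c in I) Q c = (C * r)%:E * \int[mu]_(c in I) P c)%E.
  exact: (ge0_integralZl_EFin mu mI (fun c _ => P0 c) (measurable_funTS mP) Cr0).
have -> : (\int[mu]_(c in I) P c = \int[mu]_(c in I) N ((s + t)%R, x) + \int[mu]_(c in I) N ((s + t)%R, (x + c)%R))%E.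
  apply: (ge0_integralD mu mI _ _ (fun c _ => N0 _) (measurable_funTS mN)) => [c _|] //.
rewrite cstI.
rewrite cstI (volterra_average T (s + t) x mf f0).
rewrite -(volterraD (s + t, x) (measurable_vker T) (@vker_ge0 _ T) (measurable_vavg T) (@vavg_ge0 _ T) mf f0).
rewrite addeA; apply: leeD; last by [].
apply: (le_trans (leeD (unit_average_le x mv Nv) (lexx _))).
rewrite -EFinD lee_fin /A /restart_cst ler_pdivlMr//.
rewrite (_ : (2 * M + 2 * C * M * (pi + r^-1)) * r = M * (2 * r + 2 * C * (pi * r) + 2 * C)); last first.
  by field; rewrite gt_eqF.
rewrite ler_wpM2l ?(ltW M0)// lerD2r; apply: lerD; first by rewrite ler_wpM2l.
by apply: ler_wpM2l; [rewrite mulr_ge0 ?(ltW C0)|rewrite ler_wpM2l ?pi_ge0].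
Qed.

(** The restart time is chosen at distance comparable to [|v|^(-3)] from [t]: the first term
    of [averaged_inequality] is then absorbed by [|v|], and the factor [cbrt s] of the second one
    is of order [1 / |v|], which makes the inequality linear in [v^2]. *)
Lemma linear_inequality : {ae mu, forall t, 0 < t < T -> good_time t} ->
  {ae mu, forall t, 0 < t < T -> {ae mu, forall x,
    ((v t x ^+ 2)%:E <= (16 * C3 ^+ 2 / cbrt t ^+ 2)%:E +
      (8 * C * C3)%:E * volterra (vkers T) f (t, x))%E}}.
Proof.
move: restart_cst_gt0 averaged_inequality; move: restart_cst => c3 C30 avg.
move=> hg; have [e [he dense]] := dense_ae_sequence T0 hg.
apply: ae_imp hg => t ht tT; have gt := ht tT; have /andP[t0 tT'] := tT.
have [_ _ hsol _] := gt.
apply: ae_imp hsol => x so.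
set a := `|v t x|; have -> : v t x ^+ 2 = a ^+ 2 by rewrite /a real_normK// num_real.
have a0 : 0 <= a by exact: normr_ge0.
set V := volterra _ _ _.
have V0 : (0 <= V)%E by exact: (volterra_ge0 _ (@vkers_ge0 _ _) f0).
have B0 : 0 <= 8 * C * c3.
  by apply: mulr_ge0; [rewrite mulr_ge0 ?(ltW C0)|exact: ltW].
have r0 := cbrt_gt0 t0.
have Q0 : 0 <= 16 * c3 ^+ 2 / cbrt t ^+ 2.
  by apply: divr_ge0; [apply: mulr_ge0 => //; exact: sqr_ge0|exact: sqr_ge0].
have [az|az] := eqVneq a 0.
  rewrite az expr0n/=; apply: adde_ge0; last by rewrite mule_ge0// lee_fin.
  by rewrite lee_fin.
have ap : 0 < a by rewrite lt_neqAle eq_sym az.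
(* For [cbrt s >= b] the term [c3 / cbrt s] is at most half of [a]. *)
pose b := 2 * c3 / a; have b0 : 0 < b by rewrite divr_gt0 ?mulr_gt0.
have b3 : 0 < b ^+ 3 by rewrite exprn_gt0.
have cle s c : 0 <= s -> 0 <= c -> s <= c ^+ 3 -> cbrt s <= c.
  move=> s0 c0 h; rewrite -(@ler_pXn2r _ 3) ?nnegrE ?cbrt_ge0//.
  by rewrite cbrtK.
have cge s c : 0 <= s -> 0 <= c -> c ^+ 3 <= s -> c <= cbrt s.
  move=> s0 c0 h; rewrite -(@ler_pXn2r _ 3) ?nnegrE ?cbrt_ge0//.
  by rewrite cbrtK.
have h8 : 2 * b ^+ 3 <= (2 * b) ^+ 3.
  have -> : (2 * b) ^+ 3 = 8 * b ^+ 3 by ring.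
  by move: b3; move: (b ^+ 3) => X; lra.
(* If there is no room for such a restart between [0] and [t], then [a] is already at most
   [4 c3 / cbrt t]. *)
have [tb|tb] := leP t (2 * b ^+ 3).
  apply: (@le_trans _ _ (16 * c3 ^+ 2 / cbrt t ^+ 2)%:E); last by rewrite leeDl// mule_ge0// lee_fin.
  rewrite lee_fin ler_pdivlMr ?exprn_gt0//.
  have h : cbrt t <= 2 * b by apply: cle; [exact: ltW|rewrite mulr_ge0 ?(ltW b0)|exact: (le_trans tb)].
  have h2 : a * cbrt t <= 4 * c3.
    apply: (le_trans (ler_wpM2l a0 h)); rewrite /b le_eqVlt; apply/orP; left; apply/eqP.
    by field.
  rewrite -exprMn (_ : 16 * c3 ^+ 2 = (4 * c3) ^+ 2); last by ring.
  by rewrite ler_pXn2r ?nnegrE ?mulr_ge0 ?cbrt_ge0 ?(ltW C30).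
have [n /andP[n1 n2]] : exists n, t - 2 * b ^+ 3 < e n < t - b ^+ 3.
  by apply: dense; lra.
have [/andP[e0 eT] ge] := he n.
have s0 : 0 < t - e n by lra.
have E : t - e n + e n = t by rewrite subrK.
have := avg (t - e n) (e n) x s0 e0.
rewrite E => /(_ tT' ge gt so) h.
have [p1' p2'] : b ^+ 3 <= t - e n /\ t - e n <= 2 * b ^+ 3.
  by split; [rewrite lerBrDr addrC -lerBrDr ltW|rewrite lerBlDr addrC -lerBlDr ltW].
have c1 : b <= cbrt (t - e n) by apply: cge => //; exact: ltW.
have c2 : cbrt (t - e n) <= 2 * b by apply: cle; [exact: ltW|rewrite mulr_ge0 ?(ltW b0)|exact: le_trans h8].
move: h V0; rewrite -/V -/a; case: V => [V| |//] h V0; last first.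
  rewrite mulry gtr0_sg ?mul1e ?addey ?leey//.
  by rewrite !mulr_gt0 ?C0 ?C30.
rewrite -EFinM -EFinD lee_fin in h; rewrite lee_fin in V0.
rewrite -EFinM -EFinD lee_fin.
have i1 : c3 / cbrt (t - e n) <= a / 2.
  apply: (@le_trans _ _ (c3 / b)).
    by rewrite ler_wpM2l ?(ltW C30)// lef_pV2 ?posrE// (lt_le_trans b0).
  rewrite /b le_eqVlt; apply/orP; left; apply/eqP; field.
  by rewrite az gt_eqF.
have i2 : C * cbrt (t - e n) * V <= C * (2 * b) * V.
  by rewrite ler_wpM2r// ler_wpM2l ?(ltW C0).
have i3 : a <= 2 * (C * (2 * b) * V) by lra.
apply: (@le_trans _ _ (a * (2 * (C * (2 * b) * V)))); first by rewrite expr2 ler_wpM2l.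
rewrite (_ : a * _ = 8 * C * c3 * V); last by rewrite /b; field.
by rewrite lerDr.
Qed.

End linear_inequality.

(** * Decay of solutions *)

Section barrier.
Context (R : realType) (T : R) (T0 : 0 < T).
Local Notation mu := (@lebesgue_measure R).
Local Notation mu2 := (leb2 R).
Implicit Types (t x y s l : R) (w : R * R).

(** Convolution with an integrable function of time preserves integrability, hence is finite
    at almost every time. *)
Lemma sing_volterra_ae_finite (g : R * R -> R) :
  measurable_fun setT (g : plane R -> R) -> (forall w, 0 <= g w) ->
  (\int[mu2]_w (g w)%:E < +oo)%E ->
  {ae mu, forall t, (\int[mu2]_w (sing T (t - w.1) * g w)%:E < +oo)%E}.
Proof.
move=> mg g0 gfin.
pose F (u : R * (R * R)) := sing T (u.1 - u.2.1) * g u.2.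
have mF : measurable_fun setT (F : measurableTypeR R * plane R -> R).
  apply: measurable_funM; last exact: (measurableT_comp mg).
  by apply: measurable_sing; apply: measurable_funB => //; exact: measurableT_comp.
have F0 u : 0 <= F u by rewrite mulr_ge0 ?sing_ge0.
apply: ge0_integral_lty_ae.
- exact: (measurable_tonelli mu2 mF F0).
- by move=> t; apply: integral_ge0 => w _; rewrite lee_fin; exact: (F0 (t, w)).
rewrite (tonelli_swap mu mu2 mF F0).
have S0 := sing_integrable T0; set S := \int[mu]_s sing T s.
have SE : (\int[mu]_s (sing T s)%:E = S%:E)%E by rewrite (Rintegral_fineK measurableT S0).
have Sp : 0 <= S by apply: Rintegral_ge0 => s _; exact: sing_ge0.
apply: (@le_lt_trans _ _ (\int[mu2]_w (S * g w)%:E)%E); last first.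
  by have -> := ge0_integralMl mu2 Sp g0 mg; exact: lte_mul_pinfty.
apply: ge0_le_integral => //.
- by move=> w _; apply: integral_ge0 => y _; rewrite lee_fin.
- exact: (measurable_tonelli_r mu mF F0).
- by apply/measurable_EFinP; exact: measurable_funM.
move=> w _; rewrite /F/=.
have ms : measurable_fun setT (fun t : R => sing T (t - w.1)).
  by apply: measurable_sing; exact: measurable_funB.
under eq_integral do rewrite mulrC.
have -> := ge0_integralMl mu (g0 w) (fun t => sing_ge0 T (t - w.1)) ms.
have -> : (\int[mu]_t (sing T (t - w.1))%:E = S%:E)%E.
  rewrite -SE; apply: (ge0_integral_shift (- w.1) (f := fun s => (sing T s)%:E)).
    by apply/measurable_EFinP; exact: measurable_sing.
  by move=> s; rewrite lee_fin sing_ge0.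
by rewrite -EFinM mulrC.
Qed.

(** A multiple of [t ^ (-2/3)]; the exponential makes it a strict supersolution of the linear
    Volterra inequality when [l] is large. *)
Definition barrier A l w := A * (sing T w.1 * expR (l * w.1)).

Lemma barrier_ge0 A l w : 0 <= A -> 0 <= barrier A l w.
Proof. by move=> A0; rewrite mulr_ge0// mulr_ge0 ?sing_ge0 ?expR_ge0. Qed.

Lemma measurable_barrier A l :
  measurable_fun setT (barrier A l : plane R -> R).
Proof.
apply: measurable_funM => //; apply: measurable_funM; first exact: measurable_sing.
by apply: (measurableT_comp (@measurable_expR R)); exact: measurable_funM.
Qed.

Lemma volterra_barrier_le A l e t x : 0 <= A -> 0 <= l -> 0 < t -> t < T ->
  (\int[mu]_s (sing T s * expR (- (l * s)))%:E <= e%:E)%E ->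
  (volterra (vkers T) (barrier A l) (t, x) <= (16 * pi * A * e * ((cbrt t ^+ 2)^-1 * expR (l * t)))%:E)%E.
Proof.
move=> A0 l0 t0 tT he.
have mV := measurable_volterra_arg (t, x) (measurable_vkers T) (measurable_barrier A l).
have nV w : 0 <= vkers T (t - w.1, x - w.2) * barrier A l w.
  by rewrite mulr_ge0 ?vkers_ge0 ?barrier_ge0.
rewrite /volterra (tonelli_l mu mu mV nV)/=.
pose c := 2 * pi * A * (4 * (cbrt t ^+ 2)^-1 * expR (l * t)).
have pA : 0 <= 2 * pi * A by rewrite !mulr_ge0 ?pi_ge0.
have c0 : 0 <= c.
  by rewrite mulr_ge0// mulr_ge0 ?expR_ge0// mulr_ge0 ?invr_ge0 ?sqr_ge0.
pose h s := sing T s * expR (- (l * s)).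
have h0 s : 0 <= h s by rewrite mulr_ge0 ?sing_ge0 ?expR_ge0.
have mh : measurable_fun setT h.
  apply: measurable_funM; first exact: measurable_sing.
  by apply: (measurableT_comp (@measurable_expR R)); apply: measurable_funN; exact: measurable_funM.
have mht : measurable_fun setT (fun s : R => h (t - s)).
  have a1 : measurable_fun setT (fun s : R => t - s) by exact: measurable_funB.
  exact: (measurableT_comp mh a1).
have msum : measurable_fun setT (fun s : R => h (t - s) + h s) by exact: measurable_funD.
have nsum s : 0 <= h (t - s) + h s by exact: addr_ge0.
apply: (@le_trans _ _ (\int[mu]_s (c * (h (t - s) + h s))%:E)%E); last first.
  have -> := ge0_integralMl mu c0 nsum msum.
  have -> := ge0_integralDr mu (fun s => h0 (t - s)) h0 mht mh.
  have -> : (\int[mu]_s (h (t - s))%:E = \int[mu]_s (h s)%:E)%E.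
    apply: (ge0_integral_subl t (f := fun s => (h s)%:E)); first exact/measurable_EFinP.
    by move=> s; rewrite lee_fin.
  apply: (@le_trans _ _ (c%:E * (e%:E + e%:E))%E).
    by apply: lee_wpmul2l; rewrite ?lee_fin//; exact: (leeD he he).
  rewrite -EFinD -EFinM lee_fin le_eqVlt; apply/orP; left; apply/eqP.
  by rewrite /c; move: ((cbrt t ^+ 2)^-1) => X; ring.
apply: ge0_le_integral => //.
- by move=> s _; apply: integral_ge0 => y _; rewrite lee_fin; exact: (nV (s, y)).
- exact: (measurable_tonelli mu mV nV).
- by apply/measurable_EFinP; exact: measurable_funM.
move=> s _.
have b0 : 0 <= barrier A l (s, 0) by exact: barrier_ge0.
have mk : measurable_fun setT (fun y : R => vkers T (t - s, x - y)).
  apply: (measurableT_comp (measurable_vkers T)); apply: measurable_fun_pair => //.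
  exact: measurable_funB.
under eq_integral do rewrite mulrC.
have -> := ge0_integralMl mu b0 (fun y => vkers_ge0 T (t - s, x - y)) mk.
have -> : (\int[mu]_y (vkers T (t - s, (x - y)%R))%:E = \int[mu]_y (vkers T (t - s, (y - 0)%R))%:E)%E.
  under [RHS]eq_integral do rewrite subr0.
  apply: (ge0_integral_subl x (f := fun y => (vkers T (t - s, y))%:E)).
    apply/measurable_EFinP; apply: (measurableT_comp (measurable_vkers T)).
    exact: measurable_fun_pair.
  by move=> y; rewrite lee_fin vkers_ge0.
apply: (@le_trans _ _ ((barrier A l (s, 0))%:E * (2 * pi * sing T (t - s))%:E)%E).
  by apply: lee_wpmul2l; rewrite ?lee_fin//; exact: vkers_mass.
rewrite -EFinM lee_fin /barrier/=.
have hs := sing_conv_le s t0 tT l0.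
rewrite [leLHS](_ : _ = 2 * pi * A * (sing T (t - s) * (sing T s * expR (l * s)))); last by ring.
rewrite /c -[leRHS]mulrA; apply: ler_wpM2l => //.
Qed.

(** The contraction principle [volterra_contraction] for the kernel [vkers]: its effect on the weight
    is integrable in time, hence small in Laplace transform. *)
Lemma vkers_vanish B (Z : R * R -> R) : 0 < B ->
  measurable_fun setT (Z : plane R -> R) -> (forall w, 0 <= Z w) ->
  (forall w, ~~ (0 < w.1 < T) -> Z w = 0) ->
  (\int[mu2]_w (wgt w.2 * Z w)%:E < +oo)%E ->
  {ae mu, forall t, 0 < t < T ->
    {ae mu, forall x, ((Z (t, x))%:E <= B%:E * volterra (vkers T) Z (t, x))%E}} ->
  {ae mu, forall t, {ae mu, forall x, Z (t, x) = 0}}.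
Proof.
move=> B0 mZ Z0 Zsupp fin hZ.
pose kap := B * (36 * pi * (1 + cbrt T ^+ 2)).
have kap0 : 0 < kap.
  by rewrite mulr_gt0// mulr_gt0 ?mulr_gt0 ?pi_gt0// ltr_pwDl ?sqr_ge0.
have [l l0 hl] : exists2 l, 0 <= l & (\int[mu]_s (sing T s * expR (- (l * s)))%:E <= ((2 * kap)^-1)%:E)%E.
  by apply: sing_laplace_small => //; rewrite invr_gt0 mulr_gt0.
have mq : measurable_fun setT ((fun w => B * vkers T w) : plane R -> R).
  by apply: measurable_funM => //; exact: measurable_vkers.
have q0 w : 0 <= B * vkers T w by rewrite mulr_ge0 ?vkers_ge0// ltW.
have mk : measurable_fun setT (fun s : R => kap * sing T s).
  by apply: measurable_funM => //; exact: measurable_sing.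
have k0 s : 0 <= kap * sing T s by rewrite mulr_ge0 ?sing_ge0// ltW.
apply: (volterra_contraction (l := l) mq q0 mk k0 mZ Z0).
- move=> s y.
  have mw : measurable_fun setT (fun x : R => wgt x * vkers T (s, x - y)).
    apply: measurable_funM; first exact: measurable_wgt.
    apply: (measurableT_comp (measurable_vkers T)); apply: measurable_fun_pair => //.
    exact: measurable_funB.
  have nw x : 0 <= wgt x * vkers T (s, x - y) by rewrite mulr_ge0 ?wgt_ge0 ?vkers_ge0.
  under eq_integral do rewrite mulrCA.
  have -> := ge0_integralMl mu (ltW B0) nw mw.
  apply: (@le_trans _ _ (B%:E * (36 * pi * (1 + cbrt T ^+ 2) * sing T s * wgt y)%:E)%E).
    by apply: lee_wpmul2l; rewrite ?lee_fin ?(ltW B0)//; exact: vkers_weight.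
  by rewrite -EFinM lee_fin /kap !mulrA.
- have ms : measurable_fun setT (fun s : R => sing T s * expR (- (l * s))).
    apply: measurable_funM; first exact: measurable_sing.
    by apply: (measurableT_comp (@measurable_expR R)); apply: measurable_funN; exact: measurable_funM.
  have ns s : 0 <= sing T s * expR (- (l * s)) by rewrite mulr_ge0 ?sing_ge0 ?expR_ge0.
  under eq_integral do rewrite -mulrA.
  have -> := ge0_integralMl mu (ltW kap0) ns ms.
  apply: (@le_trans _ _ (kap%:E * ((2 * kap)^-1)%:E)%E).
    by apply: lee_wpmul2l; rewrite ?lee_fin// ltW.
  by rewrite -EFinM lee_fin invfM mulrCA divff ?mulr1// gt_eqF.
- apply: le_lt_trans fin; apply: le_ge0_integral => //.
  + by move=> w; rewrite mulr_ge0// ltW// stwgt_gt0.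
  + by apply: measurable_funM => //; exact: measurable_stwgt.
  + by apply: measurable_funM => //; exact: measurable_wgt.
  move=> w; have [/andP[w0 w1]|h] := boolP (0 < w.1 < T); last by rewrite Zsupp// !mulr0.
  apply: ler_pM => //; first by rewrite ltW// stwgt_gt0.
  by rewrite /stwgt ler_piMl ?wgt_ge0// -expR0 ler_expR oppr_le0 mulr_ge0// ltW.
apply: ae_imp hZ => t ht; have [tt|tt] := boolP (0 < t < T); last first.
  by apply: aeW => x; rewrite Zsupp//; exact: volterra_ge0.
by apply: ae_imp (ht tt) => x hx; rewrite (volterraZ (t, x) (ltW B0) (measurable_vkers T) (@vkers_ge0 _ T) mZ Z0).
Qed.

End barrier.

Section decay.
Context (R : realType) (eta : R) (heta : 0 < eta) (T : R) (T0 : 0 < T).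
Local Notation mu := (@lebesgue_measure R).
Local Notation mu2 := (leb2 R).
Local Notation K := (Defs.Kernel eta).
Local Notation G := (dxKernel eta).
Local Notation Gc := (Gc eta).
Local Notation duh := (duh eta).
Context (C : R) (C1 : 1 <= C) (hC : forall t x, 0 < t -> t <= T ->
    `|K t x| <= C * pois (cbrt t) x /\ `|G t x| <= C * gam (cbrt t) x).
Context (p : \bar R) (p1 : (1 <= p)%E) (d : R) (d0 : 0 < d).
Context (u0 : R -> R) (mu0 : measurable_fun setT u0)
  (Nu0 : ('N[mu]_p[EFin \o u0] <= d%:E)%E).
Local Notation heat := (heat eta u0).
Implicit Types (t x y z s : R) (w : R * R) (v : R -> R -> R).

Let C0 : 0 < C. Proof. exact: lt_le_trans C1. Qed.

Lemma strip_section_measurable v t :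
  measurable_fun (`]0, T[ `*` [set: R]) (fun z : R * R => v z.1 z.2) -> 0 < t -> t < T ->
  measurable_fun setT (v t).
Proof.
move=> mv t0 tT; have m := measurable_on_strip mv.
rewrite (_ : v t = fun x => if (0 < t) && (t < T) then v t x else 0).
  exact: (measurableT_comp m (@pair1_measurable _ _ R R t)).
by apply/funext => x; rewrite t0 tT.
Qed.

Lemma sub_strip t1 v : t1 < T ->
  measurable_fun (`]0, T[ `*` [set: R]) (fun z : R * R => v z.1 z.2) ->
  measurable_fun (`]0, t1[ `*` [set: R]) (fun z : R * R => v z.1 z.2).
Proof.
move=> t1T; apply: measurable_funS; first by apply: measurableX => //; exact: measurable_itv.
move=> w [/= + _]; rewrite in_itv/= => /andP[w0 wt]; split=> //=.
by rewrite in_itv/= w0 (lt_trans wt).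
Qed.

Lemma mild_solves v t1 t x : 0 < t -> t < t1 ->
  duhamel_cvg eta v t x ->
  v t x = Defs.conv (K t) u0 x - 2%:R^-1 * duhamel eta v t x ->
  solves eta u0 (strip_sq t1 v) v t x.
Proof.
move=> t0 tt1 cv E.
have f0 w : w.1 <= 0 -> strip_sq t1 v w = 0 by move=> w0; rewrite /strip_sq ltNge w0.
have fv w : 0 < w.1 -> w.1 < t -> strip_sq t1 v w = v w.1 w.2 ^+ 2.
  by move=> w0 wt; rewrite /strip_sq w0 (lt_trans wt).
split; first exact/(duhamel_cvgE eta f0 fv).
by rewrite E (duhamelE f0 fv cv) heatE.
Qed.

Lemma solution_solves v t1 : t1 < T -> mild_solution eta T u0 v ->
  {ae mu, forall t, 0 < t < t1 -> {ae mu, forall x, solves eta u0 (strip_sq t1 v) v t x}}.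
Proof.
move=> t1T; apply: ae_imp => t ht /andP[t0 tt1].
have {}ht : {ae mu, forall x, duhamel_cvg eta v t x /\
    v t x = Defs.conv (K t) u0 x - 2%:R^-1 * duhamel eta v t x}.
  by apply: ht; rewrite in_itv/= t0 (lt_trans tt1).
by apply: ae_imp ht => x [cv E]; exact: mild_solves.
Qed.

Lemma solution_good v t1 : 0 < t1 -> t1 < T -> Linfty_Lp T p v -> mild_solution eta T u0 v ->
  exists2 M, 0 < M & {ae mu, forall t, 0 < t < t1 -> good_time eta t1 p u0 (strip_sq t1 v) v M t}.
Proof.
move=> t10 t1T [mv [M hM]] hsol; exists (Num.max M 1); first by rewrite lt_max ltr01 orbT.
have hcv : {ae mu, forall t, t \in `]0, T[ -> {ae mu, forall x, duhamel_cvg eta v t x}}.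
  apply: ae_imp hsol => t ht tT; have {}ht := ht tT.
  by apply: ae_imp ht => x [].
have fin := strip_sq_weight_finite heta t10 t1T mv hcv.
have ms := measurable_strip_sq (sub_strip t1T mv).
have mg : measurable_fun setT ((fun w => wgt w.2 * strip_sq t1 v w) : plane R -> R).
  by apply: measurable_funM => //; exact: measurable_wgt.
have g0 w : 0 <= wgt w.2 * strip_sq t1 v w by rewrite mulr_ge0 ?wgt_ge0 ?strip_sq_ge0.
have hfin := sing_volterra_ae_finite t10 mg g0 fin.
apply: ae_imp (ae_and (ae_and hM hfin) (solution_solves t1T hsol)) => t [[h1 h2] h3] tt.
have /andP[t0 tt1] := tt; have tT := lt_trans tt1 t1T.
split => //; last exact: h3.
- exact: (strip_section_measurable mv).
- apply: (@le_trans _ _ M%:E); first by apply: h1; rewrite in_itv/= t0.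
  by rewrite lee_fin le_max lexx.
Qed.

(** The excess [Z] of the square of a solution over a barrier satisfies the homogeneous linear
    Volterra inequality, hence vanishes. *)
Lemma solution_decay v t1 : 0 < t1 -> t1 < T -> Linfty_Lp T p v -> mild_solution eta T u0 v ->
  exists2 B, 0 < B & {ae mu, forall t, 0 < t < t1 -> {ae mu, forall x, `|v t x| <= B / cbrt t}}.
Proof.
move=> t10 t1T Lv hsol; have [mv _] := Lv.
have [M M0 hg] := solution_good t10 t1T Lv hsol.
have hC1 t x : 0 < t -> t <= t1 ->
    `|K t x| <= C * pois (cbrt t) x /\ `|G t x| <= C * gam (cbrt t) x.
  by move=> t0 tt1; apply: hC => //; rewrite (le_trans tt1)// ltW.
pose f := strip_sq t1 v.
have mf : measurable_fun setT (f : plane R -> R).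
  exact: (measurable_strip_sq (sub_strip t1T mv)).
have f0 w : 0 <= f w by exact: strip_sq_ge0.
have fsupp w : ~~ ((0 < w.1) && (w.1 < t1)) -> f w = 0.
  by move=> h; rewrite /f /strip_sq (negbTE h).
have lin := linear_inequality heta t10 C1 hC1 p1 d0 mu0 Nu0 mf f0 fsupp M0 hg.
have c30 := restart_cst_gt0 t1 C1 M0.
move: lin; set A := 16 * _ ^+ 2; set B := 8 * C * _ => lin.
have A0 : 0 < A by rewrite mulr_gt0// exprn_gt0.
have B0 : 0 < B by apply: mulr_gt0 => //; rewrite mulr_gt0.
clear c30 hg; clearbody A B.
pose kap := B * (36 * pi * (1 + cbrt t1 ^+ 2)).
have kap0 : 0 < kap.
  by rewrite mulr_gt0// mulr_gt0 ?mulr_gt0 ?pi_gt0// ltr_pwDl ?sqr_ge0.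
have [l l0 hl] : exists2 l, 0 <= l & (\int[mu]_s (sing t1 s * expR (- (l * s)))%:E <= ((2 * kap)^-1)%:E)%E.
  by apply: sing_laplace_small => //; rewrite invr_gt0 mulr_gt0.
have fin : (\int[mu2]_w (wgt w.2 * f w)%:E < +oo)%E.
  apply: (strip_sq_weight_finite heta t10 t1T mv).
  apply: ae_imp hsol => t ht tT; have {}ht := ht tT.
  by apply: ae_imp ht => x [].
pose b w := barrier t1 (2 * A) l w.
have A20 : 0 <= 2 * A by rewrite mulr_ge0// ltW.
have mb : measurable_fun setT (b : plane R -> R) by exact: measurable_barrier.
have b0 w : 0 <= b w by exact: barrier_ge0.
pose Z w := Num.max 0 (f w - b w).
have Z0 w : 0 <= Z w by rewrite le_max lexx.
have mZ : measurable_fun setT (Z : plane R -> R).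
  by apply: measurable_maxr => //; exact: measurable_funB.
have Zf w : Z w <= f w.
  by rewrite ge_max; apply/andP; split; [exact: f0|rewrite lerBlDr lerDl; exact: b0].
have fbZ w : f w <= b w + Z w by rewrite -lerBlDl le_max lexx orbT.
have hZ : {ae mu, forall t, {ae mu, forall x, Z (t, x) = 0}}.
  apply: (vkers_vanish t10 B0 mZ Z0).
  - by move=> w h; have := Zf w; rewrite fsupp// => Zw; apply/eqP; rewrite eq_le Zw Z0.
  - apply: le_lt_trans fin; apply: le_ge0_integral => //.
    + by move=> w; rewrite mulr_ge0 ?wgt_ge0.
    + by apply: measurable_funM => //; exact: measurable_wgt.
    + by apply: measurable_funM => //; exact: measurable_wgt.
    + by move=> w; rewrite ler_wpM2l ?wgt_ge0.
  apply: ae_imp lin => t ht tt; have /andP[t0 tt1] := tt.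
  apply: ae_imp (ht tt) => x hx.
  have hV : (volterra (vkers t1) f (t, x) <= volterra (vkers t1) b (t, x) + volterra (vkers t1) Z (t, x))%E.
    have a1 := measurable_volterra_arg (t, x) (measurable_vkers t1) mb.
    have a2 := measurable_volterra_arg (t, x) (measurable_vkers t1) mZ.
    have n1 w : 0 <= vkers t1 (t - w.1, x - w.2) * b w by rewrite mulr_ge0 ?vkers_ge0.
    have n2 w : 0 <= vkers t1 (t - w.1, x - w.2) * Z w by rewrite mulr_ge0 ?vkers_ge0.
    rewrite /volterra; have <- := ge0_integralDr mu2 n1 n2 a1 a2.
    apply: le_ge0_integral => //.
    + by move=> w; rewrite mulr_ge0 ?vkers_ge0.
    + exact: (measurable_volterra_arg (t, x) (measurable_vkers t1) mf).
    + exact: measurable_funD.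
    + by move=> w /=; rewrite -mulrDr ler_wpM2l ?vkers_ge0.
  have hb := volterra_barrier_le x A20 l0 t0 tt1 hl.
  have ftx : f (t, x) = v t x ^+ 2 by rewrite /f /strip_sq/= t0 tt1.
  have V0 := volterra_ge0 (t, x) (@vkers_ge0 _ t1) Z0.
  have c0 := cbrt_gt0 t0; have ci : 0 <= (cbrt t ^+ 2)^-1 by rewrite invr_ge0 sqr_ge0.
  have E1 : 1 <= expR (l * t) by rewrite -expR0 ler_expR mulr_ge0// ltW.
  have btx : b (t, x) = 2 * A * ((cbrt t ^+ 2)^-1 * expR (l * t)) by rewrite /b /barrier/= singE.
  move: V0 hV; case: (volterra (vkers t1) Z (t, x)) => [V| |//] V0 hV; last first.
    by rewrite mulry gtr0_sg// mul1e leey.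
  rewrite lee_fin in V0.
  set Y := 16 * pi * _ * _ * _ in hb.
  have hf : (volterra (vkers t1) f (t, x) <= (Y + V)%:E)%E.
    by apply: (le_trans hV); rewrite EFinD; exact: leeD.
  have h : v t x ^+ 2 <= A / cbrt t ^+ 2 + B * (Y + V).
    rewrite -lee_fin; apply: (le_trans hx); rewrite EFinD; apply: leeD => //.
    by rewrite [leRHS]EFinM; apply: lee_wpmul2l => //; rewrite lee_fin ltW.
  rewrite -EFinM lee_fin.
  rewrite /Z ftx btx ge_max; apply/andP; split; first by rewrite mulr_ge0// ltW.
  rewrite lerBlDr addrC; apply: (le_trans h).
  rewrite [B * (_ + V)]mulrDr addrA lerD2r.
  rewrite (_ : B * Y = 16 * (36 * (1 + cbrt t1 ^+ 2))^-1 * A * ((cbrt t ^+ 2)^-1 * expR (l * t))); last first.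
    rewrite /Y /kap; move: ((cbrt t ^+ 2)^-1) => X.
    have := pi_gt0 R; move: (pi : R) => q qp.
    have s0 : 0 < 1 + cbrt t1 ^+ 2 by rewrite ltr_pwDl ?sqr_ge0.
    by field; rewrite !gt_eqF.
  set X := (cbrt t ^+ 2)^-1 * expR (l * t).
  have X0 : 0 <= X by rewrite mulr_ge0 ?expR_ge0.
  have AX : 0 <= A * X by rewrite mulr_ge0// ltW.
  have i1 : A / cbrt t ^+ 2 <= A * X by rewrite ler_wpM2l ?(ltW A0)// ler_peMr.
  (* One half of the barrier, of height [2 A X], pays for the inhomogeneous term and the
     other half for the Volterra operator applied to the barrier. *)
  have i2 : 16 * (36 * (1 + cbrt t1 ^+ 2))^-1 * A * X <= A * X.
    rewrite -mulrA ler_piMl// ler_pdivrMr ?mul1r ?mulr_gt0 ?ltr_pwDl ?sqr_ge0//.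
    have := sqr_ge0 (cbrt t1); lra.
  lra.
pose X := 2 * A * expR (l * t1).
have X0 : 0 <= X by rewrite mulr_ge0 ?expR_ge0.
exists (1 + X); first by rewrite ltr_pwDl.
apply: ae_imp hZ => t ht /andP[t0 tt1]; apply: ae_imp ht => x Ztx.
have c0 := cbrt_gt0 t0.
have := fbZ (t, x); rewrite Ztx addr0 /f /strip_sq /b /barrier/= t0 tt1/= singE// => h.
rewrite -(@ler_pXn2r _ 2) ?nnegrE ?divr_ge0 ?addr_ge0 ?(ltW c0)//.
rewrite real_normK ?num_real//; apply: (le_trans h).
rewrite expr_div_n mulrCA mulrC; apply: ler_wpM2r; first by rewrite invr_ge0 sqr_ge0.
apply: (@le_trans _ _ X).
  by rewrite ler_wpM2l// ler_expR ler_wpM2l// ltW.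
have := mulr_ge0 X0 X0; rewrite -!expr2; move: X X0 => X X0; nra.
Qed.

End decay.

(** * Uniqueness *)

Section uniqueness.
Context (R : realType) (eta : R) (heta : 0 < eta) (T : R) (T0 : 0 < T).
Local Notation mu := (@lebesgue_measure R).
Local Notation mu2 := (leb2 R).
Local Notation K := (Defs.Kernel eta).
Local Notation G := (dxKernel eta).
Local Notation Gc := (Gc eta).
Local Notation duh := (duh eta).
Context (C : R) (C1 : 1 <= C) (hC : forall t x, 0 < t -> t <= T ->
    `|K t x| <= C * pois (cbrt t) x /\ `|G t x| <= C * gam (cbrt t) x).
Context (p : \bar R) (p1 : (1 <= p)%E) (d : R) (d0 : 0 < d).
Context (u0 : R -> R) (mu0 : measurable_fun setT u0)
  (Nu0 : ('N[mu]_p[EFin \o u0] <= d%:E)%E).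
Implicit Types (t x y z s : R) (w : R * R) (v : R -> R -> R).

Let C0 : 0 < C. Proof. exact: lt_le_trans C1. Qed.

Lemma le_integral_nested (F H : R * R -> R) :
  measurable_fun setT (F : plane R -> R) -> (forall w, 0 <= F w) ->
  measurable_fun setT (H : plane R -> R) -> (forall w, 0 <= H w) ->
  {ae mu, forall t, {ae mu, forall x, F (t, x) <= H (t, x)}} ->
  (\int[mu2]_w (F w)%:E <= \int[mu2]_w (H w)%:E)%E.
Proof.
move=> mF F0 mH H0 FH; rewrite (tonelli_l mu mu mF F0) (tonelli_l mu mu mH H0).
apply: ae_ge0_le_integral => //.
- by move=> t _; apply: integral_ge0 => x _; rewrite lee_fin.
- exact: (measurable_tonelli mu mF F0).
- by move=> t _; apply: integral_ge0 => x _; rewrite lee_fin.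
- exact: (measurable_tonelli mu mH H0).
apply: ae_imp FH => t ht _; apply: ae_ge0_le_integral => //.
- by move=> x _; rewrite lee_fin.
- apply/measurable_EFinP; exact: (measurableT_comp mF (@pair1_measurable _ _ R R t)).
- by move=> x _; rewrite lee_fin.
- apply/measurable_EFinP; exact: (measurableT_comp mH (@pair1_measurable _ _ R R t)).
by apply: ae_imp ht => x hx _; rewrite lee_fin.
Qed.

(** The decay [B / cbrt t] linearizes the difference of squares; the difference of the solutions,
    divided by [cbrt t], then satisfies a homogeneous linear Volterra inequality. *)
Lemma decaying_solutions_eq t1 B v1 v2 : 0 < t1 -> t1 < T -> 0 < B ->
  measurable_fun (`]0, T[ `*` [set: R]) (fun z : R * R => v1 z.1 z.2) ->
  measurable_fun (`]0, T[ `*` [set: R]) (fun z : R * R => v2 z.1 z.2) ->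
  {ae mu, forall t, 0 < t < t1 -> {ae mu, forall x, solves eta u0 (strip_sq t1 v1) v1 t x}} ->
  {ae mu, forall t, 0 < t < t1 -> {ae mu, forall x, solves eta u0 (strip_sq t1 v2) v2 t x}} ->
  {ae mu, forall t, 0 < t < t1 -> {ae mu, forall x, `|v1 t x| <= B / cbrt t}} ->
  {ae mu, forall t, 0 < t < t1 -> {ae mu, forall x, `|v2 t x| <= B / cbrt t}} ->
  {ae mu, forall t, 0 < t < t1 -> {ae mu, forall x, v1 t x = v2 t x}}.
Proof.
move=> t10 t1T B0 mv1 mv2 sol1 sol2 dec1 dec2.
pose D w := if (0 < w.1) && (w.1 < t1) then v1 w.1 w.2 - v2 w.1 w.2 else 0.
have mD : measurable_fun setT (D : plane R -> R).
  apply: (measurable_on_strip (g := fun w => v1 w.1 w.2 - v2 w.1 w.2)).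
  by apply: measurable_funB; exact: (sub_strip t1T).
(* [sing t1 t * cbrt t = 1 / cbrt t].  The truncation by [2 * B] changes nothing almost
   everywhere, and makes [Z] bounded by a multiple of [sing] at every point. *)
pose Z w := Num.min (`|D w| * cbrt w.1) (2 * B) * sing t1 w.1.
have mZ : measurable_fun setT (Z : plane R -> R).
  apply: measurable_funM; last exact: measurable_sing.
  apply: measurable_minr => //; apply: measurable_funM; first exact: measurableT_comp.
  exact: measurable_cbrt.
have B20 : 0 <= 2 * B by rewrite mulr_ge0// ltW.
have cb0 s : 0 <= cbrt s by exact: cbrt_ge0.
have Z0 w : 0 <= Z w by rewrite mulr_ge0 ?sing_ge0// le_min B20 mulr_ge0.
have Zle w : Z w <= 2 * B * sing t1 w.1 by rewrite ler_wpM2r ?sing_ge0// ge_min lexx orbT.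
pose f1 := strip_sq t1 v1; pose f2 := strip_sq t1 v2.
have mf1 : measurable_fun setT (f1 : plane R -> R).
  exact: (measurable_strip_sq (sub_strip t1T mv1)).
have mf2 : measurable_fun setT (f2 : plane R -> R).
  exact: (measurable_strip_sq (sub_strip t1T mv2)).
have key t x : 0 < t -> t < t1 -> `|v1 t x| <= B / cbrt t -> `|v2 t x| <= B / cbrt t ->
    Z (t, x) = `|v1 t x - v2 t x| / cbrt t /\ `|f1 (t, x) - f2 (t, x)| <= 2 * B * Z (t, x).
  move=> t0 tt1 h1 h2; have c0 := cbrt_gt0 t0.
  have E : Z (t, x) = `|v1 t x - v2 t x| / cbrt t.
    rewrite /Z /D/= t0 tt1/= singE// min_l.
      by rewrite expr2 invfM mulrA mulfK ?gt_eqF.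
    rewrite -ler_pdivlMr//; apply: (le_trans (ler_normB _ _)).
    by rewrite -mulrA mulr_natl mulr2n; exact: lerD.
  split=> //; rewrite E /f1 /f2 /strip_sq/= t0 tt1/= subr_sqr normrM mulrCA.
  apply: ler_wpM2l => //; apply: (le_trans (ler_normD _ _)).
  by rewrite -mulrA mulr_natl mulr2n; exact: lerD.
have fin : (\int[mu2]_w (wgt w.2 * Z w)%:E < +oo)%E.
  have mS : measurable_fun setT ((fun w => 2 * B * (sing t1 w.1 * wgt w.2)) : plane R -> R).
    apply: measurable_funM => //; apply: measurable_funM; last exact: measurable_wgt.
    exact: measurable_sing.
  have S0 w : 0 <= 2 * B * (sing t1 w.1 * wgt w.2).
    by apply: mulr_ge0 => //; apply: mulr_ge0; [exact: sing_ge0|exact: wgt_ge0].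
  apply: (@le_lt_trans _ _ (\int[mu2]_w (2 * B * (sing t1 w.1 * wgt w.2))%:E)%E).
    apply: le_ge0_integral => //.
    - by move=> w; rewrite mulr_ge0 ?wgt_ge0.
    - by apply: measurable_funM => //; exact: measurable_wgt.
    - by move=> w; rewrite [leRHS]mulrA [leRHS]mulrC ler_wpM2l ?wgt_ge0.
  rewrite (tonelli_l mu mu mS S0).
  have s0 := sing_integrable t10.
  have ms : measurable_fun setT (fun s => 2 * B * pi * sing t1 s).
    by apply: measurable_funM => //; exact: measurable_sing.
  apply: (@le_lt_trans _ _ (\int[mu]_s (2 * B * pi * sing t1 s)%:E)%E).
    apply: ge0_le_integral => //.
    - by move=> t _; apply: integral_ge0 => x _; rewrite lee_fin; exact: (S0 (t, x)).
    - exact: (measurable_tonelli mu mS S0).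
    - exact/measurable_EFinP.
    move=> s _ /=.
    have b0 : 0 <= 2 * B * sing t1 s by rewrite mulr_ge0 ?sing_ge0.
    under eq_integral do rewrite mulrA.
    have -> := ge0_integralMl mu b0 (@wgt_ge0 R) (measurable_wgt (@measurable_id _ R setT)).
    rewrite (_ : 2 * B * pi * _ = 2 * B * sing t1 s * pi); last by ring.
    by rewrite [leRHS]EFinM; apply: lee_wpmul2l; [rewrite lee_fin|exact: integral_wgt_le].
  have b0 : 0 <= 2 * B * pi by rewrite mulr_ge0 ?pi_ge0.
  have -> := ge0_integralMl mu b0 (sing_ge0 t1) (measurable_sing _ (@measurable_id _ R setT)).
  by rewrite (Rintegral_fineK measurableT s0) -EFinM ltry.
have hZ : {ae mu, forall t, {ae mu, forall x, Z (t, x) = 0}}.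
  have BC0 : 0 < B * C by rewrite mulr_gt0.
  apply: (vkers_vanish t10 BC0 mZ Z0) => //.
    by move=> w h; rewrite /Z sing_out ?mulr0.
  have decZ : {ae mu, forall s, 0 < s < t1 -> {ae mu, forall y, `|f1 (s, y) - f2 (s, y)| <= 2 * B * Z (s, y)}}.
    apply: ae_imp (ae_and dec1 dec2) => s [h1 h2] ss; have /andP[s0 s1] := ss.
    by apply: ae_imp (ae_and (h1 ss) (h2 ss)) => y [a1 a2]; have [] := key s y s0 s1 a1 a2.
  apply: ae_imp (ae_and (ae_and dec1 dec2) (ae_and sol1 sol2)) => t [[h1 h2] [h3 h4]] tt.
  have /andP[t0 tt1] := tt; have c0 := cbrt_gt0 t0.
  apply: ae_imp (ae_and (ae_and (h1 tt) (h2 tt)) (ae_and (h3 tt) (h4 tt))) => x [[a1 a2] [[i1 e1] [i2 e2]]].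
  have [-> _] := key t x t0 tt1 a1 a2.
  have mdf : measurable_fun setT ((fun w => f1 w - f2 w) : plane R -> R).
    exact: measurable_funB.
  have mG := measurable_duh_arg heta (t, x) mdf.
  have mH : measurable_fun setT ((fun w => 2 * (B * C * cbrt t) * (vkers t1 (t - w.1, x - w.2) * Z w)) :
      plane R -> R).
    apply: measurable_funM => //.
    exact: (measurable_volterra_arg (t, x) (measurable_vkers t1) mZ).
  have BCt0 : 0 <= 2 * (B * C * cbrt t) by rewrite mulr_ge0// mulr_ge0// ltW.
  have nV w : 0 <= vkers t1 (t - w.1, x - w.2) * Z w by rewrite mulr_ge0 ?vkers_ge0.
  have H0 w : 0 <= 2 * (B * C * cbrt t) * (vkers t1 (t - w.1, x - w.2) * Z w) by rewrite mulr_ge0.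
  have dE : v1 t x - v2 t x = - (2^-1 * duh (fun w => f1 w - f2 w) (t, x)).
    have -> : duh (fun w => f1 w - f2 w) (t, x) = duh f1 (t, x) - duh f2 (t, x).
      rewrite /duh -(RintegralB measurableT i1 i2).
      by apply: eq_Rintegral => w _; rewrite mulrBr.
    by rewrite e1 e2; ring.
  have bnd : (`|duh (fun w => f1 w - f2 w) (t, x)|%:E <=
      (2 * (B * C * cbrt t))%:E * volterra (vkers t1) Z (t, x))%E.
    apply: (le_trans (abs_Rintegral_le mu2 measurableT mG)).
    have <- := ge0_integralMl mu2 BCt0 nV (measurable_volterra_arg (t, x) (measurable_vkers t1) mZ).
    apply: le_integral_nested => //; first exact: measurableT_comp.
    apply: ae_imp decZ => s hs /=.
    have [ss|ss] := boolP (0 < s < t1); last first.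
      apply: aeW => y; rewrite /f1 /f2 /strip_sq/= (negbTE ss) subrr mulr0 normr0.
      exact: (H0 (s, y)).
    apply: ae_imp (hs ss) => y hy; have /andP[s0 s1] := ss.
    have [ts|st] := leP t s.
      rewrite Gc0 ?subr_le0// mul0r normr0; exact: (H0 (s, y)).
    have q0 : 0 < t - s by rewrite subr_gt0.
    have qt1 : t - s < t1 by rewrite (le_lt_trans _ tt1)// gerBl ltW.
    have r0 := cbrt_gt0 q0.
    have hg : `|Gc (t - s, x - y)| <= C * (cbrt t * vkers t1 (t - s, x - y)).
      rewrite GcE//; have [_ hG] := hC (x - y) q0 (ltW (lt_trans qt1 t1T)).
      apply: (le_trans hG); apply: ler_wpM2l; first exact: ltW.
      apply: (@le_trans _ _ (cbrt (t - s) * vker t1 (t - s, x - y))).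
        by rewrite /vker/= q0 qt1/= mulrCA divff ?mulr1// gt_eqF.
      apply: ler_pM => //; first exact: vker_ge0.
        by apply: cbrt_le; [exact: ltW|rewrite gerBl ltW].
      by rewrite /vkers lerDl; exact: vavg_ge0.
    rewrite normrM [leRHS](_ : _ = C * (cbrt t * vkers t1 (t - s, x - y)) * (2 * B * Z (s, y))); last by ring.
    by apply: ler_pM.
  rewrite dE normrN normrM ger0_norm// mulrAC EFinM.
  have -> : ((B * C)%:E * volterra (vkers t1) Z (t, x) =
      (2^-1 / cbrt t)%:E * ((2 * (B * C * cbrt t))%:E * volterra (vkers t1) Z (t, x)))%E.
    rewrite muleA -EFinM; congr (_%:E * _)%E; field; by rewrite gt_eqF.
  by apply: lee_wpmul2l => //; rewrite lee_fin divr_ge0.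
apply: ae_imp (ae_and hZ (ae_and dec1 dec2)) => t [ht [h1 h2]] tt.
have /andP[t0 tt1] := tt.
apply: ae_imp (ae_and ht (ae_and (h1 tt) (h2 tt))) => x [Ztx [a1 a2]].
have [E _] := key t x t0 tt1 a1 a2.
move: Ztx; rewrite E => /eqP; rewrite mulf_eq0 invr_eq0 (gt_eqF (cbrt_gt0 t0)) orbF.
by rewrite normr_eq0 subr_eq0 => /eqP.
Qed.

(** The weighted bound for [v^2] holds on strips ending before [T], and these exhaust the
    time interval. *)
Lemma mild_solution_unique v1 v2 : Linfty_Lp T p v1 -> Linfty_Lp T p v2 ->
  mild_solution eta T u0 v1 -> mild_solution eta T u0 v2 ->
  {ae mu, forall t, t \in `]0, T[ -> {ae mu, forall x, v1 t x = v2 t x}}.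
Proof.
move=> L1 L2 s1 s2; have [m1 _] := L1; have [m2 _] := L2.
pose e n : R := T - T / n.+2%:R.
have T2 n : 0 < T / n.+2%:R :> R by rewrite divr_gt0.
have eT n : e n < T by rewrite /e gtrBl.
have e0 n : 0 < e n by rewrite subr_gt0 ltr_pdivrMr// ltr_pMr// ltr1n.
have h n : {ae mu, forall t, 0 < t < e n -> {ae mu, forall x, v1 t x = v2 t x}}.
  have [B1 B10 d1] := solution_decay heta C1 hC p1 d0 mu0 Nu0 (e0 n) (eT n) L1 s1.
  have [B2 B20 d2] := solution_decay heta C1 hC p1 d0 mu0 Nu0 (e0 n) (eT n) L2 s2.
  have B0 : 0 < B1 + B2 by exact: addr_gt0.
  apply: (decaying_solutions_eq (e0 n) (eT n) B0 m1 m2 (solution_solves (eT n) s1) (solution_solves (eT n) s2)).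
  - apply: ae_imp d1 => t ht tt; apply: ae_imp (ht tt) => x /le_trans; apply.
    by apply: ler_wpM2r; rewrite ?invr_ge0 ?cbrt_ge0// lerDl ltW.
  - apply: ae_imp d2 => t ht tt; apply: ae_imp (ht tt) => x /le_trans; apply.
    by apply: ler_wpM2r; rewrite ?invr_ge0 ?cbrt_ge0// lerDr ltW.
apply: ae_imp (ae_nat h) => t ht; rewrite in_itv/= => /andP[t0 tT].
have Tt : 0 < T - t by rewrite subr_gt0.
have [n hn] : exists n, T / (T - t) < n.+2%:R.
  exists (Num.truncn (T / (T - t))); apply: (lt_trans (truncnS_gt _)); by rewrite ltr_nat.
apply: (ht n); rewrite t0/= /e ltrBrDr addrC -ltrBrDr.
by rewrite ltr_pdivrMr// mulrC -ltr_pdivrMr.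
Qed.

End uniqueness.

(** * Well-posedness *)

Theorem theorem4 (R : realType) (eta T : R) (heta : 0 < eta) (hT : 0 < T) :
  exists2 delta : R, 0 < delta &
    forall (p : \bar R) (u0 : R -> R), (1 <= p)%E ->
      u0 \in Lfun lebesgue_measure p ->
      ('N[lebesgue_measure]_p[EFin \o u0] < delta%:E)%E ->
      exists u : R -> R -> R,
        (Linfty_Lp T p u /\ (sup_weighted_norm T p u < +oo)%E /\
         mild_solution eta T u0 u) /\
        forall v : R -> R -> R,
          Linfty_Lp T p v -> (sup_weighted_norm T p v < +oo)%E ->
          mild_solution eta T u0 v ->
          {ae @lebesgue_measure R, forall t, t \in `]0, T[ ->
            {ae @lebesgue_measure R, forall x, v t x = u t x}}.
Proof.
have [C C1 hC] := kernel_bounds heta hT.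
have C0 : 0 < C by exact: lt_le_trans C1.
have Sint := sing_integrable hT.
pose S := \int[lebesgue_measure]_s sing T s.
have hS : (\int[@lebesgue_measure R]_s (sing T s)%:E <= S%:E)%E.
  by rewrite (Rintegral_fineK measurableT Sint).
have S0 : 0 <= S by apply: Rintegral_ge0 => s _; exact: sing_ge0.
(* Smallness condition for the iteration; [S + 1] replaces [S] to keep [d] well defined. *)
pose A := 64 * pi * C ^+ 2 * (pi * cbrt T + 1).
have A0 : 0 < A.
  apply: mulr_gt0; last by rewrite ltr_wpDl// mulr_ge0 ?pi_ge0 ?cbrt_ge0.
  by apply: mulr_gt0; [rewrite mulr_gt0 ?pi_gt0|rewrite exprn_gt0].
pose d := (A * (S + 1))^-1.
have d0 : 0 < d by rewrite invr_gt0 mulr_gt0// ltr_wpDl.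
have dS : A * S * d <= 1.
  rewrite /d ler_pdivrMr ?mul1r; last by rewrite mulr_gt0// ltr_wpDl.
  by rewrite ler_pM2l// lerDl.
exists d => // p u0 p1 u0L /ltW Nu0.
have mu0 : measurable_fun setT u0.
  by have := u0L; rewrite inE => /andP[]; rewrite inE.
pose U := picard_lim eta T u0.
have mU : measurable_fun setT (U : plane R -> R).
  exact: (measurable_picard_lim heta C1 hC hS p1 d0 mu0 Nu0 dS).
pose u t x := U (t, x).
have Nu t : 0 < t -> t < T -> ('N[lebesgue_measure]_p[EFin \o u t] <= (2 * C * pi * d)%:E)%E.
  exact: (picard_lim_Lnorm heta C1 hC hS p1 d0 mu0 Nu0 dS).
have Lu : Linfty_Lp T p u.
  split.
    rewrite (_ : (fun z : R * R => u z.1 z.2) = U); first exact: measurable_funTS.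
    by apply/funext => -[].
  exists (2 * C * pi * d); apply: aeW => t; rewrite in_itv/= => /andP[t0 tT].
  exact: Nu.
have su : mild_solution eta T u0 u.
  apply: aeW => t; rewrite in_itv/= => /andP[t0 tT]; apply: aeW => x; split.
    exact: (picard_lim_duhamel_cvg heta C1 hC hS p1 d0 mu0 Nu0 dS).
  exact: (picard_lim_eq heta C1 hC hS p1 d0 mu0 Nu0 dS).
exists u; split; last first.
  move=> v Lv _ sv.
  exact: (mild_solution_unique heta hT C1 hC p1 d0 mu0 Nu0 Lv Lu sv su).
split=> //; split=> //.
have M0 : 0 <= 2 * C * pi * d.
  by apply: mulr_ge0; [apply: mulr_ge0; [apply: mulr_ge0 => //; exact: ltW|exact: pi_ge0]|exact: ltW].
apply: (@le_lt_trans _ _ (cbrt T * (2 * C * pi * d))%:E); last exact: ltry.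
apply: ge_ereal_sup => b [t /=]; rewrite in_itv/= => /andP[t0 tT] <-.
rewrite EFinM; apply: lee_pmul; [by rewrite lee_fin cbrt_ge0|exact: Lnorm_ge0| |exact: Nu].
by rewrite lee_fin; apply: cbrt_le; exact: ltW.
Qed.
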